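(* Let $n\ge 2$ and let $p>n$ be a prime. Let $\lambda\in P$ be a regular weight, $1\le k\le n-1$ and $\alpha\in\mathbb K$ with $\alpha\ne0$. Then the baby Verma module $V(\mathfrak b_{k,\alpha},\lambda)$ is an indecomposable $U_\chi$-module.
   Context: $\mathbb K$ is an algebraically closed field of characteristic $p$. For $X\in\mathfrak{sl}_n(\mathbb K)$, $X^{[p]}$ is the $p$-th matrix power. $\chi\in\mathfrak{sl}_n(\mathbb K)^*$ vanishes on upper triangular matrices (diagonal included), and for $i>j$: $\chi(E_{i,j})=1$ if $i=j+1$ and $1\le j\le n-2$, and $\chi(E_{i,j})=0$ otherwise. $U_\chi=U(\mathfrak{sl}_n(\mathbb K))/(X^p-X^{[p]}-\chi(X)^p: X\in\mathfrak{sl}_n(\mathbb K))$. $P$ is the weight lattice of $SL_n(\mathbb K)$ for the diagonal torus and upper triangular Borel subgroup, $\varpi_1,\dots,\varpi_{n-1}$ the fundamental weights and $\rho=\sum\varpi_i$. A weight $\lambda\in P$ is called regular if it lies in the interior of $C_0=\{\lambda\in P:\lambda+\rho=\sum r_i\varpi_i,\ r_i\ge 0,\ r_1+\cdots+r_{n-1}\le p\}$, i.e. $\lambda+\rho=\sum r_i\varpi_i$ with all $r_i>0$ and $r_1+\cdots+r_{n-1}<p$. Let $v_1,\dots,v_n$ be the standard basis of $\mathbb K^n$. For a basis $u_1,\dots,u_n$ of $\mathbb K^n$ let $\mathcal F(u_1,\dots,u_n)$ be the complete flag whose $m$-dimensional member is spanned by $u_1,\dots,u_m$. For $1\le k\le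 n-1$ and $\alpha\in\mathbb K$, $$\mathcal F_{k,\alpha}=\mathcal F(v_1,\dots,v_{k-1},\,v_k+\alpha v_n,\,v_n,\,v_{k+1},\dots,v_{n-1}),$$ and $\mathfrak b_{k,\alpha}\subset\mathfrak{sl}_n(\mathbb K)$ is the Borel subalgebra stabilising $\mathcal F_{k,\alpha}$; one has $\chi(\mathfrak b_{k,\alpha})=0$. For a Borel subalgebra $\mathfrak b$ with $\chi(\mathfrak b)=0$, let $U_0(\mathfrak b)\subset U_\chi$ be the subalgebra generated by $\mathfrak b$. Choose $g\in SL_n(\mathbb K)$ conjugating $\mathfrak b$ to the algebra $\mathfrak b_+$ of upper triangular matrices. Let $\mathbb K_\lambda$ be the one-dimensional $U_0(\mathfrak b)$-module obtained through conjugation by $g$ from the one-dimensional $\mathfrak b_+$-module annihilated by strictly upper triangular matrices and on which diagonal matrices act via $\lambda$ modulo $p$ (it does not depend on $g$). The baby Verma module is $V(\mathfrak b,\lambda)=U_\chi\otimes_{U_0(\mathfrak b)}\mathbb K_\lambda$. *)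

(* Defs.v *)
From HB Require Import structures.
From mathcomp Require Import all_boot all_order all_algebra.
From mathcomp Require Import boolp.
From mathcomp Require Import finmap monalg.

Set Implicit Arguments.
Unset Strict Implicit.
Unset Printing Implicit Defensive.

Import GRing.Theory Num.Theory.
Local Open Scope ring_scope.
Local Open Scope quotient_scope.

(* R / (S), for the two-sided ideal (S) generated by a subset S. A quotient   *)
(* may be the zero ring, hence the use of [pzRingType] throughout.            *)
Section RingQuotient.
Variables (R : pzRingType) (S : R -> Prop).

Inductive two_sided_ideal : R -> Prop :=
| Ideal_gen x of S x : two_sided_ideal x
| Ideal_zero : two_sided_ideal 0
| Ideal_add x y of two_sided_ideal x & two_sided_ideal y :
    two_sided_ideal (x + y)
| Ideal_mull a x of two_sided_ideal x : two_sided_ideal (a * x)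
| Ideal_mulr a x of two_sided_ideal x : two_sided_ideal (x * a).

Definition ideal_pred : {pred R} := fun x => `[< two_sided_ideal x >].

Lemma ideal_pred_zmod_closed : zmod_closed ideal_pred.
Proof.
split=> [|x y /asboolP xI /asboolP yI]; apply/asboolP; first exact: Ideal_zero.
by apply: Ideal_add => //; rewrite -mulN1r; apply: Ideal_mull.
Qed.

HB.instance Definition _ :=
  GRing.isZmodClosed.Build R ideal_pred ideal_pred_zmod_closed.

Definition quot_ring := Quotient.quot ideal_pred.

HB.instance Definition _ := GRing.Zmodule.on quot_ring.

Definition quot_proj (x : R) : quot_ring := \pi_(quot_ring) x.

Lemma quot_projP x y : (quot_proj x = quot_proj y) <-> two_sided_ideal (x - y).
Proof.
split=> [/eqP|xy]; first by rewrite -Quotient.idealrBE => /asboolP.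
by apply/eqP; rewrite -Quotient.idealrBE; apply/asboolP.
Qed.

Lemma quot_projK (x : quot_ring) : quot_proj (repr x) = x.
Proof. exact: reprK. Qed.

Lemma quot_projD : {morph quot_proj : x y / x + y}.
Proof. by move=> x y; rewrite /quot_proj !piE. Qed.

Definition quot_one : quot_ring := quot_proj 1.
Definition quot_mul (x y : quot_ring) : quot_ring :=
  quot_proj (repr x * repr y).

Lemma quot_projM x y : quot_proj (x * y) = quot_mul (quot_proj x) (quot_proj y).
Proof.
apply/quot_projP; set x' := repr _; set y' := repr _.
have xx' : two_sided_ideal (x - x') by apply/quot_projP; rewrite quot_projK.
have yy' : two_sided_ideal (y - y') by apply/quot_projP; rewrite quot_projK.
have -> : x * y - x' * y' = (x - x') * y + x' * (y - y').
  by rewrite mulrBl mulrBr addrA subrK.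
by apply: Ideal_add; [apply: Ideal_mulr | apply: Ideal_mull].
Qed.

Lemma quot_mulA : associative quot_mul.
Proof.
move=> x y z; rewrite -[x]quot_projK -[y]quot_projK -[z]quot_projK.
by rewrite -!quot_projM mulrA.
Qed.

Lemma quot_mul1x : left_id quot_one quot_mul.
Proof. by move=> x; rewrite -[x]quot_projK -quot_projM mul1r. Qed.

Lemma quot_mulx1 : right_id quot_one quot_mul.
Proof. by move=> x; rewrite -[x]quot_projK -quot_projM mulr1. Qed.

Lemma quot_mulDl : left_distributive quot_mul +%R.
Proof.
move=> x y z; rewrite -[x]quot_projK -[y]quot_projK -[z]quot_projK.
by rewrite -quot_projD -!quot_projM mulrDl quot_projD.
Qed.

Lemma quot_mulDr : right_distributive quot_mul +%R.
Proof.
move=> x y z; rewrite -[x]quot_projK -[y]quot_projK -[z]quot_projK.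
by rewrite -quot_projD -!quot_projM mulrDr quot_projD.
Qed.

HB.instance Definition _ := GRing.Zmodule_isPzRing.Build quot_ring
  quot_mulA quot_mul1x quot_mulx1 quot_mulDl quot_mulDr.

Lemma quot_proj_is_zmod_morphism : zmod_morphism quot_proj.
Proof. by move=> x y; rewrite /quot_proj !piE. Qed.

Lemma quot_proj_is_monoid_morphism : monoid_morphism quot_proj.
Proof. by split=> // x y; rewrite quot_projM. Qed.

HB.instance Definition _ :=
  GRing.isZmodMorphism.Build R quot_ring quot_proj quot_proj_is_zmod_morphism.
HB.instance Definition _ :=
  GRing.isMonoidMorphism.Build R quot_ring quot_proj
    quot_proj_is_monoid_morphism.

End RingQuotient.

Section ModuleQuotient.
Variables (R : pzRingType) (V : lmodType R) (S : V -> Prop).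

Inductive submodule_span : V -> Prop :=
| Span_gen v of S v : submodule_span v
| Span_zero : submodule_span 0
| Span_add v w of submodule_span v & submodule_span w : submodule_span (v + w)
| Span_scale a v of submodule_span v : submodule_span (a *: v).

Definition span_pred : {pred V} := fun v => `[< submodule_span v >].

Lemma span_pred_zmod_closed : zmod_closed span_pred.
Proof.
split=> [|x y /asboolP xI /asboolP yI]; apply/asboolP; first exact: Span_zero.
by apply: Span_add => //; rewrite -scaleN1r; apply: Span_scale.
Qed.

HB.instance Definition _ :=
  GRing.isZmodClosed.Build V span_pred span_pred_zmod_closed.

Definition quot_lmod := Quotient.quot span_pred.

HB.instance Definition _ := GRing.Zmodule.on quot_lmod.

Definition lmod_proj (v : V) : quot_lmod := \pi_(quot_lmod) v.

Lemma lmod_projP v w : (lmod_proj v = lmod_proj w) <-> submodule_span (v - w).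
Proof.
split=> [/eqP|vw]; first by rewrite -Quotient.idealrBE => /asboolP.
by apply/eqP; rewrite -Quotient.idealrBE; apply/asboolP.
Qed.

Lemma lmod_projK (v : quot_lmod) : lmod_proj (repr v) = v.
Proof. exact: reprK. Qed.

Lemma lmod_projD : {morph lmod_proj : v w / v + w}.
Proof. by move=> v w; rewrite /lmod_proj !piE. Qed.

Definition quot_scale (a : R) (v : quot_lmod) : quot_lmod :=
  lmod_proj (a *: repr v).

Lemma lmod_projZ a v : lmod_proj (a *: v) = quot_scale a (lmod_proj v).
Proof.
apply/lmod_projP; rewrite -scalerBr; apply: Span_scale.
by apply/lmod_projP; rewrite lmod_projK.
Qed.

Lemma quot_scaleA a b v : quot_scale a (quot_scale b v) = quot_scale (a * b) v.
Proof. by rewrite -[v]lmod_projK -!lmod_projZ scalerA. Qed.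

Lemma quot_scale1 : left_id 1 quot_scale.
Proof. by move=> v; rewrite -[v]lmod_projK -lmod_projZ scale1r. Qed.

Lemma quot_scaleDr : right_distributive quot_scale +%R.
Proof.
move=> a v w; rewrite -[v]lmod_projK -[w]lmod_projK.
by rewrite -lmod_projD -!lmod_projZ scalerDr lmod_projD.
Qed.

Lemma quot_scaleDl v : {morph quot_scale^~ v : a b / a + b}.
Proof.
by move=> a b; rewrite -[v]lmod_projK -!lmod_projZ scalerDl lmod_projD.
Qed.

HB.instance Definition _ := GRing.Zmodule_isLmodule.Build R quot_lmod
  quot_scaleA quot_scale1 quot_scaleDr quot_scaleDl.

Lemma lmod_proj_is_linear : linear lmod_proj.
Proof. by move=> a v w; rewrite lmod_projD lmod_projZ. Qed.

HB.instance Definition _ :=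
  GRing.isLinear.Build R V quot_lmod *:%R lmod_proj lmod_proj_is_linear.

End ModuleQuotient.

(* The free left U-module on a set M; [monalg] only provides scaling over     *)
(* nonzero rings, whence the copy.                                            *)
Section FreeModule.
Variables (U : pzRingType) (M : choiceType).

Definition free_lmod := {malg U[M]}.

HB.instance Definition _ := GRing.Zmodule.on free_lmod.

Definition free_scale (a : U) (f : free_lmod) : free_lmod :=
  [malg m in msupp f => a * f@_m].

Lemma free_scaleE a f m : (free_scale a f)@_m = a * f@_m.
Proof. by rewrite mcoeffE; case: msuppP; rewrite ?mulr0. Qed.

Lemma free_scaleA a b f : free_scale a (free_scale b f) = free_scale (a * b) f.
Proof. by apply/malgP=> m; rewrite !free_scaleE mulrA. Qed.

Lemma free_scale1 : left_id 1 free_scale.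
Proof. by move=> f; apply/malgP=> m; rewrite free_scaleE mul1r. Qed.

Lemma free_scaleDr : right_distributive free_scale +%R.
Proof.
by move=> a f g; apply/malgP=> m; rewrite mcoeffD !free_scaleE mcoeffD mulrDr.
Qed.

Lemma free_scaleDl f : {morph free_scale^~ f : a b / a + b}.
Proof.
by move=> a b; apply/malgP=> m; rewrite mcoeffD !free_scaleE mulrDl.
Qed.

HB.instance Definition _ := GRing.Zmodule_isLmodule.Build U free_lmod
  free_scaleA free_scale1 free_scaleDr free_scaleDl.

Definition free_elt (u : U) (m : M) : free_lmod := << u *g m >>.

End FreeModule.

(* U (x)_B M for a subring B of U and a left B-module M. The pair (B, M) is   *)
(* given by the graph [act] of the action: [act b m m'] means that b is in B  *)
(* and b m = m'. In [free_lmod U M], additivity in the left factor holds by   *)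
(* construction.                                                              *)
Section Tensor.
Variables (U : pzRingType) (M : zmodType) (act : U -> M -> M -> Prop).

Inductive tensor_relation : free_lmod U M -> Prop :=
| Tensor_addr u m m' :
    tensor_relation (free_elt u (m + m') - (free_elt u m + free_elt u m'))
| Tensor_balanced u b m m' of act b m m' :
    tensor_relation (free_elt (u * b) m - free_elt u m').

Definition tensor := quot_lmod tensor_relation.

End Tensor.

Section Indecomposable.
Variables (R : pzRingType) (V : lmodType R).

Definition indecomposable : Prop :=
  (exists v : V, v != 0) /\
  forall W1 W2 : {pred V},
    submod_closed W1 -> submod_closed W2 ->
    (forall v, exists2 w1, w1 \in W1 & v - w1 \in W2) ->
    (forall v, v \in W1 -> v \in W2 -> v = 0) ->
    (forall v, v \in W1 -> v = 0) \/ (forall v, v \in W2 -> v = 0).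

End Indecomposable.

(* Enveloping algebras of a Lie algebra L over K with bracket br. They are    *)
(* kept as rings U with a map K -> U rather than [algType]s, because an       *)
(* [algType] has to be nonzero.                                               *)
Section Enveloping.
Variables (K : fieldType) (L : lmodType K) (br : L -> L -> L).

Definition free_alg := {malg K[{fmonom L}]}.

Definition free_gen (x : L) : free_alg := << fmu x >>.

Inductive env_relation : free_alg -> Prop :=
| Env_linear (a : K) x y :
    env_relation (free_gen (a *: x + y) - (a *: free_gen x + free_gen y))
| Env_bracket x y :
    env_relation
      (free_gen x * free_gen y - free_gen y * free_gen x - free_gen (br x y)).

Definition env_alg := quot_ring env_relation.

Definition env_gen (x : L) : env_alg := quot_proj env_relation (free_gen x).
Definition env_scalar (a : K) : env_alg := quot_proj env_relation a%:A.

Variables (p : nat) (pmap : L -> L) (chi : L -> K).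

Inductive red_relation : env_alg -> Prop :=
| Red_pchar x :
    red_relation
      (env_gen x ^+ p - env_gen (pmap x) - env_scalar (chi x ^+ p)).

Definition red_env_alg := quot_ring red_relation.

Definition red_gen (x : L) : red_env_alg := quot_proj red_relation (env_gen x).
Definition red_scalar (a : K) : red_env_alg :=
  quot_proj red_relation (env_scalar a).

End Enveloping.

Section TracePower.
Variables (K : fieldType) (p : nat).
Hypothesis charKp : p \in [pchar K].

Lemma det_expr n (A : 'M[{poly K}]_n) m : \det (A ^+ m) = \det A ^+ m.
Proof.
elim: m => [|m IHm]; first by rewrite !expr0 det1.
by rewrite !exprS -IHm -det_mulmx.
Qed.

Lemma poly_exp_pchar (q : {poly K}) i : (q ^+ p)`_(p * i) = q`_i ^+ p.
Proof.
have charP : p \in [pchar {poly K}] by exact: (rmorph_pchar polyC charKp).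
have p_gt0 : (0 < p)%N by rewrite prime_gt0 ?(pcharf_prime charKp).
pose Fr := pFrobenius_aut charKp.
suff -> : q ^+ p = map_poly Fr q \Po 'X^p.
  by rewrite coef_comp_poly_Xn // dvdn_mulr // mulKn // coef_map.
rewrite comp_polyE size_map_poly -(pFrobenius_autE charP).
rewrite -{1}[q]coefK poly_def raddf_sum; apply: eq_bigr => j _ /=.
by rewrite pFrobenius_autE exprZn coef_map -exprM mulnC exprM.
Qed.

Lemma mxtrace_exp_pchar n (A : 'M[K]_n) : \tr (A ^+ p) = \tr A ^+ p.
Proof.
have p_gt0 : (0 < p)%N by rewrite prime_gt0 ?(pcharf_prime charKp).
case: n A => [|n] A.
  by rewrite /mxtrace !big_ord0 expr0n gtn_eqF.
have charM : p \in [pchar 'M[{poly K}]_n.+1].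
  exact: (rmorph_pchar scalar_mx (rmorph_pchar polyC charKp)).
pose B : 'M[{poly K}]_n.+1 := map_mx polyC A.
have BX : map_mx polyC (A ^+ p) = B ^+ p by rewrite -rmorphXn.
have XX : ('X%:M : 'M[{poly K}]_n.+1) ^+ p = ('X ^+ p)%:M by rewrite -rmorphXn.
have eq1 : char_poly (A ^+ p) \Po 'X^p = char_poly A ^+ p.
  rewrite /char_poly -det_expr -[_ \Po _]/(comp_poly 'X^p _) -det_map_mx.
  congr (\det _); rewrite /char_poly_mx -(pFrobenius_autE charM).
  rewrite pFrobenius_autB_comm; last exact: comm_scalar_mx.
  rewrite !pFrobenius_autE XX -BX map_mxB map_scalar_mx /= comp_polyX.
  by congr (_ - _); apply/matrixP => i j; rewrite !mxE comp_polyC.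
have /(congr1 (fun q : {poly K} => q`_(p * n))) := eq1.
rewrite coef_comp_poly_Xn // dvdn_mulr // mulKn // poly_exp_pchar.
rewrite -[n in X in X = _ -> _]/(n.+1.-1) -[n in X in _ = X -> _]/(n.+1.-1).
rewrite !char_poly_trace // -pFrobenius_autE pFrobenius_autN.
by rewrite pFrobenius_autE => /oppr_inj.
Qed.

End TracePower.

Section SpecialLinear.
Variables (K : fieldType) (n : nat).

Definition traceless : {pred 'M[K]_n} := fun X => \tr X == 0.

Lemma traceless_submod_closed : submod_closed traceless.
Proof.
split=> [|a X Y /eqP trX /eqP trY].
  by rewrite /in_mem /= /traceless mxtrace0.
by rewrite /in_mem /= /traceless mxtraceD mxtraceZ trX trY mulr0 addr0.
Qed.

HB.instance Definition _ :=
  GRing.isSubmodClosed.Build K 'M[K]_n traceless traceless_submod_closed.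

Record sl := Sl { sl_val :> 'M[K]_n; sl_valP : sl_val \in traceless }.

HB.instance Definition _ := [isSub for sl_val].
HB.instance Definition _ := [Choice of sl by <:].
HB.instance Definition _ := [SubChoice_isSubLmodule of sl by <:].

Lemma sl_bracket_subproof (X Y : sl) : X *m Y - Y *m X \in traceless.
Proof.
by rewrite /in_mem /= /traceless mxtraceD raddfN /= mxtrace_mulC subrr.
Qed.

Definition sl_bracket (X Y : sl) : sl := Sl (sl_bracket_subproof X Y).

Variables (p : nat) (charKp : p \in [pchar K]).

Lemma sl_pmap_subproof (X : sl) : (X : 'M[K]_n) ^+ p \in traceless.
Proof.
have /eqP trX := sl_valP X; rewrite /in_mem /= /traceless.
rewrite (mxtrace_exp_pchar charKp) trX expr0n gtn_eqF //.
by rewrite prime_gt0 ?(pcharf_prime charKp).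
Qed.

Definition sl_pmap (X : sl) : sl := Sl (sl_pmap_subproof X).

(* X is the sum of the X i j *: E_(i, j), and (i, j) is counted from 0: the   *)
(* E_(j + 1, j) with 1 <= j <= n - 2 are the E_(j.+1, j) with j.+2 < n below. *)
Definition chi (X : sl) : K :=
  \sum_(i < n) \sum_(j < n | (i == j.+1 :> nat) && (j.+2 < n)%N) X i j.

Definition Uchi := red_env_alg sl_bracket p sl_pmap chi.

Definition Uchi_gen (X : sl) : Uchi := red_gen sl_bracket p sl_pmap chi X.
Definition Uchi_scalar (a : K) : Uchi := red_scalar sl_bracket p sl_pmap chi a.

(* A weight of SL_n is given by its coordinates on the fundamental weights:   *)
(* [lam i] is the coefficient of varpi_(i + 1).                               *)
Definition weight := {ffun 'I_n.-1 -> int}.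

Definition rho : weight := [ffun => 1].

Definition regular (lam : weight) : Prop :=
  (forall i, 0 < (lam + rho) i) /\ \sum_i (lam + rho) i < p%:Z.

(* The differential of varpi_(i + 1) maps diag(h_1, ..., h_n) to              *)
(* h_1 + ... + h_(i + 1).                                                     *)
Definition fund_weight (i : 'I_n.-1) (X : 'M[K]_n) : K :=
  \sum_(j < n | (j <= i)%N) X j j.

(* The one-dimensional representation of upper triangular matrices. *)
Definition weight_eval (lam : weight) (X : 'M[K]_n) : K :=
  \sum_i (lam i)%:~R * fund_weight i X.

Definition upper_triangular (X : 'M[K]_n) : Prop :=
  forall i j : 'I_n, (j < i)%N -> X i j = 0.

Definition conj_upper (b : sl -> Prop) (g : 'M[K]_n) : Prop :=
  forall X : sl, b X <-> upper_triangular (g *m X *m invmx g).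

(* [weight_action b lam g u c] means that u is in U_0(b) and acts on K_lam as  *)
(* c. This graph of the action U_0(b) -> End(K_lam) = K is the subalgebra of   *)
(* Uchi x K generated by the pairs (X, lam(g X g^-1)) with X in b.             *)
Inductive weight_action (b : sl -> Prop) (lam : weight) (g : 'M[K]_n) :
  Uchi -> K -> Prop :=
| Act_gen X of b X :
    weight_action b lam g (Uchi_gen X) (weight_eval lam (g *m X *m invmx g))
| Act_scalar a : weight_action b lam g (Uchi_scalar a) a
| Act_add u v c d of weight_action b lam g u c & weight_action b lam g v d :
    weight_action b lam g (u + v) (c + d)
| Act_mul u v c d of weight_action b lam g u c & weight_action b lam g v d :
    weight_action b lam g (u * v) (c * d).

Definition baby_verma (b : sl -> Prop) (lam : weight) (g : 'M[K]_n) :=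
  tensor (fun (u : Uchi) (m m' : K) =>
            exists2 c, weight_action b lam g u c & m' = c * m).

(* Numbered from 1, as is k below. *)
Definition std_vec (i : nat) : 'cV[K]_n := \col_j (j.+1 == i)%:R.

Definition flag_basis (k : nat) (alpha : K) : seq 'cV[K]_n :=
  [seq std_vec i | i <- index_iota 1 k] ++
  [:: std_vec k + alpha *: std_vec n; std_vec n] ++
  [seq std_vec i | i <- index_iota k.+1 n].

Definition flag (s : seq 'cV[K]_n) (m : nat) : {vspace 'cV[K]_n} :=
  <<take m s>>%VS.

Definition stabilises (X : 'M[K]_n) (F : nat -> {vspace 'cV[K]_n}) : Prop :=
  forall m v, v \in F m -> X *m v \in F m.

Definition borel (k : nat) (alpha : K) (X : sl) : Prop :=
  stabilises X (flag (flag_basis k alpha)).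

End SpecialLinear.

(* Main.v *)
(** The algebras b_(k, alpha) all lie in one parabolic subalgebra. Let m be the
    nilradical of the opposite parabolic; chi restricts to a character of m, and
    m acts on V modulo chi by nilpotent operators, so an endomorphism of V that
    sends V into m_chi V and is idempotent vanishes (Nakayama). The element
    E_(n, n) commutes with m up to elements of m killed by chi, and since
    alpha != 0 the quotient V / m_chi V is generated by the images of the highest
    weight vector under its powers; as X^p - X is separable, the quotient is a
    sum of at most one line for each eigenvalue in F_p. Two operators, built from
    (p - 1)-st powers of the root vectors between the chain 1, ..., n - 1 and n,
    send each line to a nonzero multiple of its neighbour, except where the
    scalar vanishes. Regularity of lambda confines the exceptions so that the
    raising and lowering arrows together connect all the lines. An idempotent
    endomorphism is therefore a scalar on V / m_chi V, hence 0 or 1.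

    That V is nonzero is not automatic, as U_chi is given by a presentation.
    It is deduced from the restricted Lie algebra of vector fields on the matrix
    space twisted by a linear form: modulo the p-th powers of the coordinates
    this gives an explicit U_chi-module that contains a highest weight vector. *)

From HB Require Import structures.
Require Import Defs.
From mathcomp Require Import all_boot all_order all_algebra.
From mathcomp Require Import boolp finmap monalg zify ring.
From mathcomp Require mpoly.

Set Implicit Arguments.
Unset Strict Implicit.
Unset Printing Implicit Defensive.

Import Order.TTheory GRing.Theory Num.Theory.
Local Open Scope ring_scope.

(** * Powers in characteristic p *)

(** Write s for the special index n - 1 and number the chain 0, ..., n - 2, so that k = j + 1. The
    obvious arrow E_(j, s) does not act on V / m_chi V when j > 0: its bracket with E_(s, j - 1),
    which lies in m, is E_(j, j - 1), where chi is 1. At j = 0 this obstruction is absent. Lowering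
    j by one trades a single root of m, (s, j - 1), for (j, s), and the (p - 1)-st power of the root
    vector that leaves m carries m_chi V for the one algebra into m_chi V for the other, because the
    p-th power is 0. Descending to j = 0, applying E_(0, s) and climbing back therefore gives an
    operator that preserves m_chi V; on a weight component it agrees with E_(j, s) up to a scalar.
    The arrow in the direction of E_(s, j) comes from the symmetry reversing the chain. The scalars
    are computed in F_p. With R = r_k + ... + r_(n - 1), the raising arrows join R consecutive
    weights of E_(s, s), and the lowering arrows join these to the other p - R. *)

Section CentralScalars.
Variables (K : fieldType) (p : nat) (charKp : p \in [pchar K]).
Variables (U : pzRingType) (c : {rmorphism K -> U}).
Hypothesis cC : forall a u, c a * u = u * c a.

Lemma pchar_mulrn (u : U) m : (p %| m)%N -> u *+ m = 0.
Proof.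
move=> /dvdnP[q ->]; rewrite mulrnA -[u *+ q]mul1r -mulrnAl.
by rewrite -(rmorph1 c) -rmorphMn /= (pcharf0 charKp) rmorph0 mul0r.
Qed.

Lemma pchar_exprD (u v : U) : GRing.comm u v -> (u + v) ^+ p = u ^+ p + v ^+ p.
Proof.
move=> uv; rewrite exprDn_comm //.
have p_pr := pcharf_prime charKp.
have [q pE] : exists q, p = q.+1 by exists p.-1; rewrite prednK ?prime_gt0.
rewrite -(big_mkord xpredT (fun i => u ^+ (p - i) * v ^+ i *+ 'C(p, i))).
rewrite big_nat_recl // pE big_nat_recr //= -pE subnn binn.
rewrite subn0 bin0 !expr0 mulr1 mul1r !mulr1n big_nat big1 ?add0r // => i iq.
by rewrite pchar_mulrn // prime_dvd_bin // pE ltnS.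
Qed.

Lemma pchar_oppX (a : K) : (- a) ^+ p = - a ^+ p.
Proof. by rewrite -[LHS](pFrobenius_autE charKp) pFrobenius_autN pFrobenius_autE. Qed.

Lemma pchar_subX (u : U) a : (u - c a) ^+ p = u ^+ p - c (a ^+ p).
Proof.
rewrite -rmorphN pchar_exprD; last exact/esym/cC.
by rewrite -rmorphXn /= pchar_oppX rmorphN.
Qed.

(** The sum of (i + 1)^(t + 1) - i^(t + 1) telescopes to p^(t + 1) = 0. Its binomial expansion is t
    + 1 times the t-th power sum plus multiples of lower power sums, and t + 1 < p is invertible. *)
Lemma sum_pow_lt t : (t < p.-1)%N -> \sum_(i < p) (i%:R : K) ^+ t = 0.
Proof.
have p_pr := pcharf_prime charKp.
have [m] := ubnP t; elim: m t => // m IHm t; rewrite ltnS => tm tp.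
have: \sum_(i < p) ((i.+1%:R : K) ^+ t.+1 - i%:R ^+ t.+1) = 0.
  rewrite -(big_mkord xpredT (fun i => i.+1%:R ^+ t.+1 - i%:R ^+ t.+1)).
  rewrite telescope_sumr //.
  by rewrite (pcharf0 charKp) expr0n /= subrr.
under eq_bigr => i _ do
  rewrite -natr1 exprDn big_ord_recl subn0 bin0 expr0 mulr1 mulr1n [X in X - _]addrC addrK.
rewrite exchange_big big_ord_recl /= [X in _ + X]big1 => [|j _].
  rewrite addr0; under eq_bigr => i _ do
    rewrite expr1n mulr1 /bump leq0n add1n bin1 subn1.
  rewrite sumrMnl -mulr_natl => /eqP; rewrite mulf_eq0 => /orP[|/eqP //].
  by rewrite -(dvdn_pcharf charKp) => /(dvdn_leq (ltn0Sn _)); lia.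
under eq_bigr => i _ do rewrite expr1n mulr1.
by rewrite sumrMnl IHm ?mul0rn // /bump /=; have := ltn_ord j; lia.
Qed.

Lemma fermat_pchar (i : nat) : (i%:R : K) ^+ p = i%:R.
Proof. by rewrite -[LHS](pFrobenius_autE charKp) pFrobenius_aut_nat. Qed.

Lemma sum_pow_pred : (2 < p)%N -> \sum_(i < p) (i%:R : K) ^+ p.-1 = -1.
Proof.
move=> p_gt2; have [q pE] : exists q, p = q.+3 by exists (p - 3)%N; lia.
rewrite -(big_mkord xpredT (fun i => (i%:R : K) ^+ p.-1)).
transitivity (\sum_(1 <= i < p) (1 : K)).
  rewrite big_ltn; last by lia.
  rewrite {1}pE /= expr0n /= add0r; apply: eq_big_nat => i ip.
  have iN0 : (i%:R : K) != 0.
    by rewrite -(dvdn_pcharf charKp); apply/negP => /dvdn_leq; lia.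
  apply: (mulfI iN0); rewrite mulr1 -exprS prednK; last by lia.
  exact: fermat_pchar.
rewrite big_const_nat iter_addr addr0 natrB; last by lia.
by rewrite (pcharf0 charKp) sub0r.
Qed.

(** Only the power sum of exponent p - 1 survives in the binomial expansion. Consequently the
    operators 1 - (u - i)^(p - 1), for i in F_p, add up to 1. *)
Lemma sum_shift_pow (u : U) : (2 < p)%N ->
  \sum_(i < p) (u - c i%:R) ^+ p.-1 = -1.
Proof.
move=> p_gt2; have p_pr := pcharf_prime charKp.
under eq_bigr => i _.
  rewrite exprBn_comm; last exact/esym/cC.
  over.
rewrite exchange_big big_ord_recr big1 => [|j _] /=.
  rewrite add0r subnn expr0 binn.
  under eq_bigr do rewrite mulr1 mulr1n -rmorphXn.
  rewrite -big_distrr /= -rmorph_sum /= sum_pow_pred // rmorphN rmorph1 mulrN1.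
  rewrite -signr_odd; have [p_eq2|p_odd] := even_prime p_pr.
    by rewrite p_eq2 in p_gt2.
  by case: (p) p_odd p_gt2 => //= q; case: (odd q) => //; rewrite expr0.
rewrite sumrMnl; under eq_bigr do rewrite -rmorphXn /=.
by rewrite -big_distrr /= -rmorph_sum /= sum_pow_lt // rmorph0 mulr0 mul0rn.
Qed.

End CentralScalars.

(** * Matrix units and the raising operator *)

Section GlOperators.
Variables (K : fieldType) (p : nat) (charKp : p \in [pchar K]).
Variables (U : pzRingType) (c : {rmorphism K -> U}).
Hypothesis cC : forall a u, c a * u = u * c a.
Variables (V : lmodType U) (n : nat).
Hypothesis n_gt1 : (1 < n)%N.
Hypothesis p_gt2 : (2 < p)%N.

Lemma cZC a u (x : V) : u *: (c a *: x) = c a *: (u *: x).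
Proof. by rewrite !scalerA cC. Qed.

Definition lie_gl (E : nat -> nat -> U) : Prop :=
  forall a b d e, (a < n)%N -> (b < n)%N -> (d < n)%N -> (e < n)%N ->
  E a b * E d e = E d e * E a b + E a e *+ (b == d) - E d b *+ (e == a).

(* chi is [gam] on the E_(a + 1, a) of the chain 0, ..., n - 2 and zero on    *)
(* the other off-diagonal matrix units.                                       *)
Definition chi_unit (gam : K) (a b : nat) : K :=
  if (a == b.+1) && (a < n.-1)%N then gam else 0.

Definition shifted_unit (E : nat -> nat -> U) gam a b : U :=
  E a b - c (chi_unit gam a b).

Definition reduced_gl (E : nat -> nat -> U) gam : Prop :=
  forall a b, (a < n)%N -> (b < n)%N -> a != b ->
  shifted_unit E gam a b ^+ p = 0.

(** With [P] the roots of m this is m_chi V. It is not a U-submodule, so stability under each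
    operator needs a proof. Scalars are central and are absorbed into [x], so closure under them is
    not imposed. *)
Inductive shifted_span E gam (P : rel nat) : V -> Prop :=
| Shifted_zero : shifted_span E gam P 0
| Shifted_add x y of shifted_span E gam P x & shifted_span E gam P y :
    shifted_span E gam P (x + y)
| Shifted_gen a b x of P a b :
    shifted_span E gam P (shifted_unit E gam a b *: x).

(* The grading in which the special index [n.-1] sits on top of [j]; the      *)
(* roots of positive degree span the algebra m.                               *)
Definition deg (j a : nat) : nat := if a == n.-1 then j else a.

Definition pos_root (j : nat) : rel nat :=
  fun a b => [&& (a < n)%N, (b < n)%N & (deg j b < deg j a)%N].

Section Span.
Variables (E : nat -> nat -> U) (gam : K).
Hypothesis glE : lie_gl E.

Lemma span_scale P a x : shifted_span E gam P x -> shifted_span E gam P (c a *: x).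
Proof.
elim=> [|y z _ IHy _ IHz|d e y de]; first by rewrite scaler0; exact: Shifted_zero.
  by rewrite scalerDr; exact: Shifted_add.
by rewrite -cZC; constructor.
Qed.

Lemma span_opp P x : shifted_span E gam P x -> shifted_span E gam P (- x).
Proof.
by move=> /(@span_scale P (-1)); rewrite rmorphN rmorph1 scaleN1r.
Qed.

Lemma span_sub P x y : shifted_span E gam P x -> shifted_span E gam P y ->
  shifted_span E gam P (x - y).
Proof. by move=> Px Py; constructor=> //; apply: span_opp. Qed.

Lemma span_mono (P Q : rel nat) x : (forall a b, P a b -> Q a b) ->
  shifted_span E gam P x -> shifted_span E gam Q x.
Proof.
move=> PQ; elim=> [|y z _ IHy _ IHz|a b y /PQ ab]; first exact: Shifted_zero.
  exact: Shifted_add.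
by constructor.
Qed.

Lemma span_stable (P Q : rel nat) u x :
  (forall a b y, P a b -> shifted_span E gam Q (u *: (shifted_unit E gam a b *: y))) ->
  shifted_span E gam P x -> shifted_span E gam Q (u *: x).
Proof.
move=> uP; elim=> [|y z _ IHy _ IHz|a b y /uP//]; first by rewrite scaler0; exact: Shifted_zero.
by rewrite scalerDr; exact: Shifted_add.
Qed.

Lemma span_unit (P : rel nat) a b x : P a b -> chi_unit gam a b = 0 ->
  shifted_span E gam P (E a b *: x).
Proof.
move=> ab chi0; have := Shifted_gen E gam x ab.
by rewrite /shifted_unit chi0 rmorph0 subr0.
Qed.

Lemma shifted_comm a b d e : (a < n)%N -> (b < n)%N -> (d < n)%N -> (e < n)%N ->
  E a b * shifted_unit E gam d e =
    shifted_unit E gam d e * E a b + E a e *+ (b == d) - E d b *+ (e == a).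
Proof.
move=> an bn dn en; rewrite mulrBr mulrBl glE // cC.
by rewrite -!addrA; congr (_ + _); rewrite [RHS]addrC -addrA.
Qed.

(** The commutator of E_(d, e) with a shifted unit consists of at most two unshifted units; the
    conditions on [P e b] and [P a d] say that their roots stay in [P] and that chi vanishes on
    them. *)
Lemma span_normalise (P : rel nat) d e x :
  (d < n)%N -> (e < n)%N ->
  (forall a b, P a b -> (a < n)%N /\ (b < n)%N) ->
  (forall b, P e b -> P d b /\ chi_unit gam d b = 0) ->
  (forall a, P a d -> P a e /\ chi_unit gam a e = 0) ->
  shifted_span E gam P x -> shifted_span E gam P (E d e *: x).
Proof.
move=> dn en Pn Pe Pd; apply: span_stable => a b y ab; have [an bn] := Pn _ _ ab.
rewrite scalerA shifted_comm // scalerBl scalerDl -!scalerA.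
apply: span_sub; first constructor; first by constructor.
  have [ea|_] := eqVneq; last by rewrite mulr0n scale0r; exact: Shifted_zero.
  by rewrite -ea in ab; have [? ?] := Pe _ ab; rewrite mulr1n; apply: span_unit.
have [bd|_] := eqVneq; last by rewrite mulr0n scale0r; exact: Shifted_zero.
by rewrite bd in ab; have [? ?] := Pd _ ab; rewrite mulr1n; apply: span_unit.
Qed.

Lemma span_normaliseX (P : rel nat) d e x m :
  (d < n)%N -> (e < n)%N ->
  (forall a b, P a b -> (a < n)%N /\ (b < n)%N) ->
  (forall b, P e b -> P d b /\ chi_unit gam d b = 0) ->
  (forall a, P a d -> P a e /\ chi_unit gam a e = 0) ->
  shifted_span E gam P x -> shifted_span E gam P (E d e ^+ m *: x).
Proof.
move=> dn en Pn Pe Pd; elim: m x => [|m IHm] x Px; first by rewrite scale1r.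
by rewrite exprS -scalerA; apply: span_normalise => //; apply: IHm.
Qed.

Hypothesis redE : reduced_gl E gam.

Lemma nilp_special_l b : (b < n.-1)%N -> E n.-1 b ^+ p = 0.
Proof.
move=> bn; rewrite -[RHS](redE (a := n.-1) (b := b)); try lia.
by rewrite /shifted_unit /chi_unit ltnn andbF rmorph0 subr0.
Qed.

Lemma nilp_special_r a : (a < n.-1)%N -> E a n.-1 ^+ p = 0.
Proof.
move=> an; rewrite -[RHS](redE (a := a) (b := n.-1)); try lia.
rewrite /shifted_unit /chi_unit; case: ifP => [|_]; first by lia.
by rewrite rmorph0 subr0.
Qed.

Definition common_root j : rel nat := fun a b => pos_root j.+1 a b && pos_root j a b.

Lemma common_root_lt j a b : common_root j a b -> (a < n)%N /\ (b < n)%N.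
Proof. by case/andP=> /and3P[]. Qed.

(** On the root (n - 1, j), present for [j.+1] only, the operator completes to a p-th power and
    gives 0. The roots common to [j] and [j.+1] are normalised by it. *)
Lemma span_down j x : (j.+1 < n.-1)%N ->
  shifted_span E gam (pos_root j.+1) x ->
  shifted_span E gam (pos_root j) (E n.-1 j ^+ p.-1 *: x).
Proof.
move=> jn; apply: span_stable => a b y; have [/andP[/eqP-> /eqP->] _|abN ab] :=
  boolP ((a == n.-1) && (b == j)).
  rewrite scalerA /shifted_unit /chi_unit ltnn andbF rmorph0 subr0 -exprSr.
  by rewrite prednK ?nilp_special_l; [rewrite scale0r; exact: Shifted_zero | lia | lia].
have abc : common_root j a b.
  by move: ab abN; rewrite /common_root /pos_root /deg; do !case: ifP; lia.
apply: (@span_mono (common_root j)) => [? ? /andP[]//|].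
apply: span_normaliseX; try lia; try exact: common_root_lt.
- move=> e; rewrite /common_root /pos_root /deg /chi_unit ltnn andbF eqxx.
  by do !case: ifP; split=> //; lia.
- move=> e; rewrite /common_root /pos_root /deg /chi_unit eqxx.
  by do !case: ifP; split=> //; lia.
- by constructor.
Qed.

Lemma span_up j x : (j.+1 < n.-1)%N ->
  shifted_span E gam (pos_root j) x ->
  shifted_span E gam (pos_root j.+1) (E j.+1 n.-1 ^+ p.-1 *: x).
Proof.
move=> jn; apply: span_stable => a b y; have [/andP[/eqP-> /eqP->] _|abN ab] :=
  boolP ((a == j.+1) && (b == n.-1)).
  rewrite scalerA /shifted_unit /chi_unit; case: ifP => [|_]; first by lia.
  rewrite rmorph0 subr0 -exprSr.
  by rewrite prednK ?nilp_special_r; [rewrite scale0r; exact: Shifted_zero | lia | lia].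
have abc : common_root j a b.
  by move: ab abN; rewrite /common_root /pos_root /deg; do !case: ifP; lia.
apply: (@span_mono (common_root j)) => [? ? /andP[]//|].
apply: span_normaliseX; try lia; try exact: common_root_lt.
- move=> e; rewrite /common_root /pos_root /deg /chi_unit eqxx.
  by do !case: ifP; split=> //; lia.
- move=> e; rewrite /common_root /pos_root /deg /chi_unit eqxx.
  by do !case: ifP; split=> //; lia.
- by constructor.
Qed.

Fixpoint raising j : U :=
  if j is i.+1 then E j n.-1 ^+ p.-1 * raising i * E n.-1 i ^+ p.-1 else E 0%N n.-1.

Lemma span_raising j x : (j < n.-1)%N ->
  shifted_span E gam (pos_root j) x ->
  shifted_span E gam (pos_root j) (raising j *: x).
Proof.
elim: j x => [|j IHj] x jn Mx /=.
  apply: span_normalise; try lia; try exact: Mx.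
  - by move=> a b /and3P[].
  - move=> e; rewrite /pos_root /deg /chi_unit eqxx.
    by do !case: ifP; split=> //; lia.
  - move=> e; rewrite /pos_root /deg /chi_unit eqxx.
    by do !case: ifP; split=> //; lia.
rewrite -!scalerA; apply: span_up => //; apply: IHj; first by lia.
exact: span_down.
Qed.

End Span.

Lemma sl2_weight (Y h : U) eta (z : V) m : h * Y = Y * h - Y *+ 2 ->
  h *: z = c eta *: z -> h *: (Y ^+ m *: z) = c (eta - m%:R *+ 2) *: (Y ^+ m *: z).
Proof.
move=> hY hz; elim: m => [|m IHm]; first by rewrite mul0rn subr0 scale1r.
rewrite exprS -scalerA scalerA hY scalerBl -!scalerA IHm cZC.
rewrite -scalerMnl -scaler_nat -[2%:R](rmorph_nat c) -scalerBl -rmorphB /=.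
congr (c _ *: _); rewrite -[m.+1%:R]natr1; ring.
Qed.

Lemma sl2_raise (X Y h : U) eta (z : V) m : X * Y = Y * X + h -> h * Y = Y * h - Y *+ 2 ->
  X *: z = 0 -> h *: z = c eta *: z ->
  X *: (Y ^+ m.+1 *: z) = c (m.+1%:R * (eta - m%:R)) *: (Y ^+ m *: z).
Proof.
move=> XY hY Xz hz; elim: m => [|m IHm].
  rewrite !scale1r scalerA XY scalerDl -scalerA Xz scaler0 add0r hz.
  by rewrite subr0 mul1r.
rewrite exprS -scalerA scalerA XY scalerDl -scalerA IHm.
rewrite (sl2_weight _ hY hz) cZC.
have -> : Y *: (Y ^+ m *: z) = Y ^+ m.+1 *: z by rewrite scalerA -exprS.
rewrite -scalerDl -rmorphD /=; congr (c _ *: _).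
by rewrite -[m.+2%:R]natr1 -[m.+1%:R]natr1; ring.
Qed.

(** [N] need not be stable under X, so every Y is moved to the far left, where it falls into [N]; C
    commutes with X, also goes to the left, and becomes gam there. The m commutations contribute the
    factors m + 1, m, ..., 2. *)
Lemma heisenberg_collapse (N : V -> Prop) (X Y C : U) gam z m :
  (forall x y, N x -> N y -> N (x + y)) -> (forall a x, N x -> N (c a *: x)) ->
  (forall x, N (Y *: x)) -> (forall x, N ((C - c gam) *: x)) ->
  X * Y = Y * X + C -> X * C = C * X ->
  N (X ^+ m.+1 *: (Y ^+ m *: z) - c (m.+1`!%:R * gam ^+ m) *: (X *: z)).
Proof.
move=> ND NZ NY NC XY XC.
have XYn k : X ^+ k.+1 * Y = Y * X ^+ k.+1 + (C * X ^+ k) *+ k.+1.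
  elim: k => [|k IHk]; first by rewrite !expr1 expr0 mulr1.
  have XCX : X * (C * X ^+ k) = C * X ^+ k.+1 by rewrite mulrA XC -mulrA -exprS.
  rewrite exprS -mulrA IHk mulrDr mulrnAr XCX (mulrA X) XY mulrDl -(mulrA Y).
  by rewrite -addrA -exprS -mulrS.
elim: m z => [|m IHm] z.
  rewrite expr0 mulr1 rmorph1 expr1 !scale1r subrr.
  by have := NZ 0 _ (NY 0); rewrite rmorph0 scale0r.
have factE : m.+2`!%:R = m.+2%:R * m.+1`!%:R :> K by rewrite factS natrM.
have -> : X ^+ m.+2 *: (Y ^+ m.+1 *: z) - c (m.+2`!%:R * gam ^+ m.+1) *: (X *: z)
  = Y *: (X ^+ m.+2 *: (Y ^+ m *: z)) +
    (c m.+2%:R *: ((C - c gam) *: (X ^+ m.+1 *: (Y ^+ m *: z))) +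
     c (m.+2%:R * gam) *: (X ^+ m.+1 *: (Y ^+ m *: z) -
        c (m.+1`!%:R * gam ^+ m) *: (X *: z))).
  rewrite {1}[Y ^+ m.+1]exprS -[in LHS]scalerA scalerA XYn scalerDl -scalerA.
  rewrite -addrA; congr (_ + _).
  rewrite -scalerMnl -scaler_nat -[m.+2%:R in LHS](rmorph_nat c) -!scalerA.
  move: (X ^+ m.+1 *: _) (X *: z) => q r.
  rewrite [c (m.+2%:R * gam)]rmorphM /= -[in RHS]scalerA -scalerDr.
  rewrite (scalerBr (c gam)) addrA -scalerDl subrK scalerBr !scalerA.
  by rewrite factE exprS mulrACA  (rmorphM c (m.+2%:R * gam)) (rmorphM c m.+2%:R).
apply: (ND); first exact: NY.
apply: (ND); apply: NZ; [exact: NC | exact: IHm].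
Qed.

(* On a vector killed by the chain root vectors above it, [raising E j] agrees *)
(* with E_(j, n - 1) up to a scalar modulo the shifted span; the conditions   *)
(* [nu a - t + (j + 1 - a) != 0] are those under which the scalar survives.   *)
Lemma raising_value E gam j (nu : nat -> K) t w :
  lie_gl E -> reduced_gl E gam -> gam != 0 -> (j < n.-1)%N ->
  (forall a, (a < j)%N -> E a n.-1 *: w = 0) ->
  (forall a b, (a < b <= j)%N -> E a b *: w = 0) ->
  (forall a, (a < j)%N -> E a a *: w = c (nu a) *: w) ->
  E n.-1 n.-1 *: w = c t *: w ->
  (forall a, (a < j)%N -> nu a - t + (j.+1 - a)%:R != 0) ->
  exists2 b, b != 0 &
    shifted_span E gam (pos_root j) (raising E j *: w - c b *: (E j n.-1 *: w)).
Proof.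
move=> glE redE gam0; elim: j t w => [|j IHj] t w jn Es Eup Ed Et nuN0.
  exists 1; rewrite ?oner_neq0 // rmorph1 scale1r subrr; exact: Shifted_zero.
set Y := E n.-1 j; set X := E j n.-1; set X' := E j.+1 n.-1.
pose w' := Y ^+ p.-1 *: w.
have commY a b : (a < n)%N -> (b < n)%N -> b != n.-1 -> a != j ->
    forall m, E a b *: (Y ^+ m *: w) = Y ^+ m *: (E a b *: w).
  move=> an bn bs aj; elim=> [|m IHm]; first by rewrite !scale1r.
  rewrite exprS -!scalerA scalerA glE /Y; try lia.
  rewrite (negbTE bs) eq_sym (negbTE aj) !mulr0n addr0 subr0 -scalerA IHm.
  by rewrite !scalerA.
(* Passing from w to w' changes the weight of E_(n - 1, n - 1) by p - 1 = -1, which balances the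
   change of j + 1 in the conditions on [nu]. *)
have [||||||b b0 Mb] := IHj (t - 1) w'.
- by lia.
- move=> a aj; rewrite /w'; elim: p.-1 => [|m IHm].
    by rewrite scale1r; apply: Es; lia.
  rewrite exprS -scalerA scalerA glE /Y; try lia.
  rewrite eqxx (_ : (j == a) = false) ?mulr1n ?mulr0n ?subr0; last by lia.
  rewrite scalerDl -scalerA IHm scaler0 add0r commY; try lia.
  by rewrite Eup ?scaler0; last lia.
- by move=> a d ad; rewrite /w' commY; try lia; rewrite Eup ?scaler0; last lia.
- move=> a aj; rewrite /w' commY; try lia; rewrite Ed; last lia.
  by rewrite cZC.
- rewrite /w'.
  have -> : t - 1 = t + p.-1%:R.
    by rewrite -subn1 natrB ?(pcharf0 charKp) ?sub0r //; lia.
  elim: p.-1 => [|m IHm]; first by rewrite scale1r addr0.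
  rewrite exprS -!scalerA scalerA glE /Y; try lia.
  rewrite eqxx (_ : (j == n.-1) = false) ?mulr1n ?mulr0n ?subr0; last by lia.
  rewrite scalerDl -scalerA IHm cZC -[X in _ + X]scale1r -(rmorph1 c) -scalerDl.
  by rewrite -rmorphD /= -addrA natr1.
- move=> a aj; have := nuN0 a (ltnW aj).
  by rewrite (_ : (j.+2 - a = (j.+1 - a).+1)%N) -?natr1; last lia; congr (_ != 0); ring.
have Xw : X *: w = 0 by apply: Es.
have hw : (E j j - E n.-1 n.-1) *: w = c (nu j - t) *: w.
  by rewrite scalerBl Ed // Et -scalerBl rmorphB.
have XY : X * Y = Y * X + (E j j - E n.-1 n.-1).
  by rewrite glE /X /Y; try lia; rewrite !eqxx !mulr1n addrA.
have hY : (E j j - E n.-1 n.-1) * Y = Y * (E j j - E n.-1 n.-1) - Y *+ 2.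
  have jY : E j j * Y = Y * E j j - Y.
    rewrite glE /Y ?eqxx ?mulr1n; try lia.
    by rewrite (_ : (j == n.-1) = false) ?mulr0n ?addr0 //; lia.
  have sY : E n.-1 n.-1 * Y = Y * E n.-1 n.-1 + Y.
    rewrite glE /Y ?eqxx ?mulr1n; try lia.
    by rewrite (_ : (j == n.-1) = false) ?mulr0n ?subr0 //; lia.
  by rewrite mulrBl mulrBr jY sY mulr2n opprD addrACA -opprD.
(* The sl_2 relation removes one of the p - 1 factors Y at the cost of the scalar -(nu j - t + 2),
   nonzero by the condition at a = j. The other p - 2 factors are removed by the Heisenberg relation
   between X' and Y, whose centre E_(j + 1, j) acts as gam modulo the span. *)
have := sl2_raise (p - 2) XY hY Xw hw.
rewrite (_ : (p - 2).+1 = p.-1); last by lia.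
rewrite -/w' => Xw'.
have etaE : p.-1%:R * (nu j - t - (p - 2)%:R) = - (nu j - t + 2) :> K.
  rewrite -subn1 !natrB ?(pcharf0 charKp); try lia.
  by ring.
have eta0 : nu j - t + 2 != 0.
  by have := nuN0 j (ltnSn j); rewrite (_ : (j.+2 - j)%N = 2%N) //; lia.
rewrite etaE in Xw'.
have XC : X' * E j.+1 j = E j.+1 j * X'.
  rewrite /X' glE; try lia.
  have [-> ->] : (n.-1 == j.+1) = false /\ (j == j.+1) = false by split; lia.
  by rewrite !mulr0n addr0 subr0.
have X'Y : X' * Y = Y * X' + E j.+1 j.
  rewrite /X' /Y glE; try lia.
  by rewrite eqxx (_ : (j == j.+1) = false) ?mulr0n ?subr0 //; lia.
have HM : shifted_span E gam (pos_root j.+1)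
    (X' ^+ p.-1 *: (Y ^+ (p - 2) *: w) -
     c (p.-1`!%:R * gam ^+ (p - 2)) *: (X' *: w)).
  rewrite -(_ : (p - 2).+1 = p.-1); last by lia.
  apply: (@heisenberg_collapse _ X' Y (E j.+1 j)) => //.
  - exact: Shifted_add.
  - exact: span_scale.
  - move=> x; apply: span_unit; first by rewrite /pos_root /deg eqxx; case: ifP; lia.
    by rewrite /chi_unit ltnn andbF.
  - move=> x; have -> : E j.+1 j - c gam = shifted_unit E gam j.+1 j.
      by rewrite /shifted_unit /chi_unit eqxx jn.
    by apply: Shifted_gen; rewrite /pos_root /deg; do !case: ifP; lia.
have fact0 : p.-1`!%:R != 0 :> K.
  have p_pr := pcharf_prime charKp.
  rewrite -(dvdn_pcharf charKp); apply/negP => dv.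
  have : (p %| p.-1`!.+1)%N by rewrite -Wilson; lia.
  by rewrite -addn1 dvdn_addr // dvdn1; lia.
pose d := - (nu j - t + 2).
exists (b * d * (p.-1`!%:R * gam ^+ (p - 2))).
  by rewrite !mulf_neq0 ?oppr_eq0 ?expf_neq0.
rewrite /= -!scalerA -/w' -/X'.
have := span_up glE redE jn Mb; rewrite scalerBr cZC Xw' cZC scalerA -rmorphM /=.
move=> M1; have := span_scale (b * d) HM; rewrite scalerBr => M2.
have := Shifted_add M1 M2; rewrite addrA subrK.
by rewrite (rmorphM c (b * d) (_ * _)) -scalerA.
Qed.
End GlOperators.

(** * Nakayama's lemma *)

Section Endo.
Variables (K : fieldType) (p : nat) (charKp : p \in [pchar K]).
Variables (U : pzRingType) (c : {rmorphism K -> U}).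
Hypothesis cC : forall a u, c a * u = u * c a.
Variables (V : lmodType U) (n : nat).
Hypothesis n_gt1 : (1 < n)%N.
Hypothesis p_gt2 : (2 < p)%N.
Variables (E : nat -> nat -> U) (gam : K).
Hypothesis glE : lie_gl n E.
Hypothesis redE : reduced_gl p c n E gam.
Variables (phi : V -> V).
Hypothesis phiD : forall x y, phi (x + y) = phi x + phi y.
Hypothesis phiZ : forall u x, phi (u *: x) = u *: phi x.
Hypothesis phiK : forall x, phi (phi x) = phi x.

Local Notation span := (@shifted_span _ _ c V n E gam).

Lemma phi0 : phi 0 = 0.
Proof. by rewrite -[in LHS](scale0r 0) phiZ scale0r. Qed.

Lemma span_phi P x : span P x -> span P (phi x).
Proof.
elim=> [|y z _ IHy _ IHz|a b y ab]; first by rewrite phi0; exact: Shifted_zero.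
  by rewrite phiD; exact: Shifted_add.
by rewrite phiZ; exact: Shifted_gen.
Qed.

(* Nakayama's lemma for the nilpotent algebra m: the positive roots are       *)
(* removed one at a time, starting with those of smallest degree.             *)
Lemma nakayama j : (j < n.-1)%N -> (forall x, span (pos_root n j) (phi x)) ->
  forall x, phi x = 0.
Proof.
move=> jn phiM.
(* [key] numbers the roots injectively, larger degree first, and [Q t] keeps those numbered below
   [t]. Bracketing with a positive root raises the degree, so [Q t] is normalised by the root of key
   [t]; chi vanishes on the brackets, whose degree is at least 2. *)
pose key a b := (((n - (deg n j a - deg n j b)) * n + a) * n + b)%N.
pose Q t : rel nat := fun a b => pos_root n j a b && (key a b < t)%N.
have key_inj a b d e : (a < n)%N -> (b < n)%N -> (d < n)%N -> (e < n)%N ->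
    key a b = key d e -> a = d /\ b = e.
  rewrite /key; move: (n - _)%N (n - _)%N => k1 k2 an bn dn en eq2.
  have := congr1 (fun m => m %% n)%N eq2; have := congr1 (fun m => m %/ n)%N eq2.
  rewrite !modnMDl !divnMDl ?modn_small ?divn_small ?addn0; try lia.
  move=> eq3 ->; split=> //; have := congr1 (fun m => m %% n)%N eq3.
  by rewrite !modnMDl !modn_small.
have key_lt a b d e : pos_root n j a b -> pos_root n j d e ->
    (deg n j d - deg n j e < deg n j a - deg n j b)%N -> (key a b < key d e)%N.
  move=> /and3P[an bn ab] /and3P[dn en de] lt; rewrite /key.
  have ltn_deg a' : (a' < n)%N -> (deg n j a' < n)%N by rewrite /deg; case: ifP; lia.
  have := ltn_deg _ an; have := ltn_deg _ dn; move: lt ab de.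
  move: (deg n j a) (deg n j b) (deg n j d) (deg n j e) => a' b' d' e' lt ab de dn' an'.
  have : (n - (a' - b') < n - (d' - e'))%N by lia.
  by move: (n - (a' - b'))%N (n - (d' - e'))%N => k1 k2; nia.
have Qlast : forall x, span (Q (n.+1 * n * n)%N) (phi x).
  move=> x; apply: span_mono (phiM x) => a b /[dup] ab /and3P[an bn _].
  rewrite /Q ab /=; apply: (@leq_trans ((n * n + a) * n + b).+1); last by nia.
  by rewrite ltnS leq_add2r leq_mul2r leq_add2r leq_mul2r leq_subr !orbT.
suff Qfirst : forall x, span (Q 0) (phi x).
  move=> x; elim: {x}(phi x) / (Qfirst x) => // [y z _ -> _ -> |a b y]; first exact: addr0.
  by rewrite /Q ltn0 andbF.
elim: (_ * _)%N Qlast => // t IHt Qt; apply: IHt.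
have [[a [b [ab kab]]]|noroot] := pselect (exists a b, pos_root n j a b /\ key a b = t);
  last first.
  move=> x; apply: span_mono (Qt x) => a b /andP[ab]; rewrite ltnS leq_eqVlt /Q ab.
  by case/orP=> // /eqP kab; case: noroot; exists a, b.
have [an bn dab] := and3P ab.
set X := shifted_unit c n E gam a b.
have XQ k y : span (Q t) y -> span (Q t) (X ^+ k *: y).
  elim: k => [|k IHk] Qy; first by rewrite scale1r.
  rewrite exprS -scalerA /X {1}/shifted_unit scalerBl.
  apply: (span_sub cC); last exact/(span_scale cC)/IHk.
  apply: (span_normalise cC glE _ _ _ _ _ (IHk Qy)) => //.
  - by move=> ? ? /andP[/and3P[]].
  - move=> e /andP[be kbe]; have [_ en dbe] := and3P be.
    have ae : pos_root n j a e by rewrite /pos_root an en (ltn_trans dbe).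
    split; last by rewrite /chi_unit; move: dab dbe; rewrite /deg; do !case: ifP => //; lia.
    by rewrite /Q ae (ltn_trans _ kbe) // key_lt //; lia.
  - move=> d /andP[da kda]; have [dn _ dda] := and3P da.
    have db : pos_root n j d b by rewrite /pos_root dn bn (ltn_trans dab).
    split; last by rewrite /chi_unit; move: dab dda; rewrite /deg; do !case: ifP => //; lia.
    by rewrite /Q db (ltn_trans _ kda) // key_lt //; lia.
have split1 x : span (Q t.+1) x ->
    exists y z, span (Q t) y /\ x = y + X *: z.
  elim=> [|_ _ _ [y [z [Qy ->]]] _ [y' [z' [Qy' ->]]]|d e y /andP[de]].
  - by exists 0, 0; split; [exact: Shifted_zero | rewrite scaler0 addr0].
  - exists (y + y'), (z + z'); split; first exact: Shifted_add.
    by rewrite scalerDr addrACA.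
  rewrite ltnS leq_eqVlt => /orP[/eqP kde|kde].
    have [dn en _] := and3P de.
    have [<- <-] := key_inj _ _ _ _ an bn dn en (etrans kab (esym kde)).
    by exists 0, y; split; [exact: Shifted_zero | rewrite add0r].
  exists (shifted_unit c n E gam d e *: y), 0; split; last by rewrite scaler0 addr0.
  by apply: Shifted_gen; rewrite /Q de.
(* Since phi is idempotent, phi z can be written phi (phi z) and decomposed again inside; each round
   gains one power of X, and X ^ p = 0. *)
have splitk k x : exists y z, span (Q t) y /\ phi x = y + X ^+ k *: phi z.
  elim: k => [|k [y [z [Qy ->]]]].
    by exists 0, x; split; [exact: Shifted_zero | rewrite scale1r add0r].
  have [y' [z' [Qy' zE]]] := split1 _ (Qt z).
  exists (y + X ^+ k *: phi y'), z'; split.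
    by apply: Shifted_add => //; apply/XQ/span_phi.
  by rewrite -[phi z]phiK zE phiD phiZ scalerDr addrA scalerA -exprSr.
move=> x; have [y [z [Qy ->]]] := splitk p x.
rewrite redE ?scale0r ?addr0 //; apply/eqP => abE.
by rewrite abE ltnn in dab.
Qed.

End Endo.

(** * Indecomposability of a cyclic module *)

Section Flip.
Variables (n : nat).
Hypothesis n_gt1 : (1 < n)%N.

Definition flip (a : nat) : nat := if a == n.-1 then n.-1 else (n.-2 - a)%N.

Lemma flip_lt a : (a < n)%N -> (flip a < n)%N.
Proof. by rewrite /flip; case: ifP; lia. Qed.

Lemma flipK a : (a < n)%N -> flip (flip a) = a.
Proof. by rewrite /flip; do !case: ifP; lia. Qed.

Lemma flip_eq a b : (a < n)%N -> (b < n)%N -> (flip a == flip b) = (a == b).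
Proof.
by move=> an bn; apply/eqP/eqP => [|->//]; rewrite -{2}[a]flipK // -{2}[b]flipK // => ->.
Qed.

End Flip.

(** * The symmetry exchanging raising and lowering arrows *)

Section Mirror.
Variables (K : fieldType) (p : nat).
Variables (U : pzRingType) (c : {rmorphism K -> U}).
Hypothesis cC : forall a u, c a * u = u * c a.
Variables (V : lmodType U) (n : nat).
Hypothesis n_gt1 : (1 < n)%N.

(* The automorphism of gl_n given by minus the transpose along the            *)
(* antidiagonal of the chain; it exchanges the roles of E_(j, n - 1) and      *)
(* E_(n - 1, j).                                                              *)
Definition mirror (E : nat -> nat -> U) a b : U := - E (flip n b) (flip n a).

Lemma lie_gl_mirror E : lie_gl n E -> lie_gl n (mirror E).
Proof.
move=> glE a b d e an bn dn en; rewrite /mirror !mulrNN glE ?flip_lt //.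
rewrite !flip_eq // !mulNrn opprK [(a == e)]eq_sym [(d == b)]eq_sym.
exact: addrAC.
Qed.

(** The sign in the automorphism turns gam into its opposite; this is why the value of chi on the
    chain is kept as a parameter instead of being fixed to 1. *)
Lemma shifted_mirror E gam a b : (a < n)%N -> (b < n)%N ->
  shifted_unit c n (mirror E) (- gam) a b = - shifted_unit c n E gam (flip n b) (flip n a).
Proof.
move=> an bn; rewrite /shifted_unit /mirror opprB addrC; congr (_ - _).
rewrite -rmorphN; congr (c _); rewrite /chi_unit /flip.
by do !case: ifP => //; rewrite ?oppr0 ?opprK //; lia.
Qed.

Lemma reduced_gl_mirror E gam : reduced_gl p c n E gam ->
  reduced_gl p c n (mirror E) (- gam).
Proof.
move=> redE a b an bn ab; rewrite shifted_mirror // exprNn redE ?mulr0 ?flip_lt //.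
by rewrite flip_eq // eq_sym.
Qed.

Lemma pos_root_flip j a b : (j < n.-1)%N -> (a < n)%N -> (b < n)%N ->
  pos_root n (n.-2 - j) a b = pos_root n j (flip n b) (flip n a).
Proof.
by move=> jn an bn; rewrite /pos_root /flip /deg; do !case: ifP; lia.
Qed.

Lemma span_mirror E gam j (x : V) : (j < n.-1)%N ->
  shifted_span c n (mirror E) (- gam) (pos_root n (n.-2 - j)) x ->
  shifted_span c n E gam (pos_root n j) x.
Proof.
move=> jn; elim=> [|y z _ IHy _ IHz|a b y ab]; first exact: Shifted_zero.
  exact: Shifted_add.
have [an bn _] := and3P ab; rewrite pos_root_flip // in ab.
rewrite shifted_mirror // scaleNr; apply: (span_opp cC); exact: Shifted_gen.
Qed.

Lemma span_mirrorV E gam j (x : V) : (j < n.-1)%N ->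
  shifted_span c n E gam (pos_root n j) x ->
  shifted_span c n (mirror E) (- gam) (pos_root n (n.-2 - j)) x.
Proof.
move=> jn; elim=> [|y z _ IHy _ IHz|a b y ab]; first exact: Shifted_zero.
  exact: Shifted_add.
have [an bn _] := and3P ab.
rewrite -[shifted_unit _ _ _ _ _ _]opprK -{1}[a](flipK n_gt1) // -{1}[b](flipK n_gt1) //.
rewrite -shifted_mirror ?flip_lt // scaleNr; apply: (span_opp cC).
by apply: Shifted_gen; rewrite pos_root_flip ?flip_lt // !flipK.
Qed.

End Mirror.

(** * Weight components of the highest weight vector, and the arrows between them *)

Section Cyclic.
Variables (K : fieldType) (p : nat) (charKp : p \in [pchar K]).
Variables (U : pzRingType) (c : {rmorphism K -> U}).
Hypothesis cC : forall a u, c a * u = u * c a.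
Variables (V : lmodType U) (n : nat).
Hypothesis n_gt1 : (1 < n)%N.
Hypothesis p_gt2 : (2 < p)%N.
Variables (E : nat -> nat -> U) (gam : K).
Hypothesis glE : lie_gl n E.
Hypothesis redE : reduced_gl p c n E gam.
Hypothesis gam0 : gam != 0.

Local Notation s := n.-1.
Local Notation H := (E s s).
Hypothesis HX : H ^+ p = H.

Variables (v : V) (j : nat) (alpha : K) (nu : nat -> K) (nus : K).
Hypothesis jn : (j < s)%N.
Hypothesis alpha0 : alpha != 0.
Hypothesis v_neg : forall a b, (a < n)%N -> (b < n)%N -> (deg n j a < deg n j b)%N ->
  E a b *: v = 0.
Hypothesis v_diag : forall a, (a < s)%N -> a != j -> E a a *: v = c (nu a) *: v.
(** In the plane with basis u = e_j + alpha e_(n - 1) and e_(n - 1), the operators of this and the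
    next two hypotheses are the projector to u, the projector to e_(n - 1), and the nilpotent map
    taking e_(n - 1) to u: the Borel subalgebra of the gl_2 factor attached to alpha. *)
Hypothesis v_j : (E j j + c alpha * E s j) *: v = c (nu j) *: v.
Hypothesis v_s : (H - c alpha * E s j) *: v = c nus *: v.
Hypothesis v_n : (E j s + c alpha * (H - E j j) - c (alpha ^+ 2) * E s j) *: v = 0.

(** For t in F_p, the projector to the t-eigenspace of H: as H^p = H, the eigenvalues h lie in F_p,
    and (h - t)^(p - 1) is 1 unless h = t. Membership in F_p is expressed by [t ^+ p = t]
    throughout. *)
Definition wproj t : U := 1 - (H - c t) ^+ p.-1.
Definition wvec t : V := wproj t *: v.

Let p_gt0 : (0 < p)%N := ltnW (ltnW p_gt2).

Lemma H_wproj t : t ^+ p = t -> H * wproj t = c t * wproj t.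
Proof.
move=> tp; apply/eqP; rewrite -subr_eq0 -mulrBl mulrBr mulr1 -exprS prednK //.
by rewrite (pchar_subX charKp cC) HX tp subrr.
Qed.

Lemma wproj_H t : wproj t * H = H * wproj t.
Proof.
rewrite /wproj mulrBl mulrBr mul1r mulr1; congr (_ - _).
by apply/esym/commrX/commrB => //; apply/esym/cC.
Qed.

Lemma H_wvec t : t ^+ p = t -> H *: wvec t = c t *: wvec t.
Proof. by move=> tp; rewrite /wvec !scalerA H_wproj. Qed.

Lemma fix_sub (x y : K) : x ^+ p = x -> y ^+ p = y -> (x - y) ^+ p = x - y.
Proof.
by move=> xp yp; rewrite -[LHS](pFrobenius_autE charKp) rmorphB /= !pFrobenius_autE xp yp.
Qed.

Lemma wproj_Hv t : wproj t *: (H *: v) = H *: wvec t.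
Proof. by rewrite /wvec !scalerA wproj_H. Qed.

Lemma wproj_wvec t r : t ^+ p = t -> r ^+ p = r ->
  wproj t *: wvec r = (r == t)%:R *: wvec r.
Proof.
move=> tp rp; rewrite {1}/wproj scalerBl scale1r.
have -> m : (H - c t) ^+ m *: wvec r = c ((r - t) ^+ m) *: wvec r.
  elim: m => [|m IHm]; first by rewrite !expr0 rmorph1 scale1r.
  rewrite exprS -scalerA IHm (cZC cC) scalerBl H_wvec // -scalerBl -rmorphB /=.
  by rewrite scalerA -rmorphM -exprSr.
have [->|rt] := eqVneq.
  by rewrite subrr expr0n gtn_eqF ?rmorph0 ?scale0r ?subr0 ?scale1r //; lia.
rewrite scale0r; have := fix_sub rp tp; rewrite -(prednK p_gt0) exprS.
rewrite -[RHS]mulr1 => /(mulfI _) ->; rewrite ?subr_eq0 //.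
by rewrite rmorph1 scale1r subrr.
Qed.

Lemma sum_wvec t : v = \sum_(i < p) wvec (t + i%:R).
Proof.
rewrite -scaler_suml /wproj sumrB sumr_const card_ord.
rewrite (pchar_mulrn charKp) // sub0r.
under eq_bigr do rewrite rmorphD opprD addrA.
by rewrite (sum_shift_pow charKp cC) // opprK scale1r.
Qed.

Lemma unit_wproj a b t : (a < n)%N -> (b < n)%N ->
  E a b * wproj t = wproj (t + (a == s)%:R - (b == s)%:R) * E a b.
Proof.
move=> an bn; have HE : E a b * (H - c t) = (H - c (t + (a == s)%:R - (b == s)%:R)) * E a b.
  rewrite mulrBr mulrBl glE; try lia.
  have -> : E a s *+ (b == s) = (b == s)%:R * E a b.
    by have [->|_] := eqVneq; rewrite ?mul1r ?mul0r.
  have -> : E s b *+ (s == a) = (a == s)%:R * E a b.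
    by rewrite eq_sym; have [->|_] := eqVneq; rewrite ?mul1r ?mul0r.
  rewrite rmorphB rmorphD !rmorph_nat -cC mulrBl mulrDl.
  rewrite -[LHS]addrA -[LHS]addrA; congr (_ + _).
  by rewrite opprB -opprD [X in _ - X = _]addrC.
rewrite /wproj mulrBr mulrBl mulr1 mul1r; congr (_ - _).
elim: p.-1 => [|m IHm]; first by rewrite !expr0 mulr1 mul1r.
by rewrite exprS mulrA HE -mulrA IHm mulrA -exprS.
Qed.

Lemma unit_wvec a b t : (a < n)%N -> (b < n)%N ->
  E a b *: wvec t = wproj (t + (a == s)%:R - (b == s)%:R) *: (E a b *: v).
Proof. by move=> an bn; rewrite /wvec !scalerA unit_wproj. Qed.

Lemma wvec_neg a b t : (a < n)%N -> (b < n)%N -> (deg n j a < deg n j b)%N ->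
  E a b *: wvec t = 0.
Proof. by move=> an bn ab; rewrite unit_wvec // v_neg // scaler0. Qed.

Lemma wvec_diag a t : (a < s)%N -> a != j -> E a a *: wvec t = c (nu a) *: wvec t.
Proof.
move=> an aj; rewrite unit_wvec ?v_diag //; try lia.
by rewrite addrK (cZC cC).
Qed.

Lemma fix_add1 (t : K) : t ^+ p = t -> (t + 1) ^+ p = t + 1.
Proof.
by move=> tp; rewrite -[LHS](pFrobenius_autE charKp) rmorphD rmorph1 /= !pFrobenius_autE tp.
Qed.

Lemma fix_sub1 (t : K) : t ^+ p = t -> (t - 1) ^+ p = t - 1.
Proof. by move=> tp; rewrite fix_sub // expr1n. Qed.

Lemma alpha_lower_v : c alpha *: (E s j *: v) = (H - c nus) *: v.
Proof. by rewrite scalerBl -v_s scalerBl opprB addrC subrK scalerA. Qed.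

(** Inverting alpha expresses E_(n - 1, j) v through H. Together with [jj_v] and [raise_v] this
    makes the whole gl_2 factor act on v by polynomials in H, so that each weight component is sent
    to a multiple of one weight component. *)
Lemma lower_v : E s j *: v = c (alpha^-1) *: ((H - c nus) *: v).
Proof. by rewrite -alpha_lower_v scalerA -rmorphM mulVf // rmorph1 scale1r. Qed.

Lemma jj_v : E j j *: v = c (nu j) *: v - (H - c nus) *: v.
Proof. by rewrite -v_j -alpha_lower_v scalerDl scalerA addrK. Qed.

Lemma wvec_lower t : t ^+ p = t ->
  E s j *: wvec t = c (alpha^-1 * (t + 1 - nus)) *: wvec (t + 1).
Proof.
move=> tp; rewrite unit_wvec ?eqxx; try lia.
rewrite (_ : (j == s) = false) ?subr0 ?mulr1n ?mulr0n; last by lia.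
rewrite lower_v (cZC cC) scalerBl scalerBr (cZC cC) wproj_Hv.
rewrite -/(wvec _) H_wvec ?fix_add1 // -scalerBl -rmorphB scalerA -rmorphM //.
Qed.

Lemma raise_v : E j s *: v = c alpha *: ((c (nu j) - H) *: v).
Proof.
have /eqP := v_n; rewrite scalerBl scalerDl subr_eq0 => /eqP/(canRL (addrK _)) ->.
rewrite expr2 rmorphM -!scalerA alpha_lower_v -scalerBr; congr (_ *: _).
by rewrite (scalerBl H (E j j)) jj_v opprB addrA (addrC ((H - _) *: v)) subrK scalerBl.
Qed.

Lemma wvec_raise t : t ^+ p = t ->
  E j s *: wvec t = c (alpha * (nu j + 1 - t)) *: wvec (t - 1).
Proof.
move=> tp; rewrite unit_wvec ?eqxx; try lia.
rewrite (_ : (j == s) = false) ?addr0 ?mulr1n ?mulr0n; last by lia.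
rewrite raise_v (cZC cC) (scalerBl (c _) H) scalerBr (cZC cC) wproj_Hv.
rewrite -/(wvec _) H_wvec ?fix_sub1 // -scalerBl -rmorphB scalerA -rmorphM.
by congr (c (_ * _) *: _); ring.
Qed.

Lemma wvec_jj t : t ^+ p = t -> E j j *: wvec t = c (nu j + nus - t) *: wvec t.
Proof.
move=> tp; rewrite unit_wvec; try lia.
rewrite addrK jj_v (scalerBl H) !scalerBr !(cZC cC) wproj_Hv.
rewrite -/(wvec _) H_wvec // -scalerBl -rmorphB -scalerBl -rmorphB.
by congr (c _ *: _); ring.
Qed.

Inductive weight_span : V -> Prop :=
| Weight_zero : weight_span 0
| Weight_add x y of weight_span x & weight_span y : weight_span (x + y)
| Weight_gen a (t : K) of t ^+ p = t : weight_span (c a *: wvec t).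

Lemma weight_span_scale a x : weight_span x -> weight_span (c a *: x).
Proof.
elim=> [|y z _ IHy _ IHz|b t tp]; first by rewrite scaler0; exact: Weight_zero.
  by rewrite scalerDr; exact: Weight_add.
by rewrite scalerA -rmorphM; exact: Weight_gen.
Qed.

Lemma v_weight_span (t : K) : t ^+ p = t -> weight_span v.
Proof.
move=> tp; rewrite (sum_wvec t); elim/big_ind: _ => [||i _].
- exact: Weight_zero.
- exact: Weight_add.
rewrite -[wvec _]scale1r -(rmorph1 c); apply: Weight_gen.
by elim: (i : nat) => [|k IHk]; rewrite ?addr0 // -natr1 addrA fix_add1.
Qed.

Lemma weight_span_unit a b x : (a < n)%N -> (b < n)%N -> (deg n j a <= deg n j b)%N ->
  weight_span x -> weight_span (E a b *: x).
Proof.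
move=> an bn ab; elim=> [|y z _ IHy _ IHz|d t tp].
- by rewrite scaler0; exact: Weight_zero.
- by rewrite scalerDr; exact: Weight_add.
rewrite (cZC cC); apply: weight_span_scale.
move: ab; rewrite leq_eqVlt => /orP[/eqP ab|ab]; last first.
  by rewrite wvec_neg //; exact: Weight_zero.
have [as_|aNs] := eqVneq a s.
  rewrite as_; have [bs|bNs] := eqVneq b s.
    by rewrite bs H_wvec //; exact: Weight_gen.
  have -> : b = j by move: ab; rewrite /deg; do !case: ifP; lia.
  by rewrite wvec_lower //; apply: Weight_gen; exact: fix_add1.
have [bs|bNs] := eqVneq b s.
  have -> : a = j by move: ab; rewrite /deg; do !case: ifP; lia.
  by rewrite bs wvec_raise //; apply: Weight_gen; exact: fix_sub1.
have <- : a = b by move: ab; rewrite /deg; do !case: ifP; lia.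
have [->|aj] := eqVneq a j; first by rewrite wvec_jj //; exact: Weight_gen.
by rewrite wvec_diag //; [exact: Weight_gen | lia].
Qed.

Local Notation M := (@shifted_span _ _ c V n E gam (pos_root n j)).

Hypothesis v_gen : forall T : V -> Prop, T v ->
  (forall x y, T x -> T y -> T (x + y)) -> (forall a x, T x -> T (c a *: x)) ->
  (forall a b x, (a < n)%N -> (b < n)%N -> T x -> T (E a b *: x)) ->
  forall x, T x.
Hypothesis nu_fix : nu j ^+ p = nu j.

(** The closure of the weight components under m. It is stable under all matrix units: one of degree
    at most 0 is commuted to the right past the root vectors of m until it meets [weight_span]. As v
    generates, the closure is V; this stands in for a PBW factorisation. *)
Inductive saturation : V -> Prop :=
| Sat_weight x of weight_span x : saturation x
| Sat_add x y of saturation x & saturation y : saturation (x + y)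
| Sat_root a b x of pos_root n j a b & saturation x : saturation (E a b *: x).

Lemma saturation_scale a x : saturation x -> saturation (c a *: x).
Proof.
elim=> [y|y z _ IHy _ IHz|d e y de _ IHy]; first by move/(weight_span_scale a); exact: Sat_weight.
  by rewrite scalerDr; exact: Sat_add.
by rewrite -(cZC cC); exact: Sat_root.
Qed.

Lemma saturation_sub x y : saturation x -> saturation y -> saturation (x - y).
Proof.
move=> Sx /(saturation_scale (-1)); rewrite rmorphN rmorph1 scaleN1r.
exact: Sat_add.
Qed.

Lemma saturation_unit a b x : (a < n)%N -> (b < n)%N ->
  saturation x -> saturation (E a b *: x).
Proof.
move=> an bn Sx; have [ab|ab] := boolP (pos_root n j a b).
  exact: Sat_root.
have {ab}ab : (deg n j a <= deg n j b)%N by rewrite /pos_root an bn /= -leqNgt in ab.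
elim: Sx a b an bn ab => [y Wy|y z _ IHy _ IHz|d e y de Sy IHy] a b an bn ab.
- by constructor; exact: weight_span_unit.
- by rewrite scalerDr; apply: Sat_add; [exact: IHy | exact: IHz].
have [dn en dde] := and3P de.
have Suv f g : (f < n)%N -> (g < n)%N -> saturation (E f g *: y).
  move=> fn gn; have [fg|fg] := boolP (pos_root n j f g); first exact: Sat_root.
  by apply: IHy => //; rewrite /pos_root fn gn /= -leqNgt in fg.
rewrite scalerA glE // scalerBl scalerDl -scalerA -!scalerMnl.
apply: saturation_sub; first apply: Sat_add.
- by apply: Sat_root => //; exact: Suv.
- by case: (b == d); rewrite ?mulr1n ?mulr0n; [exact: Suv | apply: Sat_weight; exact: Weight_zero].
- by case: (e == a); rewrite ?mulr1n ?mulr0n; [exact: Suv | apply: Sat_weight; exact: Weight_zero].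
Qed.

Lemma module_decomp x : exists y z, [/\ M y, weight_span z & x = y + z].
Proof.
have Sx : saturation x.
  move: x; apply: v_gen.
  - by apply: Sat_weight; exact: v_weight_span nu_fix.
  - exact: Sat_add.
  - exact: saturation_scale.
  - exact: saturation_unit.
elim: Sx => [y Wy|y y' _ [m [w [Mm Ww ->]]] _ [m' [w' [Mm' Ww' ->]]]|].
- by exists 0, y; split=> //; [exact: Shifted_zero | rewrite add0r].
- exists (m + m'), (w + w'); split; [exact: Shifted_add | exact: Weight_add |].
  exact: addrACA.
move=> a b y ab _ [m [w [Mm Ww yE]]].
exists (shifted_unit c n E gam a b *: y + c (chi_unit n gam a b) *: m).
exists (c (chi_unit n gam a b) *: w); split.
- by apply: Shifted_add; [exact: Shifted_gen | exact: span_scale].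
- exact: weight_span_scale.
by rewrite -addrA -scalerDr -yE scalerBl subrK.
Qed.

(** The conditions for a < j are those of [raising_value]; the one for a = j keeps the scalar of
    [wvec_raise] nonzero. *)
Lemma raise_arrow (t : K) : t ^+ p = t ->
  (forall a, (a <= j)%N -> nu a - t + (j.+1 - a)%:R != 0) ->
  exists2 b, b != 0 & M (raising p n E j *: wvec t - c b *: wvec (t - 1)).
Proof.
move=> tp tN.
have [|||||b b0 Mb] := raising_value charKp cC n_gt1 p_gt2 glE redE gam0 jn
  (nu := nu) (t := t) (w := wvec t).
- by move=> a aj; apply: wvec_neg; rewrite /deg; do ?case: ifP; lia.
- by move=> a d ad; apply: wvec_neg; rewrite /deg; do ?case: ifP; lia.
- by move=> a aj; apply: wvec_diag; lia.
- exact: H_wvec.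
- by move=> a /ltnW; exact: tN.
exists (b * (alpha * (nu j + 1 - t))).
  rewrite !mulf_neq0 //; have := tN j (leqnn j).
  by rewrite subSnn mulr1n addrAC.
by rewrite rmorphM -scalerA -wvec_raise //.
Qed.

(** This is [raising_value] for the mirrored units, with n - 2 - j for j, -t for t, and for nu its
    reversal with the opposite sign. The hypothesis on [nus] keeps the scalar of [wvec_lower]
    nonzero. *)
Lemma lower_arrow (t : K) : t ^+ p = t ->
  (forall b, (j < b < s)%N -> t - nu b + (b - j).+1%:R != 0) ->
  t + 1 - nus != 0 ->
  exists2 b, b != 0 & M (raising p n (mirror n E) (n.-2 - j) *: wvec t
                           - c b *: wvec (t + 1)).
Proof.
move=> tp tN tNs.
have flip_chain a : (a < s)%N -> flip n a = (n.-2 - a)%N.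
  by rewrite /flip; case: ifP; lia.
have flip_s : flip n s = s by rewrite /flip eqxx.
have gam'0 : - gam != 0 by rewrite oppr_eq0.
have j's : (n.-2 - j < s)%N by lia.
have [|||||b b0 Mb] := raising_value charKp cC n_gt1 p_gt2
  (lie_gl_mirror n_gt1 glE) (reduced_gl_mirror n_gt1 redE) gam'0 j's
  (nu := fun a => - nu (flip n a)) (t := - t) (w := wvec t).
- move=> a aj; rewrite /mirror flip_s flip_chain; last by lia.
  by rewrite scaleNr wvec_neg ?oppr0 // /deg; do ?case: ifP; lia.
- move=> a d ad; rewrite /mirror !flip_chain; try lia.
  by rewrite scaleNr wvec_neg ?oppr0 // /deg; do ?case: ifP; lia.
- move=> a aj; rewrite /mirror flip_chain; last by lia.
  by rewrite scaleNr wvec_diag ?rmorphN ?scaleNr //; lia.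
- by rewrite /mirror flip_s scaleNr H_wvec // rmorphN scaleNr.
- move=> a aj; rewrite flip_chain; last by lia.
  have := tN (n.-2 - a)%N; rewrite opprK addrC [- _ + t]addrC.
  by rewrite addrC (_ : ((n.-2 - a - j).+1 = (n.-2 - j).+1 - a)%N); [apply|]; lia.
exists (- b * (alpha^-1 * (t + 1 - nus))).
  by rewrite !mulf_neq0 ?oppr_eq0 ?invr_eq0.
rewrite rmorphM -scalerA -wvec_lower //.
have := span_mirror cC n_gt1 jn Mb.
rewrite /mirror flip_s flip_chain ?subKn; try lia.
by rewrite scaleNr scalerN rmorphN scaleNr.
Qed.

Lemma span_H x : M x -> M (H *: x).
Proof.
apply: (span_normalise cC glE); try lia.
- by move=> a b /and3P[].
- by move=> b sb; rewrite /chi_unit ltnn andbF.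
- move=> a as_; split=> //; rewrite /chi_unit; case: ifP => //.
  by move: as_; rewrite /pos_root; lia.
Qed.

Lemma span_wproj t x : M x -> M (wproj t *: x).
Proof.
move=> Mx; rewrite scalerBl scale1r; apply: (span_sub cC) => //.
elim: p.-1 => [|m IHm]; first by rewrite scale1r.
rewrite exprS -scalerA scalerBl; apply: (span_sub cC); first exact: span_H.
exact: (span_scale cC).
Qed.

Lemma weight_span_wproj t x : t ^+ p = t -> weight_span x ->
  exists a, wproj t *: x = c a *: wvec t.
Proof.
move=> tp; elim=> [|y z _ [a yE] _ [b zE]|a r rp].
- by exists 0; rewrite scaler0 rmorph0 scale0r.
- by exists (a + b); rewrite scalerDr yE zE rmorphD scalerDl.
rewrite (cZC cC) wproj_wvec //; have [->|_] := eqVneq.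
  by exists a; rewrite scale1r.
by exists 0; rewrite scale0r scaler0 rmorph0 scale0r.
Qed.

(** Raising arrows link the R weights nu j, nu j - 1, ..., nu j - (R - 1); lowering arrows link nu j
    to the p - R weights nu j + 1, ..., nu j + (p - R). These p weights exhaust F_p, so the arrows
    form one path. *)
Variable R : nat.
Hypothesis R_bound : (0 < R <= p)%N.
Hypothesis raise_ok : forall i a, (i < R.-1)%N -> (a <= j)%N ->
  nu a - (nu j - i%:R) + (j.+1 - a)%:R != 0.
Hypothesis lower_ok : forall i b, (i < p - R)%N -> (j < b < s)%N ->
  nu j + i%:R - nu b + (b - j).+1%:R != 0.
Hypothesis lower_ok_s : forall i, (i < p - R)%N -> nu j + i%:R + 1 - nus != 0.

Lemma fix_addn t i : t ^+ p = t -> (t + i%:R) ^+ p = t + i%:R :> K.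
Proof.
by move=> tp; elim: i => [|i IHi]; rewrite ?addr0 // -natr1 addrA fix_add1.
Qed.

Lemma fix_subn t i : t ^+ p = t -> (t - i%:R) ^+ p = t - i%:R :> K.
Proof.
by move=> tp; elim: i => [|i IHi]; rewrite ?subr0 // -natr1 opprD addrA fix_sub1.
Qed.

(** * Endomorphisms modulo m_chi V *)

Section Idempotent.
Variable phi : V -> V.
Hypothesis phiD : forall x y, phi (x + y) = phi x + phi y.
Hypothesis phiZ : forall u x, phi (u *: x) = u *: phi x.

Lemma phiB x y : phi (x - y) = phi x - phi y.
Proof. by rewrite phiD -scaleN1r phiZ scaleN1r. Qed.

Definition scalar_at a t := M (phi (wvec t) - c a *: wvec t).

Lemma ex_scalar_at t : t ^+ p = t -> exists a, scalar_at a t.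
Proof.
move=> tp; have [m [w [Mm Ww vE]]] := module_decomp (phi v).
have [a wE] := weight_span_wproj tp Ww; exists a.
by rewrite /scalar_at {1}/wvec phiZ vE scalerDr wE addrK; exact: span_wproj.
Qed.

(** An endomorphism commutes with omega and preserves m_chi V, so its scalar is carried unchanged
    along an arrow with nonzero coefficient. *)
Lemma scalar_step a b t t' omega : b != 0 ->
  (forall x, M x -> M (omega *: x)) -> M (omega *: wvec t - c b *: wvec t') ->
  scalar_at a t -> scalar_at a t'.
Proof.
move=> b0 omegaM Mtt' /omegaM; rewrite scalerBr -phiZ (cZC cC) => Mt.
have : M (c b *: (phi (wvec t') - c a *: wvec t')).
  have -> : c b *: (phi (wvec t') - c a *: wvec t') =
      (phi (omega *: wvec t) - c a *: (omega *: wvec t))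
      - (phi (omega *: wvec t - c b *: wvec t')
         - c a *: (omega *: wvec t - c b *: wvec t')).
    rewrite phiB phiZ [phi (c b *: _)]phiZ !scalerBr (cZC cC a) !opprB.
    by rewrite addrA (addrA (_ - _)) subrK addrC addrA subrK.
  apply: (span_sub cC) => //; apply: (span_sub cC); last exact: (span_scale cC).
  exact: (span_phi phiD phiZ).
move=> /(span_scale cC b^-1).
by rewrite scalerA -rmorphM mulVf // rmorph1 scale1r.
Qed.

Lemma scalar_const : exists a, forall x, M (phi x - c a *: x).
Proof.
have [a a0] := ex_scalar_at nu_fix; exists a.
have down i : (i <= R.-1)%N -> scalar_at a (nu j - i%:R).
  elim: i => [|i IHi] iR; first by rewrite subr0.
  have [b b0 Mb] := raise_arrow (fix_subn i nu_fix) (fun d => raise_ok iR).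
  rewrite -natr1 opprD addrA; apply: scalar_step b0 _ Mb (IHi (ltnW iR)).
  by move=> x; apply: (span_raising charKp cC n_gt1 p_gt2 glE redE).
have up i : (i <= p - R)%N -> scalar_at a (nu j + i%:R).
  elim: i => [|i IHi] iR; first by rewrite addr0.
  have [b b0 Mb] := lower_arrow (fix_addn i nu_fix) (fun d => lower_ok iR)
    (lower_ok_s iR).
  rewrite -natr1 addrA; apply: scalar_step b0 _ Mb (IHi (ltnW iR)).
  move=> x /(span_mirrorV cC n_gt1 jn) Mx; apply: (span_mirror cC n_gt1 jn).
  apply: (span_raising charKp cC n_gt1 p_gt2 (lie_gl_mirror n_gt1 glE)
    (reduced_gl_mirror n_gt1 redE)) => //; lia.
have all_t t : t ^+ p = t -> scalar_at a t.
  move=> tp; pose r := nu j - R.-1%:R.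
  have rp i : (r + i%:R) ^+ p = r + i%:R by apply/fix_addn/fix_subn.
  have [[i ->]|noi] := pselect (exists i : 'I_p, t = r + i%:R).
    have [iR|iR] := leqP i R.-1.
      have -> : r + i%:R = nu j - (R.-1 - i)%:R by rewrite natrB // opprB addrA addrAC.
      by apply: down; exact: leq_subr.
    have -> : r + i%:R = nu j + (i - R.-1)%:R.
      by rewrite natrB ?(ltnW iR) // addrA addrAC.
    by apply: up; have := ltn_ord i; lia.
  (* Instead of counting the roots of X^p - X: v is the sum of its components at the p weights r +
     i, and the projector at any other t kills each of them. *)
  rewrite /scalar_at; have -> : wvec t = 0.
    rewrite /wvec {1}(sum_wvec r) scaler_sumr big1 // => i _.
    rewrite wproj_wvec //; have [ri|] := eqVneq; last by rewrite scale0r.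
    by case: noi; exists i.
  by rewrite (phi0 phiZ) scaler0 subr0; exact: Shifted_zero.
move=> x; have [m [w [Mm Ww ->]]] := module_decomp x.
have -> : phi (m + w) - c a *: (m + w) = (phi m - c a *: m) + (phi w - c a *: w).
  by rewrite phiD scalerDr opprD addrACA.
apply: Shifted_add.
  by apply: (span_sub cC); [exact: (span_phi phiD phiZ) | exact: (span_scale cC)].
elim: Ww => [|y z _ My _ Mz|d t tp].
- by rewrite (phi0 phiZ) scaler0 subr0; exact: Shifted_zero.
- by rewrite phiD scalerDr opprD addrACA; exact: Shifted_add.
by rewrite phiZ (cZC cC) -scalerBr; apply: (span_scale cC); exact: all_t.
Qed.

Lemma idempotent_trivial : (forall x, phi (phi x) = phi x) ->
  (exists x : V, x != 0) ->
  (forall x, phi x = 0) \/ (forall x, phi x = x).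
Proof.
move=> phiK [x0 x0N]; have [a Ma] := scalar_const.
have [a0|a0] := eqVneq a 0.
  left; apply: (nakayama charKp cC n_gt1 p_gt2 glE redE phiD phiZ phiK jn) => x.
  by have := Ma x; rewrite a0 rmorph0 scale0r subr0.
have [a1|a1] := eqVneq a 1.
  right=> x; apply/eqP; rewrite -subr_eq0 -oppr_eq0 opprB; apply/eqP; move: x.
  apply: (nakayama charKp cC n_gt1 p_gt2 glE redE (phi := fun x => x - phi x) _ _ _ jn) => [x y|u x|x|x].
  - by rewrite phiD opprD addrACA.
  - by rewrite phiZ scalerBr.
  - by rewrite phiB phiK subrr subr0.
  - by rewrite -opprB; apply: (span_opp cC); have := Ma x; rewrite a1 rmorph1 scale1r.
(* For any other scalar a, idempotence puts (a - a^2) x into m_chi V for every x, so m_chi V is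
   everything and Nakayama applied to the identity gives V = 0. *)
case/eqP: x0N; move: x0.
apply: (nakayama charKp cC n_gt1 p_gt2 glE redE (phi := id) _ _ _ jn) => // x.
have Mx : M (c (a - a ^+ 2) *: x).
  have := span_sub cC (Shifted_add (Ma (phi x)) (span_scale cC a (Ma x))) (Ma x).
  rewrite phiK scalerBr scalerA -rmorphM -expr2 addrA subrK opprB.
  rewrite [in X in X -> _]addrC.
  by rewrite addrACA subrr addr0 addrC -scalerBl -rmorphB.
have := span_scale cC (a - a ^+ 2)^-1 Mx.
rewrite scalerA -rmorphM mulVf ?rmorph1 ?scale1r //.
by rewrite -{1}[a]mulr1 expr2 -mulrBr mulf_neq0 // subr_eq0 eq_sym.
Qed.

End Idempotent.

Lemma cyclic_indecomposable : (exists x : V, x != 0) -> indecomposable V.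
Proof.
move=> V0; split=> // W1 W2 W1c W2c W12 W0.
have [W1_0 W1_lin] := W1c; have [W2_0 W2_lin] := W2c.
have W1D x y : x \in W1 -> y \in W1 -> x + y \in W1.
  by move=> x1 y1; rewrite -[x]scale1r; exact: W1_lin.
have W2D x y : x \in W2 -> y \in W2 -> x + y \in W2.
  by move=> x1 y1; rewrite -[x]scale1r; exact: W2_lin.
have W1Z u x : x \in W1 -> u *: x \in W1.
  by move=> x1; rewrite -[_ *: _]addr0; exact: W1_lin.
have W2Z u x : x \in W2 -> u *: x \in W2.
  by move=> x1; rewrite -[_ *: _]addr0; exact: W2_lin.
(* The projection to W1 along W2, chosen pointwise; uniqueness of the components makes it an
   endomorphism. *)
pose phi x : V := s2val (cid2 (W12 x)).
have phi1 x : phi x \in W1 by rewrite /phi; case: cid2.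
have phi2 x : x - phi x \in W2 by rewrite /phi; case: cid2.
have phiE x y : y \in W1 -> x - y \in W2 -> phi x = y.
  move=> y1 y2; apply/eqP; rewrite -subr_eq0; apply/eqP; apply: W0.
    by rewrite addrC -scaleN1r; exact: W1_lin.
  have := W2_lin (-1) _ _ (phi2 x) y2.
  by rewrite scaleN1r opprB addrA subrK.
have phiD x y : phi (x + y) = phi x + phi y.
  by apply: phiE; [exact: W1D | rewrite opprD addrACA; exact: W2D].
have phiZ u x : phi (u *: x) = u *: phi x.
  by apply: phiE; [exact: W1Z | rewrite -scalerBr; exact: W2Z].
have phiK x : phi (phi x) = phi x by apply: phiE; rewrite ?subrr.
have [phi_0|phi_id] := idempotent_trivial phiD phiZ phiK V0.
  by left=> x x1; rewrite -(phi_0 x); apply/esym/phiE; rewrite ?subrr.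
by right=> x x2; rewrite -(phi_id x); apply: phiE; rewrite ?subr0.
Qed.

End Cyclic.

(** * Representations of reduced enveloping algebras *)

Section EnvelopingFacts.
Variables (K : fieldType) (L : lmodType K) (br : L -> L -> L).
Variables (p : nat) (pmap : L -> L) (chi : L -> K).

Local Notation red := (red_env_alg br p pmap chi).
Local Notation rgen := (red_gen br p pmap chi).
Local Notation rscal := (red_scalar br p pmap chi).

Lemma free_scalar_is_zmod_morphism : zmod_morphism (fun a : K => a%:A : free_alg L).
Proof. by move=> a b; rewrite scalerBl. Qed.

Lemma red_scalar_is_zmod_morphism : zmod_morphism rscal.
Proof.
by move=> a b; rewrite /red_scalar /env_scalar free_scalar_is_zmod_morphism !rmorphB.
Qed.

Lemma red_scalar_is_monoid_morphism : monoid_morphism rscal.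
Proof.
split=> [|a b]; rewrite /red_scalar /env_scalar; first by rewrite scale1r !rmorph1.
by rewrite -!rmorphM mulr_algl scalerA.
Qed.

HB.instance Definition _ :=
  GRing.isZmodMorphism.Build K red rscal red_scalar_is_zmod_morphism.
HB.instance Definition _ :=
  GRing.isMonoidMorphism.Build K red rscal red_scalar_is_monoid_morphism.

Lemma free_scalarE (a : K) : a%:A = << a *g (mone : {fmonom L}) >>.
Proof.
apply/malgP => k; rewrite mcoeffZ -[1 : free_alg L]mpolyC1E mcoeffC mcoeffU.
by rewrite eq_sym mulrnAr mulr1.
Qed.

Lemma free_scalarC (a : K) (f : free_alg L) : a%:A * f = f * a%:A.
Proof.
rewrite free_scalarE [f]monalgE mulr_suml mulr_sumr; apply: eq_bigr => m _.
by rewrite !malgM_def !fgmulUU mul1m mulm1 mulrC.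
Qed.

Lemma red_scalarC a (u : red) : rscal a * u = u * rscal a.
Proof.
rewrite -[u]quot_projK -[repr u]quot_projK /red_scalar /env_scalar.
by rewrite -!rmorphM free_scalarC.
Qed.

Lemma red_gen_linear a X Y : rgen (a *: X + Y) = rscal a * rgen X + rgen Y.
Proof.
rewrite /red_gen /red_scalar -rmorphM -rmorphD; congr (quot_proj _ _).
rewrite /env_gen /env_scalar -rmorphM -rmorphD mulr_algl.
by apply/quot_projP; apply: Ideal_gen; exact: Env_linear.
Qed.

Lemma red_gen_bracket X Y : rgen X * rgen Y = rgen Y * rgen X + rgen (br X Y).
Proof.
apply/eqP; rewrite addrC -subr_eq; apply/eqP.
rewrite /red_gen /env_gen -!rmorphM -!rmorphB; congr (quot_proj _ _).
apply/quot_projP.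
by apply: Ideal_gen; exact: Env_bracket.
Qed.

Lemma red_gen_pmap X : rgen X ^+ p = rgen (pmap X) + rscal (chi X ^+ p).
Proof.
rewrite /red_gen /red_scalar -rmorphXn -rmorphD; apply/quot_projP.
by rewrite opprD addrA; apply: Ideal_gen; exact: Red_pchar.
Qed.

Lemma free_alg_ind (P : free_alg L -> Prop) :
  P 0 -> (forall f g, P f -> P g -> P (f + g)) -> (forall a, P a%:A) ->
  (forall X f, P f -> P (free_gen X * f)) ->
  forall f, P f.
Proof.
move=> P0 PD Pa PX f; rewrite [f]monalgE; elim/big_ind: _ => // m _.
move: (f@_m) => a {f}; case: m => s; elim: s => [|X s IHs].
  by rewrite -fmoneE -free_scalarE.
have -> : << a *g FMonom (X :: s) >> = (free_gen X : free_alg L) * << a *g FMonom s >>.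
  rewrite malgM_def fgmulUU mul1r; congr << _ *g _ >>.
  by apply/eqP; rewrite fmP fmM fmU.
exact: PX.
Qed.

End EnvelopingFacts.

(** * From operators of a Lie algebra to modules over U_chi and maps out of a tensor product *)

Section Representation.
Variables (K : fieldType) (L : lmodType K) (br : L -> L -> L).
Variables (p : nat) (pmap : L -> L) (chi : L -> K).
Variables (A : lmodType K) (op : L -> A -> A).
Hypothesis op_linear : forall X, linear (op X).
Hypothesis op_linearl : forall a X Y x, op (a *: X + Y) x = a *: op X x + op Y x.
Hypothesis op_bracket : forall X Y x, op X (op Y x) - op Y (op X x) = op (br X Y) x.
Hypothesis op_pmap : forall X x, iter p (op X) x = op (pmap X) x + chi X ^+ p *: x.

Lemma op0 X : op X 0 = 0.
Proof. by have := op_linear X (-1) 0 0; rewrite scaler0 addr0 scaleN1r addNr. Qed.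

Lemma opD X x y : op X (x + y) = op X x + op X y.
Proof. by have := op_linear X 1 x y; rewrite !scale1r. Qed.

Lemma opZ X a x : op X (a *: x) = a *: op X x.
Proof. by have := op_linear X a x 0; rewrite !addr0 op0 addr0. Qed.

Definition word_act (w : seq L) (x : A) : A := foldr op x w.

Definition free_act (f : free_alg L) (x : A) : A :=
  \sum_(m <- msupp f) f@_m *: word_act m x.

Lemma free_actEw (d : {fset {fmonom L}}) (f : free_alg L) x : (msupp f `<=` d)%fset ->
  free_act f x = \sum_(m <- d) f@_m *: word_act m x.
Proof.
move=> le; rewrite [LHS](big_fset_incl _ le) => //= m md /mcoeff_outdom ->.
by rewrite scale0r.
Qed.

Lemma free_actB f g x : free_act (f - g) x = free_act f x - free_act g x.
Proof.
rewrite (free_actEw x (msuppB_le f g)) (free_actEw x (fsubsetUl (msupp f) (msupp g))).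
rewrite (free_actEw x (fsubsetUr (msupp f) (msupp g))) -sumrB.
by apply: eq_bigr => m _; rewrite mcoeffB scalerBl.
Qed.

Lemma free_act0 x : free_act 0 x = 0.
Proof. by rewrite -(subrr (0 : free_alg L)) free_actB subrr. Qed.

Lemma free_actD f g x : free_act (f + g) x = free_act f x + free_act g x.
Proof.
by rewrite -[g in LHS]opprK free_actB -[- g]sub0r free_actB free_act0 sub0r opprK.
Qed.

Lemma free_actU a m x : free_act << a *g m >> x = a *: word_act m x.
Proof.
rewrite (@free_actEw [fset m]%fset) ?big_seq_fset1 ?mcoeffUU //; exact: msuppU_le.
Qed.

Lemma free_act_scalar a x : free_act a%:A x = a *: x.
Proof. by rewrite free_scalarE free_actU /word_act fm1. Qed.

Lemma word_act_linear w : linear (word_act w).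
Proof.
by elim: w => //= X w IHw a x y; rewrite /word_act /= -/(word_act _ _) IHw op_linear.
Qed.

Lemma free_act_is_linear f : linear (free_act f).
Proof.
move=> a x y; rewrite /free_act scaler_sumr -big_split /=; apply: eq_bigr => m _.
by rewrite word_act_linear scalerDr !scalerA mulrC.
Qed.

Lemma free_act_gen X f x : free_act (free_gen X * f) x = op X (free_act f x).
Proof.
rewrite [f in LHS]monalgE mulr_sumr.
rewrite (big_morph (free_act^~ x) (fun _ _ => free_actD _ _ _) (free_act0 x)).
rewrite [free_act f x]/free_act (big_morph (op X) (opD X) (op0 X)); apply: eq_bigr => m _.
by rewrite malgM_def fgmulUU mul1r free_actU opZ /word_act fmM fmU.
Qed.

Lemma free_actM f g x : free_act (f * g) x = free_act f (free_act g x).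
Proof.
move: f; apply: free_alg_ind => [|f f' IHf IHf'|a|X f IHf].
- by rewrite mul0r !free_act0.
- rewrite mulrDl.
  exact: etrans (free_actD _ _ _) (etrans (congr2 +%R IHf IHf') (esym (free_actD _ _ _))).
- rewrite free_act_scalar mulr_algl [free_act g x]/free_act.
  rewrite (free_actEw x (msuppZ_le a g)) scaler_sumr; apply: eq_bigr => m _.
  by rewrite mcoeffZ scalerA.
- rewrite -mulrA.
  exact: etrans (free_act_gen _ _ _) (etrans (congr1 (op X) IHf) (esym (free_act_gen _ _ _))).
Qed.

Lemma free_act_gen1 X x : free_act (free_gen X) x = op X x.
Proof. by rewrite free_actU scale1r /word_act fmU. Qed.

Lemma free_act_x0 f : free_act f 0 = 0.
Proof.
by have := free_act_is_linear f (-1) 0 0; rewrite scaler0 addr0 scaleN1r addNr.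
Qed.

Lemma free_act_ideal f x : two_sided_ideal (env_relation br) f -> free_act f x = 0.
Proof.
move=> If; elim: {f}If x => [f [a X Y|X Y]||f g _ IHf _ IHg|f g _ IHg|f g _ IHg] x.
- have aXE : free_act (a *: free_gen X : free_alg L) x = a *: op X x.
    rewrite -mulr_algl; apply: etrans (free_actM _ _ _) _.
    by rewrite free_act_scalar free_act_gen1.
  move: (a *: free_gen X) aXE => aX aXE.
  by rewrite free_actB free_actD aXE !free_act_gen1 op_linearl subrr.
- have PE Z T : free_act (free_gen Z * free_gen T : free_alg L) x = op Z (op T x).
    by apply: etrans (free_actM _ _ _) _; rewrite !free_act_gen1.
  move: (free_gen X * free_gen Y) (free_gen Y * free_gen X) (PE X Y) (PE Y X).
  by move=> P Q {}PE QE; rewrite !free_actB PE QE free_act_gen1 op_bracket subrr.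
- exact: free_act0.
- by rewrite (free_actD f g) IHf IHg addr0.
- by rewrite (free_actM f g) IHg free_act_x0.
- by rewrite (free_actM g f) IHg.
Qed.

Definition env_act (u : env_alg br) (x : A) : A := free_act (repr u) x.

Lemma env_act_proj f x : env_act (quot_proj (env_relation br) f) x = free_act f x.
Proof.
apply/eqP; rewrite -subr_eq0 -free_actB; apply/eqP/free_act_ideal.
by apply/quot_projP; rewrite quot_projK.
Qed.

Lemma env_actB u u' x : env_act (u - u') x = env_act u x - env_act u' x.
Proof.
by rewrite -[u]quot_projK -[u']quot_projK -rmorphB !env_act_proj (free_actB (repr u)).
Qed.

Lemma env_actD u u' x : env_act (u + u') x = env_act u x + env_act u' x.
Proof.
by rewrite -[u]quot_projK -[u']quot_projK -rmorphD !env_act_proj (free_actD (repr u)).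
Qed.

Lemma env_actM u u' x : env_act (u * u') x = env_act u (env_act u' x).
Proof.
by rewrite -[u]quot_projK -[u']quot_projK -rmorphM !env_act_proj (free_actM (repr u)).
Qed.

Lemma env_act_scalar a x : env_act (env_scalar br a) x = a *: x.
Proof. by rewrite env_act_proj free_act_scalar. Qed.

Lemma env_act_gen X x : env_act (env_gen br X) x = op X x.
Proof. by rewrite env_act_proj free_act_gen1. Qed.

Lemma env_act_ideal u x : two_sided_ideal (red_relation p pmap chi) u -> env_act u x = 0.
Proof.
move=> Iu; elim: {u}Iu x => [u [X]||u u' _ IHu _ IHu'|u u' _ IHu'|u u' _ IHu'] x.
- rewrite !env_actB env_act_scalar env_act_gen.
  have -> : env_act (env_gen br X ^+ p) x = iter p (op X) x.
    elim: (p) => [|m IHm]; last by rewrite exprS env_actM IHm env_act_gen.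
    by rewrite expr0 -(rmorph1 (quot_proj _)) env_act_proj -[1]scale1r
      free_act_scalar scale1r.
  by rewrite op_pmap -addrA -opprD subrr.
- by rewrite -(rmorph0 (quot_proj _)) env_act_proj free_act0.
- by rewrite env_actD IHu IHu' addr0.
- by rewrite env_actM IHu' /env_act free_act_x0.
- by rewrite env_actM IHu'.
Qed.

Local Notation red := (red_env_alg br p pmap chi).

Definition red_act (u : red) (x : A) : A := env_act (repr u) x.

Lemma red_act_proj u x :
  red_act (quot_proj (red_relation p pmap chi) u) x = env_act u x.
Proof.
apply/eqP; rewrite -subr_eq0 -env_actB; apply/eqP/env_act_ideal.
by apply/quot_projP; rewrite quot_projK.
Qed.

Lemma red_actD (u u' : red) x : red_act (u + u') x = red_act u x + red_act u' x.
Proof.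
by rewrite -[u]quot_projK -[u']quot_projK -rmorphD !red_act_proj env_actD.
Qed.

Lemma red_actM (u u' : red) x : red_act (u * u') x = red_act u (red_act u' x).
Proof.
by rewrite -[u]quot_projK -[u']quot_projK -rmorphM !red_act_proj env_actM.
Qed.

Lemma red_act_scalar a x : red_act (red_scalar br p pmap chi a) x = a *: x.
Proof. by rewrite red_act_proj env_act_scalar. Qed.

Lemma red_act_gen X x : red_act (red_gen br p pmap chi X) x = op X x.
Proof. by rewrite red_act_proj env_act_gen. Qed.

Lemma red_act_is_linear u : linear (red_act u).
Proof. exact: free_act_is_linear. Qed.

Lemma red_act_x0 u : red_act u 0 = 0.
Proof. exact: free_act_x0. Qed.

Lemma red_act_xD u x y : red_act u (x + y) = red_act u x + red_act u y.
Proof. by rewrite -[x]scale1r red_act_is_linear !scale1r. Qed.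

Variables (act : red -> K -> K -> Prop) (w : A).
Hypothesis w_act : forall u m m', act u m m' -> red_act u (m *: w) = m' *: w.

Definition tensor_eval (f : free_lmod red K) : A :=
  \sum_(m <- msupp f) red_act f@_m (m *: w).

Lemma red_act0 x : red_act 0 x = 0.
Proof.
by apply: (addrI (red_act 0 x)); rewrite -red_actD !addr0.
Qed.

Lemma tensor_evalEw (d : {fset K}) (f : free_lmod red K) : (msupp f `<=` d)%fset ->
  tensor_eval f = \sum_(m <- d) red_act f@_m (m *: w).
Proof.
move=> le; rewrite [LHS](big_fset_incl _ le) => //= m md /mcoeff_outdom ->.
exact: red_act0.
Qed.

Lemma tensor_evalD f g : tensor_eval (f + g) = tensor_eval f + tensor_eval g.
Proof.
rewrite (tensor_evalEw (msuppD_le f g)) (tensor_evalEw (fsubsetUl (msupp f) (msupp g))).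
rewrite (tensor_evalEw (fsubsetUr (msupp f) (msupp g))) -big_split /=.
by apply: eq_bigr => m _; rewrite mcoeffD red_actD.
Qed.

Lemma tensor_eval0 : tensor_eval 0 = 0.
Proof. by apply: (addrI (tensor_eval 0)); rewrite -tensor_evalD !addr0. Qed.

Lemma tensor_evalB f g : tensor_eval (f - g) = tensor_eval f - tensor_eval g.
Proof. by apply/eqP; rewrite eq_sym subr_eq -tensor_evalD subrK. Qed.

Lemma tensor_eval_elt u m : tensor_eval (free_elt u m) = red_act u (m *: w).
Proof.
rewrite (@tensor_evalEw [fset m]%fset) ?big_seq_fset1 ?mcoeffUU //; exact: msuppU_le.
Qed.

Lemma tensor_evalZ u f : tensor_eval (u *: f) = red_act u (tensor_eval f).
Proof.
have le : (msupp (u *: f) `<=` msupp f)%fset.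
  apply/fsubsetP => m; rewrite -!mcoeff_neq0 free_scaleE; apply: contraNneq => ->.
  by rewrite mulr0.
rewrite (tensor_evalEw le) /tensor_eval.
rewrite (big_morph (red_act u) (red_act_xD u) (red_act_x0 u)); apply: eq_bigr => m _.
by rewrite free_scaleE red_actM.
Qed.

Lemma tensor_eval_span f : submodule_span (tensor_relation act) f -> tensor_eval f = 0.
Proof.
elim=> [_ [u m m'|u b m m' bm]||f1 g _ IHf _ IHg|u f1 _ IHf].
- rewrite tensor_evalB tensor_evalD !tensor_eval_elt scalerDl.
  by rewrite red_act_xD subrr.
- by rewrite tensor_evalB !tensor_eval_elt red_actM (w_act bm) subrr.
- exact: tensor_eval0.
- by rewrite tensor_evalD IHf IHg addr0.
- by rewrite tensor_evalZ IHf red_act_x0.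
Qed.

(** A vector w on which the subring acts as prescribed yields an evaluation u (x) m |-> u (m w) on
    the tensor product, and 1 (x) 1 goes to w. *)
Lemma tensor_neq0 : w != 0 ->
  lmod_proj (tensor_relation act) (free_elt 1 1) != 0.
Proof.
apply: contraNneq => /eqP; rewrite -(linear0 (lmod_proj _)) => /eqP/lmod_projP.
rewrite subr0 => /tensor_eval_span; rewrite tensor_eval_elt scale1r => <-.
by rewrite -(rmorph1 (red_scalar br p pmap chi)) red_act_scalar scale1r.
Qed.

End Representation.

(** * Twisted derivations in characteristic p *)

(** The inductive step shared by the Leibniz formula [iter_twistM] and by [deriv_twist_poly]. *)
Lemma pascal_sum (A : zmodType) (W : nat -> nat -> A) m :
  \sum_(i < m.+2) W (m.+1 - i)%N i *+ 'C(m.+1, i) =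
  \sum_(i < m.+1) (W (m - i).+1%N i + W (m - i)%N i.+1) *+ 'C(m, i).
Proof.
under [RHS]eq_bigr do rewrite mulrnDl.
rewrite big_split /= big_ord_recl /= subn0 bin0.
under eq_bigr => i _ do rewrite /bump leq0n add1n binS mulrnDr subSS.
rewrite big_split /= addrA; congr (_ + _); rewrite [RHS]big_ord_recl /= subn0 bin0.
congr (_ + _); rewrite big_ord_recr /= bin_small // mulr0n addr0.
by apply: eq_bigr => i _; rewrite /bump leq0n add1n subnSK.
Qed.

Section Derivation.
Variables (A : idomainType) (p : nat) (charAp : p \in [pchar A]).
Variable D : A -> A.
Hypothesis DD : forall x y, D (x + y) = D x + D y.
Hypothesis DM : forall x y, D (x * y) = D x * y + x * D y.

Lemma derivation0 : D 0 = 0.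
Proof. by apply: (addrI (D 0)); rewrite -DD !addr0. Qed.

Lemma derivation1 : D 1 = 0.
Proof. by apply: (addrI (D 1)); rewrite addr0 -[RHS](congr1 D (mulr1 1)) DM mulr1 mul1r. Qed.

Lemma derivationMn x m : D (x *+ m) = D x *+ m.
Proof. by elim: m => [|m IHm]; rewrite ?mulr0n ?derivation0 // !mulrS DD IHm. Qed.

Variable a : A.

Definition twist x : A := D x + a * x.

Lemma twistD x y : twist (x + y) = twist x + twist y.
Proof. by rewrite /twist DD mulrDr addrACA. Qed.

Lemma twistMn x m : twist (x *+ m) = twist x *+ m.
Proof. by rewrite /twist derivationMn mulrnAr mulrnDl. Qed.

Lemma twistM x y : twist (x * y) = twist x * y + x * D y.
Proof. by rewrite /twist DM mulrDl addrAC mulrA. Qed.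

Lemma twist0 : twist 0 = 0.
Proof. by rewrite /twist derivation0 mulr0 addr0. Qed.

Lemma iter_twistM x y m : iter m twist (x * y) =
  \sum_(i < m.+1) (iter (m - i)%N twist x * iter i D y) *+ 'C(m, i).
Proof.
elim: m => [|m IHm]; first by rewrite big_ord1 bin0.
rewrite (pascal_sum (fun k i => iter k twist x * iter i D y)).
rewrite iterS IHm (big_morph twist twistD twist0); apply: eq_bigr => i _.
by rewrite twistMn twistM.
Qed.

Let p_pr := pcharf_prime charAp.

Lemma mulrn_bin_pchar (x : A) i : (0 < i < p)%N -> x *+ 'C(p, i) = 0.
Proof.
move=> ip; have /dvdnP[q ->] := prime_dvd_bin p_pr ip.
by rewrite mulrnA -mulr_natl (pcharf0 charAp) mul0r.
Qed.

Lemma iter_twist_pchar x : iter p twist x = iter p D x + iter p twist 1 * x.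
Proof.
rewrite -{1}[x]mul1r iter_twistM.
have [q pE] : exists q, p = q.+1 by exists p.-1; rewrite prednK ?prime_gt0.
rewrite -(big_mkord xpredT
  (fun i => (iter (p - i)%N twist 1 * iter i D x) *+ 'C(p, i))).
rewrite big_nat_recl // pE big_nat_recr // -pE subnn binn subn0 bin0 mul1r.
rewrite big_nat big1 => [|i iq]; first by rewrite /= !mulr1n add0r addrC.
by rewrite mulrn_bin_pchar // pE ltnS.
Qed.

(* [twist_poly m] is the m-th iterate of D + t a on 1, with t a formal        *)
(* parameter: its t-derivative is computed by marking one factor a.           *)
Fixpoint twist_poly m : {poly A} :=
  if m is k.+1 then map_poly D (twist_poly k) + a *: ('X * twist_poly k) else 1.

Lemma coef_twist_poly m i : (twist_poly m.+1)`_i =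
  D (twist_poly m)`_i + (if i is k.+1 then a * (twist_poly m)`_k else 0).
Proof.
rewrite /= coefD coef_map_id0 ?derivation0 // coefZ coefXM; congr (_ + _).
by case: i => [|i] //=; rewrite mulr0.
Qed.

Lemma coef_twist_poly_gt m i : (m < i)%N -> (twist_poly m)`_i = 0.
Proof.
elim: m i => [|m IHm] [|i] // mi; first by rewrite coef1.
by rewrite coef_twist_poly !IHm ?derivation0 ?mulr0 ?addr0 // ltnW.
Qed.

Lemma coef_twist_poly_top m : (twist_poly m)`_m = a ^+ m.
Proof.
elim: m => [|m IHm]; first by rewrite coef1.
by rewrite coef_twist_poly coef_twist_poly_gt // derivation0 add0r IHm exprS.
Qed.

Lemma coef_twist_poly0 m : (0 < m)%N -> (twist_poly m)`_0 = 0.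
Proof.
elim: m => [//|m IHm] _; rewrite coef_twist_poly addr0.
case: m IHm => [|m] IHm; first by rewrite coef1 derivation1.
by rewrite IHm ?derivation0.
Qed.

(** Over the rationals the exponential generating series of [twist_poly] would be exp(t sum_(i >= 1)
    D^(i - 1)(a) z^i / i!). These are the coefficients of the exponent, and [deriv_twist_poly] is
    the t-derivative of that identity, free of denominators. *)
Definition mark i : A := if i is k.+1 then iter k D a else 0.

Lemma deriv_twist_poly m : (twist_poly m)^`() =
  \sum_(i < m.+1) (mark i *: twist_poly (m - i)) *+ 'C(m, i).
Proof.
elim: m => [|m IHm]; first by rewrite big_ord1 /= derivC scale0r mul0rn.
rewrite (pascal_sum (fun k i => mark i *: twist_poly k)).
apply/polyP => j; rewrite coef_deriv coef_twist_poly mulrnDl -derivationMn.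
rewrite -coef_deriv IHm !coef_sum.
rewrite (big_morph D DD derivation0).
have -> : (a * (twist_poly m)`_j) *+ j.+1 = a * (twist_poly m)`_j
   + (if j is k.+1 then a * (twist_poly m)^`()`_k else 0).
  case: j => [|j]; first by rewrite mulr1n addr0.
  by rewrite coef_deriv mulrS mulrnAr.
rewrite addrCA.
transitivity (a * (twist_poly m)`_j + \sum_(i < m.+1)
   (mark i * (twist_poly (m - i).+1)`_j + D (mark i) * (twist_poly (m - i))`_j) *+ 'C(m, i)).
  congr (_ + _); case: j => [|j].
    rewrite addr0; apply: eq_bigr => i _; rewrite coefMn coefZ derivationMn DM.
    by rewrite coef_twist_poly addr0 addrC.
  rewrite IHm coef_sum mulr_sumr -big_split /=; apply: eq_bigr => i _.
  rewrite !coefMn !coefZ derivationMn DM mulrnAr -mulrnDl coef_twist_poly; congr (_ *+ _).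
  by ring.
rewrite big_ord_recl [RHS]big_ord_recl /= !bin0 !mulr1n subn0 mul0r derivation0 mul0r.
rewrite !add0r scale0r add0r coefZ; congr (_ + _).
by apply: eq_bigr => i _; rewrite [RHS]coefMn [X in _ = X *+ _]coefD; congr ((_ + _) *+ _); rewrite coefZ.
Qed.

Lemma iter_twist1 m : iter m twist 1 = (twist_poly m).[1].
Proof.
have E k : (twist_poly k).[1] = \sum_(i < k.+1) (twist_poly k)`_i.
  rewrite (@horner_coef_wide _ k.+1) => [|].
    by apply: eq_bigr => i _; rewrite expr1n mulr1.
  by apply/leq_sizeP => i; exact: coef_twist_poly_gt.
elim: m => [|m IHm]; first by rewrite hornerC.
rewrite iterS IHm !E /twist (big_morph D DD derivation0) mulr_sumr.
under [RHS]eq_bigr do rewrite coef_twist_poly.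
rewrite big_split /= [X in _ = X + _]big_ord_recr /= coef_twist_poly_gt // derivation0 addr0.
by congr (_ + _); rewrite [RHS]big_ord_recl /= add0r.
Qed.

(** At m = p only the term i = p of [deriv_twist_poly] survives, so the t-derivative is constant and
    the coefficients of degrees 2 to p - 1 vanish. Setting t = 1 gives Jacobson's formula for (D +
    a)^p applied to 1. *)
Lemma iter_twist1_pchar : iter p twist 1 = iter p.-1 D a + a ^+ p.
Proof.
have p_gt1 := prime_gt1 p_pr.
have dE : (twist_poly p)^`() = (iter p.-1 D a)%:P.
  rewrite deriv_twist_poly big_ord_recr /= subnn binn mulr1n.
  rewrite big1 ?add0r => [|i _].
    by case: (p) p_gt1 => //= q _; rewrite -mul_polyC mulr1.
  have [->|i0] := posnP i; first by rewrite scale0r mul0rn.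
  apply/polyP => j; rewrite coefMn coef0 mulrn_bin_pchar // i0.
  exact: ltn_ord.
rewrite iter_twist1 (@horner_coef_wide _ p.+1) => [|]; last first.
  by apply/leq_sizeP => i; exact: coef_twist_poly_gt.
under eq_bigr do rewrite expr1n mulr1.
rewrite big_ord_recr /= coef_twist_poly_top; congr (_ + _).
have coefE j : (j.+1 < p)%N -> (twist_poly p)`_j.+1 = if j is 0 then iter p.-1 D a else 0.
  move=> jp; have := congr1 (fun q : {poly A} => q`_j) dE.
  rewrite coef_deriv coefC; case: j jp => [|j] jp; first by rewrite mulr1n.
  move/eqP; rewrite -mulr_natl mulf_eq0 => /orP[|/eqP //].
  by rewrite -(dvdn_pcharf charAp) => /(dvdn_leq (ltn0Sn _)); rewrite leqNgt jp.
rewrite -(big_mkord xpredT (fun i => (twist_poly p)`_i)).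
rewrite big_ltn ?(ltnW p_gt1) // coef_twist_poly0 ?(ltnW p_gt1) // add0r.
rewrite big_ltn // coefE // big_nat big1 ?addr0 // => -[|[|i]] // /andP[_ ip].
exact: coefE.
Qed.

Lemma iter_twist x : iter p twist x = iter p D x + (iter p.-1 D a + a ^+ p) * x.
Proof. by rewrite iter_twist_pchar iter_twist1_pchar. Qed.

End Derivation.

(** * A module of functions on the matrix space *)

Lemma commutator_leibniz (A : comPzRingType) (r s yr ys zr zs yzr yzs zyr zys : A) :
  yzr * s + zr * ys + (yr * zs + r * yzs) - (zyr * s + yr * zs + (zr * ys + r * zys)) =
  (yzr - zyr) * s + r * (yzs - zys).
Proof. by ring. Qed.

Lemma twist_commutator (A : comPzRingType) (r a b ya zb yr zr yzr zyr : A) :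
  yzr + (ya * r + a * yr) + b * (zr + a * r) - (zyr + (zb * r + b * zr) + a * (yr + b * r)) =
  yzr - zyr + (ya - zb) * r.
Proof. by ring. Qed.

Section CoordinateRing.
Import mpoly.
Variables (K : fieldType) (p : nat) (charKp : p \in [pchar K]) (n : nat).

Local Notation R := {mpoly K[n * n]}.
Local Notation CM := (map_mx (@mpolyC (n * n) K)).

Definition coord_mx : 'M[R]_n := vec_mx (\row_k 'X_k).

Local Notation y := coord_mx.

Lemma coord_mxE i j : y i j = 'X_(mxvec_index i j).
Proof. by rewrite !mxE. Qed.

Lemma map_mpolyC_mul (A B : 'M[K]_n) : CM (A *m B) = CM A *m CM B.
Proof. exact: map_mxM. Qed.

(* The derivation with y |-> y *m Y on the matrix y of coordinates, i.e. the  *)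
(* vector field of right translations.                                        *)
Definition deriv_mx (Y : 'M[K]_n) (r : R) : R :=
  \sum_k mderiv k r * mxvec (y *m CM Y) 0 k.

Lemma deriv_mxD Y r s : deriv_mx Y (r + s) = deriv_mx Y r + deriv_mx Y s.
Proof. by rewrite -big_split; apply: eq_bigr => k _; rewrite mderivD mulrDl. Qed.

Lemma deriv_mxM Y r s : deriv_mx Y (r * s) = deriv_mx Y r * s + r * deriv_mx Y s.
Proof.
rewrite mulr_suml mulr_sumr -big_split; apply: eq_bigr => k _ /=.
by rewrite mderivM mulrDl mulrAC mulrA.
Qed.

Lemma deriv_mxC Y c : deriv_mx Y c%:MP = 0.
Proof. by apply: big1 => k _; rewrite mderivC mul0r. Qed.

Lemma deriv_mxZ Y c r : deriv_mx Y (c *: r) = c *: deriv_mx Y r.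
Proof. by rewrite -!mul_mpolyC deriv_mxM deriv_mxC mul0r add0r. Qed.

Lemma deriv_coord Y i j : deriv_mx Y (y i j) = (y *m CM Y) i j.
Proof.
rewrite /deriv_mx (bigD1 (mxvec_index i j)) //= big1 => [|k kij].
  rewrite addr0 coord_mxE mxvecE mderivX mnm1E eqxx scale1r.
  by rewrite (_ : (U_(mxvec_index i j) - U_(mxvec_index i j))%MM = 0%MM)
    ?mpolyX0 ?mul1r //; apply/mnmP => l; rewrite mnmBE subnn mnm0E.
by rewrite coord_mxE mderivX mnm1E eq_sym (negbTE kij) scale0r mul0r.
Qed.

Lemma deriv_mx_coord Y (B : 'M[K]_n) i j :
  deriv_mx Y ((y *m CM B) i j) = (y *m CM (Y *m B)) i j.
Proof.
rewrite map_mpolyC_mul mulmxA [in LHS]mxE [in RHS]mxE.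
rewrite (big_morph (deriv_mx Y) (deriv_mxD Y) (deriv_mxC Y 0)).
apply: eq_bigr => l _; rewrite deriv_mxM deriv_coord [in X in _ + _ * X]mxE.
by rewrite deriv_mxC mulr0 addr0.
Qed.

Lemma derivation_ext (d d' : R -> R) :
  (forall r s, d (r + s) = d r + d s) -> (forall r s, d' (r + s) = d' r + d' s) ->
  (forall r s, d (r * s) = d r * s + r * d s) ->
  (forall r s, d' (r * s) = d' r * s + r * d' s) ->
  (forall c, d c%:MP = 0) -> (forall c, d' c%:MP = 0) ->
  (forall i j, d (y i j) = d' (y i j)) -> d =1 d'.
Proof.
move=> dD d'D dM d'M dC d'C dy.
have d1 : d 1 = d' 1 by rewrite -mpolyC1 dC d'C.
have dX m : d 'X_[m] = d' 'X_[m].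
  rewrite mpolyXE_id; elim/big_rec: _ => // k s _ IHs; rewrite dM d'M IHs.
  congr (_ * _ + _); elim: (m k) => [|e IHe]; first by rewrite !expr0.
  rewrite exprS dM d'M IHe; congr (_ * _ + _).
  by case/mxvec_indexP: k {IHe} => i j; rewrite -coord_mxE.
elim/mpolyind => [|c m r _ _ IHr]; first by rewrite -mpolyC0 dC d'C.
by rewrite dD d'D IHr -mul_mpolyC dM d'M dC d'C dX.
Qed.

Lemma deriv_mx_bracket Y Z r :
  deriv_mx Y (deriv_mx Z r) - deriv_mx Z (deriv_mx Y r) = deriv_mx (Y *m Z - Z *m Y) r.
Proof.
move: r; apply: derivation_ext; try exact: deriv_mxD; try exact: deriv_mxM;
  try exact: deriv_mxC.
- by move=> r s; rewrite !deriv_mxD opprD addrACA.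
- by move=> r s; rewrite !(deriv_mxM, deriv_mxD); exact: commutator_leibniz.
- by move=> c; rewrite !deriv_mxC subrr.
move=> i j; rewrite !deriv_coord !deriv_mx_coord.
rewrite map_mxB mulmxBr.
by move: (y *m CM (Y *m Z)) (y *m CM (Z *m Y)) => A B; rewrite !mxE.
Qed.

Lemma deriv_mx_linear a Y Z r : deriv_mx (a *: Y + Z) r = a *: deriv_mx Y r + deriv_mx Z r.
Proof.
rewrite scaler_sumr -big_split; apply: eq_bigr => k _ /=.
have -> : CM (a *: Y + Z) = a%:MP *: CM Y + CM Z.
  by apply/matrixP => i j; rewrite !mxE mpolyCD mpolyCM.
rewrite mulmxDr -scalemxAr; move: (y *m CM Y) (y *m CM Z) (mderiv k r) => A B m.
case/mxvec_indexP: k => i j; rewrite !mxvecE !mxE mulrDr.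
by rewrite mulrCA mul_mpolyC.
Qed.

Lemma iter_derivD Y m r s :
  iter m (deriv_mx Y) (r + s) = iter m (deriv_mx Y) r + iter m (deriv_mx Y) s.
Proof. by elim: m => //= m ->; rewrite deriv_mxD. Qed.

Lemma iter_deriv_coord Y m i j : iter m (deriv_mx Y) (y i j) = (y *m CM (Y ^+ m)) i j.
Proof.
elim: m => [|m IHm]; first by rewrite expr0 map_mx1 mulmx1.
by rewrite iterS IHm deriv_mx_coord exprS.
Qed.

Lemma charRp : p \in [pchar R].
Proof. exact: (rmorph_pchar (@mpolyC _ K)). Qed.

(** In characteristic p the p-th iterate of a derivation is a derivation, so it suffices to compare
    on the coordinates. *)
Lemma iter_deriv_pchar Y r : iter p (deriv_mx Y) r = deriv_mx (Y ^+ p) r.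
Proof.
have p_gt0 := prime_gt0 (pcharf_prime charKp).
move: r; apply: derivation_ext; try exact: deriv_mxD; try exact: deriv_mxM;
  try exact: deriv_mxC.
- exact: iter_derivD.
- move=> r s.
  have twist0E m x : iter m (twist (deriv_mx Y) 0) x = iter m (deriv_mx Y) x.
    by elim: m => //= m ->; rewrite /twist mul0r addr0.
  rewrite -twist0E (iter_twistM (deriv_mxD Y) (deriv_mxM Y)).
  have [q pE] : exists q, p = q.+1 by exists p.-1; rewrite prednK.
  rewrite -(big_mkord xpredT (fun i => (iter (p - i)%N (twist (deriv_mx Y) 0) r *
     iter i (deriv_mx Y) s) *+ 'C(p, i))).
  rewrite big_nat_recl // pE big_nat_recr // -pE subnn binn subn0 bin0.
  rewrite big_nat big1 => [|i iq].
    by rewrite !mulr1n twist0E /Algebra.add /= add0r.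
  by rewrite (mulrn_bin_pchar charRp) // pE ltnS.
- by move=> c; rewrite -(prednK p_gt0) iterSr deriv_mxC; elim: p.-1 => //= m ->;
    exact: derivation0 (deriv_mxD _).
by move=> i j; rewrite iter_deriv_coord deriv_coord.
Qed.

Definition linform (B : 'M[K]_n) : R := \tr (CM B *m y).

Lemma linformE B : linform B = \sum_i \sum_j (B i j)%:MP * y j i.
Proof. by apply: eq_bigr => i _; rewrite mxE; apply: eq_bigr => j _; rewrite mxE. Qed.

Lemma linform_linear a B C : linform (a *: B + C) = a *: linform B + linform C.
Proof.
rewrite /linform -mul_mpolyC; have -> : CM (a *: B + C) = a%:MP *: CM B + CM C.
  by apply/matrixP => i j; rewrite !mxE mpolyCD mpolyCM.
by rewrite mulmxDl -scalemxAl linearD linearZ.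
Qed.

Lemma linformB B C : linform (B - C) = linform B - linform C.
Proof. by rewrite addrC -scaleN1r linform_linear scaleN1r addrC. Qed.

Lemma deriv_linform Y B : deriv_mx Y (linform B) = linform (Y *m B).
Proof.
rewrite {2}/linform map_mpolyC_mul -mulmxA mxtrace_mulC -mulmxA linformE.
rewrite (big_morph (deriv_mx Y) (deriv_mxD Y) (deriv_mxC Y 0)).
apply: eq_bigr => i _; rewrite (big_morph (deriv_mx Y) (deriv_mxD Y) (deriv_mxC Y 0)).
rewrite mxE; apply: eq_bigr => j _.
by rewrite deriv_mxM deriv_mxC mul0r add0r deriv_coord [CM B i j]mxE.
Qed.

Lemma iter_deriv_linform Y B m :
  iter m (deriv_mx Y) (linform B) = linform (Y ^+ m *m B).
Proof.
elim: m => [|m IHm]; first by rewrite expr0 mul1mx.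
by rewrite iterS IHm deriv_linform mulmxA exprS.
Qed.

Variable e : 'M[K]_n.

(** Formally the conjugate of [deriv_mx Y] by exp(tr(e y)), because [linform (Y *m e)] is the
    derivative of [linform e]. Hence brackets are respected, while the p-th power acquires the extra
    term [linform (Y *m e) ^+ p]. *)
Definition field_op (Y : 'M[K]_n) : R -> R := twist (deriv_mx Y) (linform (Y *m e)).

Lemma field_opD Y r s : field_op Y (r + s) = field_op Y r + field_op Y s.
Proof. exact: (twistD (deriv_mxD Y)). Qed.

Lemma field_opZ Y a r : field_op Y (a *: r) = a *: field_op Y r.
Proof. by rewrite /field_op /twist deriv_mxZ -scalerAr scalerDr. Qed.

Lemma field_op_linearl a Y Z r : field_op (a *: Y + Z) r = a *: field_op Y r + field_op Z r.
Proof.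
rewrite /field_op /twist deriv_mx_linear mulmxDl -scalemxAl linform_linear mulrDl.
by rewrite scalerDr scalerAl addrACA.
Qed.

Lemma field_op_bracket Y Z r :
  field_op Y (field_op Z r) - field_op Z (field_op Y r) = field_op (Y *m Z - Z *m Y) r.
Proof.
rewrite /field_op /twist -deriv_mx_bracket !deriv_mxD !deriv_mxM !deriv_linform.
rewrite mulmxBl linformB -!mulmxA; exact: twist_commutator.
Qed.

Lemma iter_field_op Y r : iter p (field_op Y) r =
  field_op (Y ^+ p) r + linform (Y *m e) ^+ p * r.
Proof.
have p_gt0 := prime_gt0 (pcharf_prime charKp).
rewrite /field_op (iter_twist charRp (deriv_mxD Y) (deriv_mxM Y)) iter_deriv_pchar.
rewrite iter_deriv_linform mulmxA -[_ *m Y]/(_ * Y) -exprSr prednK //.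
by rewrite mulrDl addrA.
Qed.

(** The factor h makes the K-linear span an ideal. The quotient is the function ring of the first
    Frobenius kernel of GL_n; in it the p-th power of [linform B] becomes the constant (tr B)^p,
    which produces the term chi(X)^p. *)
Definition pth_power_relation (r : R) : Prop :=
  exists h i j, r = h * (y i j ^+ p - (i == j)%:R).

Local Notation I := (submodule_span pth_power_relation).

Lemma ideal_mul h r : I r -> I (h * r).
Proof.
elim=> [_ [h' [i [j ->]]]||r1 r2 _ I1 _ I2|a r1 _ I1].
- by apply: Span_gen; exists (h * h'), i, j; rewrite mulrA.
- by rewrite mulr0; exact: Span_zero.
- by rewrite mulrDr; exact: Span_add.
- by rewrite -scalerAr; exact: Span_scale.
Qed.

Lemma deriv_pth_power Y i j : deriv_mx Y (y i j ^+ p - (i == j)%:R) = 0.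
Proof.
rewrite -mpolyC_nat -mpolyCN deriv_mxD deriv_mxC addr0.
have -> m : deriv_mx Y (y i j ^+ m) = (y i j ^+ m.-1 * deriv_mx Y (y i j)) *+ m.
  elim: m => [|m IHm]; first by rewrite expr0 -mpolyC1 deriv_mxC.
  rewrite exprS deriv_mxM IHm mulrC mulrnAr mulrA -exprS /=.
  by case: m IHm => [|m] _; rewrite /= ?mulr0n ?addr0 // mulrS.
by rewrite -mulr_natl (pcharf0 charRp) mul0r.
Qed.

Lemma field_op_ideal Y r : I r -> I (field_op Y r).
Proof.
elim=> [_ [h [i [j ->]]]||r1 r2 _ I1 _ I2|a r1 _ I1].
- rewrite /field_op (twistM (deriv_mxM Y)) deriv_pth_power mulr0 addr0.
  by apply: Span_gen; exists (twist (deriv_mx Y) (linform (Y *m e)) h), i, j.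
- by rewrite /field_op (twist0 (deriv_mxD Y)); exact: Span_zero.
- by rewrite field_opD; exact: Span_add.
- by rewrite field_opZ; exact: Span_scale.
Qed.

Lemma linform_pth_power B : I (linform B ^+ p - (\tr B ^+ p)%:MP).
Proof.
have trE : (\tr B ^+ p)%:MP = \sum_i \sum_j (B i j ^+ p)%:MP * (j == i)%:R :> R.
  rewrite -(pFrobenius_autE charKp) rmorph_sum rmorph_sum /=; apply: eq_bigr => i _.
  rewrite (bigD1 i) //= eqxx mulr1 big1 ?addr0 ?pFrobenius_autE // => j ji.
  by rewrite (negbTE ji) mulr0.
rewrite trE linformE -(pFrobenius_autE charRp) rmorph_sum /= -sumrB.
elim/big_ind: _ => [||i _]; first exact: Span_zero.
  by move=> ? ?; exact: Span_add.
rewrite rmorph_sum /= -sumrB; elim/big_ind: _ => [||j _]; first exact: Span_zero.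
  by move=> ? ?; exact: Span_add.
rewrite rmorphM /= !pFrobenius_autE -rmorphXn -mulrBr; apply: ideal_mul.
by apply: Span_gen; exists 1, j, i; rewrite mul1r.
Qed.

Lemma lower_monomial_ideal (q : 'X_{1..n * n}) (i j : 'I_n) : (j < i)%N ->
  (p <= q (mxvec_index i j))%N -> I 'X_[q].
Proof.
move=> ji qp; set k := mxvec_index i j.
have -> : 'X_[q] = 'X_[q - U_(k) *+ p] * (y i j ^+ p - (i == j)%:R) :> R.
  rewrite (_ : (i == j) = false) ?subr0 ?coord_mxE ?mpolyXn -?mpolyXD ?submK //.
    by apply/mnm_lepP => l; rewrite mulmnE mnm1E; case: eqP => [<-|]; rewrite ?mul1n.
  by apply/eqP => ij; rewrite ij ltnn in ji.
by apply: Span_gen; exists 'X_[q - U_(k) *+ p], i, j.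
Qed.

Variable d : 'I_n -> nat.

Definition eigen_expo : 'M[nat]_n :=
  \matrix_(i, j) if (j < i)%N then p.-1 else if i == j then d j else 0%N.

Definition eigen_mnm : 'X_{1..n * n} := [multinom mxvec eigen_expo 0%R k | k < n * n].

Definition eigen_weight (Y : 'M[K]_n) : K :=
  \sum_k (eigen_mnm k)%:R * mxvec (\matrix_(i, j) Y j j) 0 k.

Hypothesis e_strict : forall i j : 'I_n, (j <= i)%N -> e i j = 0.

(** For upper triangular Y the derivation replaces a factor y_(i, j) by y_(i, l) with l <= j. The
    case l = j gives the weight. If l < j, then l < j <= i, so y_(i, l) is below the diagonal,
    already has exponent p - 1, and its p-th power lies in the ideal. *)
Lemma deriv_eigen (Y : 'M[K]_n) : upper_triangular Y ->
  I (deriv_mx Y 'X_[eigen_mnm] - eigen_weight Y *: 'X_[eigen_mnm]).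
Proof.
move=> Yup; rewrite /deriv_mx /eigen_weight scaler_suml -sumrB.
elim/big_ind: _ => [||k _]; first exact: Span_zero.
  by move=> ? ?; exact: Span_add.
rewrite mderivX; have [->|mk] := posnP (eigen_mnm k).
  by rewrite !mulr0n scale0r !mul0r scale0r subrr; exact: Span_zero.
rewrite -scalerAl -[in X in _ - X]scalerA -scalerBr; apply: Span_scale.
case/mxvec_indexP: k mk => i j mk; rewrite !mxvecE.
have -> : (\matrix_(a < n, b < n) Y b b) i j = Y j j by rewrite mxE.
rewrite [(y *m _) i j]mxE.
rewrite mulr_sumr (bigD1 j) //= coord_mxE [CM Y j j]mxE mulrA -mpolyXD submK; last first.
  by apply/mnm_lepP => l; rewrite mnm1E; case: eqP => [<-|].
rewrite [_ * (Y j j)%:MP]mulrC mul_mpolyC addrAC subrr add0r.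
elim/big_ind: _ => [||l lj]; first exact: Span_zero.
  by move=> ? ?; exact: Span_add.
rewrite coord_mxE [CM Y l j]mxE mulrA -mpolyXD mulrC.
have [jl|lj'] := ltnP j l; first by rewrite Yup // mpolyC0 mul0r; exact: Span_zero.
have {lj lj'}lj : (l < j)%N by rewrite ltn_neqAle lj'; move: lj; rewrite -val_eqE /= => ->.
have ji : (j <= i)%N.
  have [//|ij] := leqP j i; move: mk; rewrite /eigen_mnm mnmE mxvecE mxE.
  by rewrite (ltnNge j i) (ltnW ij) /=; case: eqP => // ijE; rewrite ijE ltnn in ij.
have li : (l < i)%N := leq_trans lj ji.
apply/ideal_mul/(lower_monomial_ideal li).
rewrite mnmDE mnmBE !mnm1E eqxx /eigen_mnm mnmE mxvecE mxE li.
rewrite (_ : (mxvec_index i j == mxvec_index i l) = false).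
  by rewrite subn0 addn1 prednK // prime_gt0 // (pcharf_prime charKp).
apply/negP => /eqP /(congr1 (mxvec (\matrix_(_ < n, b < n) (b : nat)) 0)).
by rewrite !mxvecE !mxE => jl; rewrite jl ltnn in lj.
Qed.

(** Y e is strictly upper triangular, so tr(Y e y) involves only coordinates below the diagonal,
    each of which multiplies the monomial into the ideal. *)
Lemma field_op_eigen (Y : 'M[K]_n) : upper_triangular Y ->
  I (field_op Y 'X_[eigen_mnm] - eigen_weight Y *: 'X_[eigen_mnm]).
Proof.
move=> Yup; rewrite /field_op /twist addrAC; apply: Span_add; first exact: deriv_eigen.
rewrite linformE mulr_suml; elim/big_ind: _ => [||i _]; first exact: Span_zero.
  by move=> ? ?; exact: Span_add.
rewrite mulr_suml; elim/big_ind: _ => [||j _]; first exact: Span_zero.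
  by move=> ? ?; exact: Span_add.
have [ij|ji] := ltnP i j; last first.
  rewrite mxE big1 ?mpolyC0 ?mul0r => [|l _]; first exact: Span_zero.
  have [li|il] := ltnP l i; first by rewrite Yup // mul0r.
  by rewrite e_strict ?mulr0 // (leq_trans ji).
rewrite -mulrA coord_mxE -mpolyXD; apply/ideal_mul/(lower_monomial_ideal ij).
rewrite mnmDE mnm1E eqxx /eigen_mnm mnmE mxvecE mxE ij add1n prednK //.
by rewrite prime_gt0 // (pcharf_prime charKp).
Qed.

(** Restriction to lower unitriangular matrices. There the eigenvector becomes the product of all
    y_(i, j)^(p - 1) with i > j, whatever the diagonal exponents, and the coefficient of this
    monomial is a linear form that kills the ideal. *)
Definition borel_point : 'I_(n * n) -> R :=
  mxvec (\matrix_(i, j) if (j < i)%N then y i j else (i == j)%:R) 0.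

Definition top_mnm : 'X_{1..n * n} :=
  [multinom mxvec (\matrix_(i < n, j < n) if (j < i)%N then p.-1 else 0%N) 0%R k | k < n * n].

Definition top_coef (r : R) : K := (mmap (@mpolyC (n * n) K) borel_point r)@_top_mnm.

Lemma top_coef_ideal r : I r -> top_coef r = 0.
Proof.
elim=> [_ [h [i [j ->]]]||r1 r2 _ I1 _ I2|a r1 _ I1].
- rewrite /top_coef rmorphM rmorphB rmorphXn rmorph_nat /= coord_mxE.
  rewrite mmapX mmap1U /borel_point mxvecE mxE.
  have p_gt0 := prime_gt0 (pcharf_prime charKp).
  have [ji|ij] := ltnP j i; last first.
    by case: eqP => _; rewrite ?expr1n ?expr0n ?gtn_eqF // subrr mulr0 mcoeff0.
  rewrite (_ : (i == j) = false) ?subr0; last first.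
    by apply/eqP => ij; rewrite ij ltnn in ji.
  rewrite coord_mxE mpolyXn mcoeffM big1 // => -[k1 k2] /= /eqP kE.
  rewrite mcoeffX; case: eqP => [k2E|]; last by rewrite mulr0.
  have := congr1 (fun m : 'X_{1..n * n} => m (mxvec_index i j)) kE.
  rewrite /= mnmDE -k2E mulmnE mnm1E eqxx /top_mnm mnmE mxvecE mxE ji.
  by have := leq_addl (k1 (mxvec_index i j)) p; lia.
- by rewrite /top_coef rmorph0 mcoeff0.
- by rewrite /top_coef rmorphD mcoeffD -/(top_coef _) I1 -/(top_coef _) I2 addr0.
by rewrite /top_coef mmapZ mul_mpolyC mcoeffZ -/(top_coef _) I1 mulr0.
Qed.

Lemma eigen_not_ideal : ~ I 'X_[eigen_mnm].
Proof.
move=> /top_coef_ideal /eqP; rewrite /top_coef mmapX.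
have -> : mmap1 borel_point eigen_mnm = 'X_[top_mnm].
  rewrite mpolyXE_id; apply: eq_bigr => k _.
  case/mxvec_indexP: k => i j; rewrite /borel_point /eigen_mnm /top_mnm !mnmE.
  rewrite !mxvecE [in LHS]mxE [eigen_expo i j]mxE [in RHS]mxE.
  case: ltnP => ji; first by rewrite coord_mxE.
  by case: eqP => _; rewrite ?expr1n ?expr0.
by rewrite mcoeffX eqxx oner_eq0.
Qed.

End CoordinateRing.

(** * Baby Verma modules are nonzero *)

Lemma sum_mxvec_index (A : nmodType) n (F : 'I_(n * n) -> A) :
  \sum_k F k = \sum_i \sum_j F (mxvec_index i j).
Proof.
rewrite pair_bigA /= (reindex _ (curry_mxvec_bij _ _)) /=.
by apply: eq_bigr => -[i j].
Qed.

Lemma int_pchar_nat (K : fieldType) p (charKp : p \in [pchar K]) (z : int) :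
  exists m : nat, m%:R = z%:~R :> K.
Proof.
have p_gt0 := prime_gt0 (pcharf_prime charKp).
exists `|(z %% p)%Z|%N; rewrite {2}(divz_eq z p) rmorphD rmorphM /=.
rewrite -[p%:Z%:~R]/(p%:R) (pcharf0 charKp) mulr0 add0r.
have z_ge0 : (0 <= (z %% p)%Z)%R by apply: modz_ge0; lia.
by rewrite -[in RHS](gez0_abs z_ge0).
Qed.

Lemma sl_val_linear (K : fieldType) n a (X Y : sl K n) :
  sl_val (a *: X + Y) = a *: sl_val X + sl_val Y.
Proof. exact: (linearP (val : sl K n -> 'M[K]_n)). Qed.

Section NonZero.
Import mpoly.
Variables (K : fieldType) (p n : nat) (charKp : p \in [pchar K]).
Variables (b : sl K n -> Prop) (lam : weight n) (g e : 'M[K]_n).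
Hypothesis g_unit : g \in unitmx.
Hypothesis b_upper : conj_upper b g.
Hypothesis e_strict : forall i j : 'I_n, (j <= i)%N -> e i j = 0.
Hypothesis chi_e : forall X : sl K n, chi X = \tr ((g *m X *m invmx g) *m e).

Local Notation conj X := (g *m X *m invmx g).

Lemma conj_mulmx (X Y : 'M[K]_n) : conj (X *m Y) = conj X *m conj Y.
Proof. by rewrite !mulmxA mulmxKV. Qed.

Lemma conj_exp (X : 'M[K]_n) m : conj (X ^+ m) = conj X ^+ m.
Proof.
elim: m => [|m IHm]; first by rewrite !expr0 mulmx1 mulmxV.
by rewrite !exprS -IHm; exact: conj_mulmx.
Qed.

Let A := quot_lmod (@pth_power_relation K p n).
Let proj := lmod_proj (@pth_power_relation K p n).

Let projD r s : proj (r + s) = proj r + proj s.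
Proof. exact: lmod_projD. Qed.

Let projZ a r : proj (a *: r) = a *: proj r.
Proof. exact: lmod_projZ. Qed.

Let projB r s : proj (r - s) = proj r - proj s.
Proof. by rewrite -scaleN1r projD projZ scaleN1r. Qed.

Definition sl_op (X : sl K n) (a : A) : A := proj (field_op e (conj X) (repr a)).

Lemma field_op_sub Y r s : field_op e Y (r - s) = field_op e Y r - field_op e Y s :> _.
Proof. by rewrite -scaleN1r field_opD field_opZ scaleN1r. Qed.

Lemma sl_op_proj X r : sl_op X (proj r) = proj (field_op e (conj X) r).
Proof.
apply/lmod_projP; rewrite -field_op_sub; apply: (field_op_ideal charKp).
by apply/lmod_projP; rewrite lmod_projK.
Qed.

Lemma sl_op_linear X : linear (sl_op X).
Proof.
move=> a x y; rewrite -[x]lmod_projK -[y]lmod_projK -projZ -projD !sl_op_proj.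
by rewrite field_opD field_opZ projD projZ.
Qed.

Lemma sl_op_linearl a X Y x : sl_op (a *: X + Y) x = a *: sl_op X x + sl_op Y x.
Proof.
have XY : conj (a *: X + Y) = a *: conj X + conj Y.
  by rewrite sl_val_linear mulmxDr mulmxDl -scalemxAr -scalemxAl.
by rewrite /sl_op XY field_op_linearl projD projZ.
Qed.

Lemma sl_op_bracket X Y x :
  sl_op X (sl_op Y x) - sl_op Y (sl_op X x) = sl_op (sl_bracket X Y) x.
Proof.
rewrite -[x]lmod_projK; move: (repr x) => r.
rewrite (sl_op_proj Y r) (sl_op_proj X r) !sl_op_proj.
have -> : conj (sl_bracket X Y) = conj X *m conj Y - conj Y *m conj X.
  by rewrite /= mulmxBr mulmxBl !conj_mulmx.
by rewrite -field_op_bracket projB.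
Qed.

Lemma sl_op_pmap X x :
  iter p (sl_op X) x = sl_op (sl_pmap charKp X) x + chi X ^+ p *: x.
Proof.
rewrite -[x]lmod_projK; move: (repr x) => s.
have -> m r : iter m (sl_op X) (proj r) = proj (iter m (field_op e (conj X)) r).
  by elim: m => //= m ->; rewrite sl_op_proj.
rewrite sl_op_proj -projZ -projD; apply/lmod_projP.
rewrite (iter_field_op charKp) conj_exp opprD addrACA subrr add0r chi_e.
rewrite -mpoly.mul_mpolyC -mulrBl mulrC; apply: ideal_mul.
exact: linform_pth_power.
Qed.

Lemma ex_eigen_expo : exists d : 'I_n -> nat, forall Y : 'M[K]_n,
  eigen_weight p d Y = weight_eval lam Y.
Proof.
have p_gt0 := prime_gt0 (pcharf_prime charKp).
(* [mu j] is the coefficient of Y_(j, j) in the weight. The exponents p - 1 below the diagonal of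
   column j already contribute [low j], so the diagonal exponent has to supply the difference modulo
   p. *)
pose mu (j : 'I_n) : int := \sum_(i < n.-1 | (j <= i)%N) lam i.
pose low (j : 'I_n) : nat := (\sum_(i < n | j < i) p.-1)%N.
have /all_sig[d dE] (j : 'I_n) : {m : nat | m%:R = (mu j - (low j)%:Z)%:~R :> K}.
  exact/cid/(int_pchar_nat charKp).
exists d => Y; rewrite /eigen_weight sum_mxvec_index exchange_big /=.
transitivity (\sum_j (mu j)%:~R * Y j j).
  apply: eq_bigr => j _.
  under eq_bigr do rewrite mpoly.mnmE !mxvecE !mxE.
  rewrite -mulr_suml; congr (_ * _).
  rewrite (bigID (fun i : 'I_n => (j < i)%N)) /= (bigD1 j (P := fun i => ~~ _)) /=; last first.
    by rewrite ltnn.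
  rewrite ltnn eqxx dE rmorphB /= [X in _ + (_ + X)]big1 => [|i /andP[ji ij]].
    rewrite addr0 [X in X + _](_ : _ = (low j)%:R); first by rewrite addrC subrK.
    by rewrite natr_sum; apply: eq_bigr => i ->.
  by rewrite (negbTE ji) (negbTE ij).
rewrite /weight_eval; under [RHS]eq_bigr do rewrite mulr_sumr big_mkcond /=.
rewrite exchange_big /=; apply: eq_bigr => j _.
rewrite rmorph_sum mulr_suml big_mkcond /=; apply: eq_bigr => i _.
by case: ifP.
Qed.

Lemma baby_verma_neq0 : exists x : baby_verma charKp b lam g, x != 0.
Proof.
have [d dE] := ex_eigen_expo.
pose w := proj (mpoly.mpolyX K (eigen_mnm p d)).
have w0 : w != 0.
  apply/eqP; rewrite -(subrr w) -projB => /lmod_projP; rewrite subrr subr0.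
  exact: eigen_not_ideal.
have w_eigen X : b X -> sl_op X w = weight_eval lam (conj X) *: w.
  move=> /b_upper Xup; rewrite sl_op_proj -projZ; apply/lmod_projP.
  by rewrite -dE; exact: field_op_eigen.
eexists; apply: (tensor_neq0 sl_op_linear sl_op_linearl sl_op_bracket sl_op_pmap _ w0).
move=> u m m' [a ua ->].
rewrite -[m *: w]addr0 (red_act_is_linear sl_op_linear) (red_act_x0 sl_op_linear) addr0.
suff -> : red_act sl_op u w = a *: w by rewrite scalerA mulrC.
elim: ua => [X bX|c|u1 u2 a1 a2 _ IH1 _ IH2|u1 u2 a1 a2 _ IH1 _ IH2].
- rewrite (red_act_gen sl_op_linear sl_op_linearl sl_op_bracket sl_op_pmap).
  exact: w_eigen.
- exact: (red_act_scalar sl_op_linear sl_op_linearl sl_op_bracket sl_op_pmap).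
- rewrite (red_actD sl_op_linear sl_op_linearl sl_op_bracket sl_op_pmap) IH1 IH2.
  by rewrite scalerDl.
rewrite (red_actM sl_op_linear sl_op_linearl sl_op_bracket sl_op_pmap) IH2.
rewrite -[a2 *: w]addr0 (red_act_is_linear sl_op_linear) (red_act_x0 sl_op_linear) addr0.
by rewrite IH1 scalerA mulrC.
Qed.

End NonZero.

(** * Upper triangular matrices and flags *)

Section UpperTriangular.
Variable K : fieldType.

Definition block_upper n t (A : 'M[K]_n) : Prop :=
  forall i j : 'I_n, (t <= i)%N -> (j < t)%N -> A i j = 0.

Lemma block_upper_mul n t (A B : 'M[K]_n) :
  block_upper t A -> block_upper t B -> block_upper t (A *m B).
Proof.
move=> At Bt i j ti jt; rewrite mxE big1 // => l _.
have [tl|lt] := leqP t l; first by rewrite Bt ?mulr0.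
by rewrite At ?mul0r.
Qed.

(** By Cayley-Hamilton the inverse of A is a polynomial in A. *)
Lemma block_upper_inv n t (A B : 'M[K]_n) : A *m B = 1%:M ->
  block_upper t A -> block_upper t B.
Proof.
case: n A B => [|n] A B AB At; first by move=> [].
have [Au Bu] := mulmx1_unit AB.
have hornerAt (q : {poly K}) : block_upper t (horner_mx A q).
  elim/poly_ind: q => [|q a IHq]; first by rewrite rmorph0 => i j _ _; rewrite mxE.
  rewrite rmorphD rmorphM /= horner_mx_X horner_mx_C => i j ti jt.
  rewrite mxE (block_upper_mul IHq At ti jt) add0r mxE (_ : (i == j) = false) //.
  by apply/eqP => ij; move: ti; rewrite ij leqNgt jt.
have [q [a qE]] : exists q a, char_poly A = q * 'X + a%:P.
  by elim/poly_ind: (char_poly A) => [|q a _]; [exists 0, 0; rewrite mul0r addr0 | exists q, a].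
have a0 : a != 0.
  have := char_poly_det A; rewrite qE coefD coefMX coefC add0r /= => ->.
  by rewrite mulf_neq0 ?expf_neq0 ?oppr_eq0 ?oner_neq0 // -unitfE -unitmxE.
have BE : B = (- a^-1) *: horner_mx A q.
  have := Cayley_Hamilton A; rewrite qE rmorphD rmorphM /= horner_mx_X horner_mx_C.
  move/(congr1 (fun C => C *m B)); rewrite mul0mx mulmxDl -[_ * A]/(_ *m A).
  rewrite -mulmxA AB mulmx1 mul_scalar_mx => /eqP; rewrite addr_eq0 => /eqP ->.
  by rewrite scalerN scaleNr opprK scalerA mulVf // scale1r.
by move=> i j ti jt; rewrite BE mxE hornerAt ?mulr0.
Qed.

Lemma upper_block n (A : 'M[K]_n) : upper_triangular A <-> forall t, block_upper t A.
Proof.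
split=> [Aup t i j ti jt|At i j ji]; first by rewrite Aup // (leq_trans jt).
exact: (At i).
Qed.

Lemma upper_inv n (A B : 'M[K]_n) : A *m B = 1%:M ->
  upper_triangular A -> upper_triangular B.
Proof.
by move=> AB /upper_block At; apply/upper_block => t; exact: block_upper_inv AB (At t).
Qed.

Lemma upper_mul n (A B : 'M[K]_n) :
  upper_triangular A -> upper_triangular B -> upper_triangular (A *m B).
Proof.
move=> /upper_block At /upper_block Bt; apply/upper_block => t.
exact: block_upper_mul.
Qed.

(* The flag of coordinate subspaces is the only complete flag stable under    *)
(* all strictly upper triangular matrix units.                                *)
Lemma upper_normaliser n (A B : 'M[K]_n) : A *m B = 1%:M -> B *m A = 1%:M ->
  (forall a b : 'I_n, (a < b)%N -> upper_triangular (A *m delta_mx a b *m B)) ->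
  upper_triangular A.
Proof.
move=> AB BA AEB i a ai; apply/eqP/negPn/negP => Aia.
(* The (i, j) entry of A E_(a, b) B is A i a * B b j. For j <= a < i it is 0, and A i a is not. *)
have Bt : block_upper a.+1 B.
  move=> b j ab ja; have := AEB a b ab i j (leq_ltn_trans (ja : (j <= a)%N) ai).
  rewrite mxE (bigD1 b) //= big1 => [|l lb].
    rewrite addr0 mxE (bigD1 a) //= big1 => [|l la]; last first.
      by rewrite mxE (negbTE la) mulr0.
    by rewrite mxE !eqxx mulr1 addr0 => /eqP; rewrite mulf_eq0 (negbTE Aia) => /eqP.
  rewrite mxE big1 ?mul0r // => m _.
  by rewrite mxE (negbTE lb) andbF mulr0.
by move: Aia; rewrite (block_upper_inv BA Bt) ?eqxx.
Qed.

Definition strictly_upper n (A : 'M[K]_n) : Prop :=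
  forall i j : 'I_n, (j <= i)%N -> A i j = 0.

Lemma upper_mul_strict n (A B : 'M[K]_n) :
  upper_triangular A -> strictly_upper B -> strictly_upper (A *m B).
Proof.
move=> Aup Bup i j ji; rewrite mxE big1 // => l _.
have [li|il] := ltnP l i; first by rewrite Aup ?mul0r.
by rewrite Bup ?mulr0 // (leq_trans ji).
Qed.

Lemma strict_mul_upper n (A B : 'M[K]_n) :
  strictly_upper A -> upper_triangular B -> strictly_upper (A *m B).
Proof.
move=> Aup Bup i j ji; rewrite mxE big1 // => l _.
have [li|il] := leqP l i; first by rewrite Aup ?mul0r.
by rewrite Bup ?mulr0 // (leq_ltn_trans ji).
Qed.

Lemma upper_mul_diag n (A B : 'M[K]_n) i :
  upper_triangular A -> upper_triangular B -> (A *m B) i i = A i i * B i i.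
Proof.
move=> Aup Bup; rewrite mxE (bigD1 i) //= big1 ?addr0 // => l li.
have [il|li'] := ltnP i l; first by rewrite Bup ?mulr0.
by rewrite Aup ?mul0r // ltn_neqAle li'; rewrite -val_eqE in li; rewrite li.
Qed.

Lemma sum_nat_delta n (x : nat) (F : nat -> K) : (x < n)%N ->
  \sum_(i < n) ((i : nat) == x)%:R * F i = F x.
Proof.
move=> xn; rewrite (bigD1 (Ordinal xn)) //= eqxx mul1r big1 ?addr0 // => i ix.
by rewrite -val_eqE /= in ix; rewrite (negbTE ix) mul0r.
Qed.

End UpperTriangular.

(** * The basis adapted to the flag *)

Section FlagBasis.
Variables (K : fieldType) (n j : nat) (alpha : K).
Hypothesis jn : (j < n.-1)%N.

(* The positions 0, ..., n - 1 in [flag_basis n j.+1 alpha] correspond to the *)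
(* labels 0, ..., j, n - 1, j + 1, ..., n - 2 of standard basis vectors.      *)
Definition label (q : nat) : nat :=
  if (q <= j)%N then q else if q == j.+1 then n.-1 else q.-1.

Definition flag_coef (i q : nat) : K :=
  (i == label q)%:R + ((q == j) && (i == n.-1))%:R * alpha.

Definition flag_inv_coef (q i : nat) : K :=
  (i == label q)%:R - ((q == j.+1) && (i == j))%:R * alpha.

Definition flag_mx : 'M[K]_n := \matrix_(i, q) flag_coef i q.
Definition flag_inv_mx : 'M[K]_n := \matrix_(q, i) flag_inv_coef q i.

Lemma label_lt q : (q < n)%N -> (label q < n)%N.
Proof. by rewrite /label; do !case: ifP; lia. Qed.

Lemma sum_flag_inv q (F : nat -> K) : (q < n)%N ->
  \sum_(i < n) flag_inv_coef q i * F i = F (label q) - (q == j.+1)%:R * alpha * F j.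
Proof.
move=> qn; rewrite -(sum_nat_delta F (label_lt qn)).
have jn' : (j < n)%N by lia.
rewrite -[F j](sum_nat_delta F jn') mulr_sumr -sumrB; apply: eq_bigr => i _.
rewrite /flag_inv_coef mulrBl; congr (_ - _).
by case: (q == _); case: (_ == j) => /=; rewrite ?mul0r ?mulr0 // !mul1r.
Qed.

Lemma flag_mxV : flag_inv_mx *m flag_mx = 1%:M.
Proof.
apply/matrixP => q q'; rewrite !mxE.
under eq_bigr do rewrite !mxE.
rewrite (sum_flag_inv (fun i => flag_coef i q')) // /flag_coef /label.
rewrite -val_eqE /=; have := ltn_ord q; have := ltn_ord q'; move: (q : nat) (q' : nat) => a b bn an.
have js : (j == n.-1) = false by lia.
have sj : (n.-1 == j) = false by lia.
have jj : (j == j.+1) = false by lia.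
have [->|ab] := eqVneq a b.
  have [->|bj] := eqVneq b j; first by rewrite leqnn /= !eqxx js jj /= !mul0r addr0 subr0.
  have [->|bj1] := eqVneq b j.+1; last by rewrite /= !mul0r subr0 addr0 eqxx.
  by rewrite ltnn ?eqxx /= ?eqxx ?js ?[j.+1 == j]eq_sym ?jj /= ?mul0r ?addr0 ?mulr0 ?subr0.
move: ab; have [->|aj1] := eqVneq a j.+1 => ab.
  rewrite ltnn; have [->|bj] := eqVneq b j.
    by rewrite leqnn ?eqxx /= ?eqxx ?sj ?js /= ?mul1r ?mul0r ?addr0 ?add0r ?mulr1 ?subrr.
  rewrite /= !mul0r !addr0 (_ : (n.-1 == _) = false); last by do !case: ifP; lia.
  by rewrite (_ : (j == _) = false) ?mulr0 ?subr0 //; do !case: ifP; lia.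
rewrite !mul0r subr0 (_ : (_ == _) = false); last by do !case: ifP; lia.
rewrite (_ : (_ && _) = false) ?mul0r ?addr0 //.
by do !case: ifP; lia.
Qed.

Lemma flag_mxK : flag_mx *m flag_inv_mx = 1%:M.
Proof. by apply: mulmx1C; exact: flag_mxV. Qed.

Lemma nth_flag_basis (q : 'I_n) : nth 0 (flag_basis n j.+1 alpha) q = col q flag_mx.
Proof.
have size1 : size [seq std_vec K n i | i <- index_iota 1 j.+1] = j.
  by rewrite size_map size_iota subn1.
rewrite /flag_basis nth_cat size1; case: ltnP => [qj|jq].
  rewrite (nth_map 0%N) ?size_iota ?nth_iota; try lia.
  apply/colP => i; rewrite !mxE /flag_coef /label (ltnW qj) add1n eqSS.
  by rewrite (_ : (nat_of_ord q == j) = false) ?mul0r ?addr0 //; lia.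
rewrite nth_cat /=; case: ltnP => [qj|qj].
  have [qE|qE] : nat_of_ord q = j \/ nat_of_ord q = j.+1 by lia.
    rewrite qE subnn /=; apply/colP => i; rewrite !mxE /flag_coef /label qE leqnn eqxx eqSS.
    rewrite /= mulrC; congr (_ + _%:R * _); have := ltn_ord i; lia.
  rewrite qE subSnn /=; apply/colP => i; rewrite !mxE /flag_coef /label qE ltnn eqxx.
  rewrite (_ : (j.+1 == j) = false) ?mul0r ?addr0; last by lia.
  by congr (_%:R); have := ltn_ord i; lia.
have qn := ltn_ord q.
rewrite (nth_map 0%N) ?size_iota ?nth_iota; try lia.
apply/colP => i; rewrite !mxE /flag_coef /label.
have [-> -> ->] : [/\ (q <= j)%N = false, (nat_of_ord q == j) = false
    & (nat_of_ord q == j.+1) = false] by split; lia.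
rewrite mul0r addr0.
by congr (_%:R); lia.
Qed.

Lemma size_flag_basis : size (flag_basis n j.+1 alpha) = n.
Proof. by rewrite /flag_basis !size_cat !size_map !size_iota /=; lia. Qed.

Lemma upper_borel (X : sl K n) (Y : 'M[K]_n) : upper_triangular Y ->
  sl_val X *m flag_mx = flag_mx *m Y -> borel j.+1 alpha X.
Proof.
move=> Yup XE m v; rewrite /flag; set t := take m _ => vt.
have st : (size t <= n)%N.
  by rewrite /t size_take size_flag_basis; case: ltnP; lia.
have tE (i : nat) (iq : (i < size t)%N) :
    nth 0 t i = col (Ordinal (leq_trans iq st)) flag_mx.
  rewrite -nth_flag_basis /t nth_take //.
  by apply: leq_trans iq _; rewrite /t size_take; case: ltnP; lia.
rewrite (coord_span (X := in_tuple t) vt) mulmx_sumr; apply: memv_suml => i _.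
rewrite -scalemxAr; apply: memvZ; rewrite (tE i (ltn_ord i)).
set q := Ordinal _; rewrite colE mulmxA XE -colE.
have -> : col q (flag_mx *m Y) = \sum_l Y l q *: col l flag_mx.
  apply/colP => a; rewrite !mxE summxE; apply: eq_bigr => l _.
  by rewrite !mxE mulrC.
apply: memv_suml => l _; have [ql|lq] := ltnP q l.
  by rewrite Yup // scale0r mem0v.
have lt : (l < size t)%N := leq_ltn_trans lq (ltn_ord i).
apply: memvZ; apply: memv_span; apply/(nthP 0); exists l => //.
by rewrite (tE l lt); congr (col _ _); apply: val_inj.
Qed.

End FlagBasis.

(** * The modules V(b_(k, alpha), lambda) *)

Section Weights.
Variables (K : fieldType) (p n : nat) (lam : weight n).
Hypothesis lam_reg : regular p lam.

(** The value of lam at E_(q, q) - 1/n, the traceless part of a diagonal matrix unit. *)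
Definition flag_weight (q : nat) : K :=
  \sum_(i < n.-1) (lam i)%:~R * \sum_(l < n | (l <= i)%N) ((nat_of_ord l == q)%:R - n%:R^-1).

(** For regular lam, the coefficient r_(l + 1) of lambda + rho as a natural number. *)
Definition gap (l : nat) : nat :=
  if insub l is Some i then `|((lam + rho n) i)%R|%N else 0%N.

Lemma gapE (i : 'I_n.-1) : (gap i)%:Z = lam i + 1.
Proof.
rewrite /gap valK gez0_abs; last exact/ltW/(lam_reg.1 i).
by rewrite !ffunE.
Qed.

Lemma gap_gt0 l : (l < n.-1)%N -> (0 < gap l)%N.
Proof.
move=> ln; have := lam_reg.1 (Ordinal ln); rewrite -ltz_nat.
by rewrite (gapE (Ordinal ln)) !ffunE.
Qed.

Lemma sum_gap : (\sum_(0 <= l < n.-1) gap l < p)%N.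
Proof.
rewrite -ltz_nat big_mkord; have := lam_reg.2; congr (_ < _).
rewrite -natz natr_sum; apply: eq_bigr => i _.
by rewrite natz gapE !ffunE.
Qed.

Lemma flag_weight_step q : (q < n.-1)%N ->
  flag_weight q - flag_weight q.+1 = (gap q)%:R - 1.
Proof.
move=> qn; have qn1 : (q < n)%N by lia.
have qn2 : (q.+1 < n)%N by lia.
rewrite -sumrB (bigD1 (Ordinal qn)) //= [X in _ + X = _]big1 => [|i iq].
  rewrite addr0 -mulrBr -sumrB (bigD1 (Ordinal qn1)) //= big1 => [|l /andP[lq lN]].
    rewrite eqxx (_ : (q == q.+1) = false); last by lia.
    rewrite addr0 opprB addrA subrK subr0 mulr1.
    rewrite -[(gap q)%:R]/((gap q)%:Z%:~R) (gapE (Ordinal qn)).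
    by rewrite rmorphD /= addrK.
  have -> : (nat_of_ord l == q) = false by apply/negbTE; rewrite -val_eqE in lN.
  by rewrite (_ : (nat_of_ord l == q.+1) = false) ?subrr //; lia.
rewrite -mulrBr -sumrB; apply/eqP; rewrite mulf_eq0; apply/orP; right; apply/eqP.
have [iq'|qi] := ltnP i q.
  apply: big1 => l li; rewrite (_ : (nat_of_ord l == q) = false); last by lia.
  by rewrite (_ : (nat_of_ord l == q.+1) = false) ?subrr //; lia.
have qi' : (q.+1 <= i)%N by rewrite ltn_neqAle qi andbT eq_sym; rewrite -val_eqE in iq.
rewrite (bigD1 (Ordinal qn1)) //= (bigD1 (Ordinal qn2)) /=; last first.
  by rewrite qi' -val_eqE /= gtn_eqF.
rewrite big1 => [|l /andP[/andP[_ l1] l2]]; last first.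
  have [-> ->] : (nat_of_ord l == q) = false /\ (nat_of_ord l == q.+1) = false.
    by rewrite -!val_eqE in l1 l2; split; apply/negbTE.
  exact: subrr.
have [-> ->] : (q == q.+1) = false /\ (q.+1 == q) = false by split; lia.
by rewrite !eqxx /=; ring.
Qed.

Lemma flag_weight_diff q m : (q + m <= n.-1)%N ->
  flag_weight q - flag_weight (q + m) = (\sum_(q <= l < q + m) gap l)%:R - m%:R.
Proof.
elim: m => [|m IHm] qm; first by rewrite addn0 big_geq // !subrr.
rewrite addnS big_nat_recr ?leq_addr //= natrD -natr1.
have := flag_weight_step (q := q + m); rewrite addnS in qm; move=> /(_ qm) st.
rewrite -[flag_weight q](subrK (flag_weight (q + m))) IHm ?(ltnW qm) //.
by rewrite -addrA st; ring.
Qed.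

Hypothesis charKp : p \in [pchar K].

Lemma flag_weight_fix q : flag_weight q ^+ p = flag_weight q.
Proof.
rewrite -(pFrobenius_autE charKp) rmorph_sum; apply: eq_bigr => i _.
rewrite rmorphM /= rmorph_int rmorph_sum; congr (_ * _); apply: eq_bigr => l _.
by rewrite rmorphB fmorphV /= !rmorph_nat.
Qed.

Lemma natr_pchar_neq0 m : (0 < m < p)%N -> m%:R != 0 :> K.
Proof.
move=> /andP[m0 mp]; rewrite -(dvdn_pcharf charKp); apply/negP => /(dvdn_leq m0).
by rewrite leqNgt mp.
Qed.

End Weights.

Section TracelessPart.
Variables (K : fieldType) (n : nat).
Hypothesis nK : n%:R != 0 :> K.

Lemma traceless_part_subproof (M : 'M[K]_n) :
  M - (\tr M / n%:R)%:M \in @traceless K n.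
Proof.
rewrite /in_mem /= /traceless mxtraceD raddfN /= mxtrace_scalar.
by rewrite -[_ *+ n]mulr_natr divfK // subrr.
Qed.

(** As n is invertible in K, gl_n is the sum of sl_n and the scalars, and this projection respects
    brackets. It gives all matrix units, diagonal ones included, a meaning in U_chi. *)
Definition traceless_part (M : 'M[K]_n) : sl K n := Sl (traceless_part_subproof M).

Lemma traceless_part_sl (X : sl K n) : traceless_part X = X.
Proof.
apply: val_inj => /=; have /eqP -> := sl_valP X.
by rewrite mul0r raddf0 subr0.
Qed.

Lemma traceless_part_linear a (M N : 'M[K]_n) :
  traceless_part (a *: M + N) = a *: traceless_part M + traceless_part N.
Proof.
apply: val_inj; rewrite [RHS]sl_val_linear /=.
rewrite mxtraceD mxtraceZ mulrDl raddfD /= -mulrA -scale_scalar_mx.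
by rewrite scalerBr opprD addrACA.
Qed.

Lemma traceless_part_bracket (M N : 'M[K]_n) :
  sl_bracket (traceless_part M) (traceless_part N) = traceless_part (M *m N - N *m M).
Proof.
apply: val_inj => /=; rewrite mxtraceD raddfN /= mxtrace_mulC subrr mul0r.
rewrite raddf0 subr0 !mulmxBl !mulmxBr !mul_mx_scalar !mul_scalar_mx.
rewrite !scale_scalar_mx [_ / _ * (\tr N / _)]mulrC.
move: (M *m N) (N *m M) (_ *: M) (_ *: N) (_%:M) => x y z w u.
by apply/matrixP => i k; rewrite !mxE; ring.
Qed.

End TracelessPart.

(** * Matrix units in U_chi, the highest weight vector, and the arithmetic of lambda *)

Section Assembly.
Variables (K : fieldType) (p n : nat) (charKp : p \in [pchar K]).
Hypothesis n_gt1 : (1 < n)%N.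
Hypothesis np : (n < p)%N.
Variables (lam : weight n) (j : nat) (alpha : K) (g : 'M[K]_n).
Hypothesis jn : (j < n.-1)%N.
Hypothesis lam_reg : regular p lam.
Hypothesis alpha0 : alpha != 0.
Hypothesis g_unit : g \in unitmx.
Hypothesis g_borel : conj_upper (borel j.+1 alpha) g.

Local Notation s := n.-1.

Lemma nK : n%:R != 0 :> K.
Proof. by apply: (natr_pchar_neq0 charKp); rewrite np ltnW. Qed.

Local Notation tpart := (traceless_part nK).
Local Notation U := (Uchi n charKp).
Local Notation c := (red_scalar (@sl_bracket K n) p (sl_pmap charKp) (@chi K n)).
Local Notation B := (flag_mx n j alpha).
Local Notation Bi := (flag_inv_mx n j alpha).

Definition mx_gen (M : 'M[K]_n) : U := Uchi_gen charKp (tpart M).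

Lemma mx_gen_linear a M N : mx_gen (a *: M + N) = c a * mx_gen M + mx_gen N.
Proof.
by rewrite /mx_gen traceless_part_linear; exact: red_gen_linear.
Qed.

Lemma mx_genD M N : mx_gen (M + N) = mx_gen M + mx_gen N.
Proof. by rewrite -[M]scale1r mx_gen_linear rmorph1 mul1r scale1r. Qed.

Lemma mx_gen0 : mx_gen 0 = 0.
Proof. by apply: (addrI (mx_gen 0)); rewrite -mx_genD !addr0. Qed.

Lemma mx_genZ a M : mx_gen (a *: M) = c a * mx_gen M.
Proof. by rewrite -[a *: M]addr0 mx_gen_linear mx_gen0 addr0. Qed.

Lemma mx_genB M N : mx_gen (M - N) = mx_gen M - mx_gen N.
Proof. by rewrite -scaleN1r mx_genD mx_genZ rmorphN rmorph1 mulN1r. Qed.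

Lemma mx_genMn M m : mx_gen (M *+ m) = mx_gen M *+ m.
Proof. by elim: m => [|m IHm]; rewrite ?mx_gen0 // !mulrS mx_genD IHm. Qed.

Lemma mx_gen_bracket M N :
  mx_gen M * mx_gen N = mx_gen N * mx_gen M + mx_gen (M *m N - N *m M).
Proof. by rewrite /mx_gen -(traceless_part_bracket nK); exact: red_gen_bracket. Qed.

Definition mx_unit (a b : nat) : 'M[K]_n :=
  \matrix_(i, k) ((nat_of_ord i == a) && (nat_of_ord k == b))%:R.

Lemma mx_unitM a b d e : (b < n)%N ->
  mx_unit a b *m mx_unit d e = mx_unit a e *+ (b == d).
Proof.
move=> bn; apply/matrixP => i k; rewrite !mxE.
under eq_bigr do rewrite !mxE.
rewrite (bigD1 (Ordinal bn)) //= big1 ?addr0 => [|l lb]; last first.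
  by rewrite -val_eqE /= in lb; rewrite (negbTE lb) andbF mul0r.
rewrite eqxx andbT mulmxnE !mxE.
by case: (b == d); case: (_ == a); case: (_ == e); rewrite ?mulr0 ?mul0r ?mulr1.
Qed.

Definition gl_gen (a b : nat) : U := mx_gen (mx_unit a b).

Lemma lie_gl_gen : lie_gl n gl_gen.
Proof.
move=> a b d e an bn dn en; rewrite /gl_gen mx_gen_bracket !mx_unitM //.
by rewrite mx_genB !mx_genMn addrA.
Qed.

Definition chi_mx : 'M[K]_n :=
  \matrix_(i, k) ((nat_of_ord k == i.+1) && (i.+2 < n)%N)%:R.

Lemma chi_mxE (X : sl K n) : chi X = \tr (X *m chi_mx).
Proof.
apply: eq_bigr => i _; rewrite mxE big_mkcond; apply: eq_bigr => k _.
by rewrite mxE; case: ifP => _; rewrite ?mulr1 ?mulr0.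
Qed.

Lemma sum_mx_unit a b (F : nat -> nat -> K) : (a < n)%N -> (b < n)%N ->
  \sum_(i < n) \sum_(k < n) mx_unit a b i k * F i k = F a b.
Proof.
move=> an bn; rewrite -(sum_nat_delta (F a) bn).
rewrite -(sum_nat_delta (fun i => \sum_(k < n) (nat_of_ord k == b)%:R * F i k) an).
apply: eq_bigr => i _; rewrite mulr_sumr; apply: eq_bigr => k _.
by rewrite mxE -mulnb natrM mulrA.
Qed.

Lemma chi_mx_unit a b : (a < n)%N -> (b < n)%N ->
  chi (tpart (mx_unit a b)) = chi_unit n 1 a b.
Proof.
move=> an bn; rewrite chi_mxE /= mulmxBl mul_scalar_mx raddfB /= mxtraceZ.
rewrite [\tr chi_mx]big1 => [|i _]; last by rewrite mxE ltn_eqF.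
rewrite mulr0 subr0 -[RHS](sum_mx_unit (chi_unit n 1) an bn).
apply: eq_bigr => i _; rewrite mxE; apply: eq_bigr => k _.
rewrite [chi_mx k i]mxE /chi_unit; congr (_ * _).
have [->|_] //= := eqVneq (nat_of_ord i) k.+1.
by rewrite (_ : (k.+2 < n) = (k.+1 < n.-1))%N; [case: ifP | lia].
Qed.

(** In the diagonal case the p-map fixes the traceless part because both the matrix unit and 1/n
    equal their p-th powers. *)
Lemma mx_unit_gen_exp a b : (a < n)%N -> (b < n)%N ->
  gl_gen a b ^+ p = (if a == b then gl_gen a b else 0) + c (chi_unit n 1 a b ^+ p).
Proof.
move=> an bn; have p_pr := pcharf_prime charKp.
rewrite [LHS]red_gen_pmap chi_mx_unit //; congr (_ + _).
have trE : \tr (mx_unit a b) = (a == b)%:R.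
  rewrite -(sum_mx_unit (fun i k => (i == k)%:R) an bn).
  apply: eq_bigr => i _; rewrite (bigD1 i) //= eqxx mulr1 big1 ?addr0 // => k ki.
  by rewrite -val_eqE eq_sym /= in ki; rewrite (negbTE ki) mulr0.
have scalC (x : K) (M : 'M[K]_n) : x%:M * M = M * x%:M.
  by apply/esym; exact: scalar_mxC.
have tE : sl_val (sl_pmap charKp (tpart (mx_unit a b))) =
    mx_unit a b ^+ p - ((\tr (mx_unit a b) / n%:R) ^+ p)%:M.
  by rewrite /= (pchar_subX charKp (c := @scalar_mx K n) scalC).
case: eqVneq trE => [ab|ab] trE.
  have MX m : mx_unit a b ^+ m.+1 = mx_unit a b.
    elim: m => [|m IHm]; first exact: expr1.
    by rewrite exprS IHm -[_ * _]/(_ *m _) mx_unitM // ab eqxx mulr1n.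
  congr red_gen; apply: val_inj; apply: etrans tE _.
  rewrite trE mul1r -(prednK (prime_gt0 p_pr)) MX.
  by rewrite /= trE mul1r prednK ?prime_gt0 // exprVn (fermat_pchar charKp).
rewrite -mx_gen0; congr red_gen; apply: val_inj; apply: etrans tE _.
rewrite trE /= mxtrace0 mul0r.
have p2 : p = (p - 2).+2 by lia.
rewrite expr0n (gtn_eqF (prime_gt0 p_pr)) p2 2!exprS mulrA.
have -> : mx_unit a b * mx_unit a b = 0.
  by rewrite -[_ * _]/(_ *m _) mx_unitM // eq_sym (negbTE ab).
by rewrite mul0r.
Qed.

Lemma reduced_gl_gen : reduced_gl p c n gl_gen 1.
Proof.
move=> a b an bn ab; rewrite /shifted_unit (pchar_subX charKp); last exact: red_scalarC.
by rewrite mx_unit_gen_exp // (negbTE ab) add0r subrr.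
Qed.

Lemma gl_gen_special : gl_gen s s ^+ p = gl_gen s s.
Proof.
rewrite mx_unit_gen_exp ?eqxx; try lia.
rewrite /chi_unit (_ : (s == s.+1) = false); last by lia.
by rewrite expr0n gtn_eqF ?rmorph0 ?addr0 //; lia.
Qed.

Lemma mulVB : g *m B *m (Bi *m invmx g) = 1%:M.
Proof. by rewrite mulmxA -[g *m B *m Bi]mulmxA flag_mxK // mulmx1 mulmxV. Qed.

Lemma mulBV : Bi *m invmx g *m (g *m B) = 1%:M.
Proof. exact: mulmx1C mulVB. Qed.

Lemma borel_traceless (Y : 'M[K]_n) : upper_triangular Y -> \tr Y = 0 ->
  exists2 X : sl K n, borel j.+1 alpha X & sl_val X = B *m Y *m Bi.
Proof.
move=> Yup trY; have trX : B *m Y *m Bi \in @traceless K n.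
  by rewrite /in_mem /= /traceless mxtrace_mulC mulmxA flag_mxV // mul1mx trY.
exists (Sl trX) => //; apply: upper_borel Yup _ => //=.
by rewrite -mulmxA flag_mxV // mulmx1.
Qed.

(** For a strictly upper triangular unit Y, the matrix B Y B^-1 lies in b_(k, alpha), so conjugation
    by g B keeps Y upper triangular and [upper_normaliser] applies. This is what makes the weight
    independent of g in [weight_eval_conj]. *)
Lemma gB_upper : upper_triangular (g *m B).
Proof.
apply: upper_normaliser mulVB mulBV _ => a b ab.
have [||X bX XE] := @borel_traceless (delta_mx a b).
- move=> i k ki; rewrite mxE; case: eqP => // ia; case: eqP => // kb.
  by move: ki; rewrite ia kb ltnNge ltnW.
- rewrite /mxtrace big1 // => i _; rewrite mxE; case: eqP => // ->.
  by rewrite -val_eqE /= ltn_eqF.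
have /g_borel := bX; rewrite XE; congr upper_triangular.
by rewrite !mulmxA.
Qed.

Lemma gBV_upper : upper_triangular (Bi *m invmx g).
Proof. exact: upper_inv mulVB gB_upper. Qed.

(** The matrix form of chi(b_(k, alpha)) = 0: [chi_mx] moves the chain down by one and kills v_n,
    hence sends each member of the flag into the preceding one. The vector after v_n goes to v_k =
    (v_k + alpha v_n) - alpha v_n. *)
Lemma flag_chi_strict : strictly_upper (Bi *m chi_mx *m B).
Proof.
move=> q q' qq; rewrite -mulmxA mxE.
have chiB (a : 'I_n) : (chi_mx *m B) a q' = (a.+2 < n)%:R * flag_coef n j alpha a.+1 q'.
  rewrite mxE; have [an|an] := ltnP a.+2 n; last first.
    by rewrite mul0r big1 // => k _; rewrite !mxE ltnNge an andbF mul0r.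
  have an1 : (a.+1 < n)%N by lia.
  rewrite mul1r -(sum_nat_delta (fun k => flag_coef n j alpha k q') an1).
  by apply: eq_bigr => k _; rewrite !mxE an andbT.
under eq_bigr do rewrite chiB mxE.
rewrite (sum_flag_inv alpha jn (fun a : nat => (a.+2 < n)%:R * flag_coef n j alpha a.+1 q')) //.
have qn := ltn_ord q; have qn' := ltn_ord q'.
have coef0 a : (a.+2 < n)%N -> a.+1 != label n j q' -> flag_coef n j alpha a.+1 q' = 0.
  move=> an aq; rewrite /flag_coef (negbTE aq) (_ : (a.+1 == n.-1) = false); last by lia.
  by rewrite andbF mul0r addr0.
have F0 a : ((a.+2 < n)%N -> a.+1 != label n j q') ->
    (a.+2 < n)%:R * flag_coef n j alpha a.+1 q' = 0.
  have [an /(_ isT) aq|_ _] := ltnP a.+2 n; last by rewrite mul0r.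
  by rewrite coef0 // mulr0.
rewrite F0 ?sub0r => [|lq]; last first.
  by apply/eqP; move: lq qq; rewrite /label; do !case: ifP; lia.
have [qj|_] := eqVneq (nat_of_ord q) j.+1; last by rewrite !mul0r oppr0.
rewrite F0 ?mulr0 ?oppr0 // => lq.
by apply/eqP; move: lq qq; rewrite qj /label; do !case: ifP; lia.
Qed.

(** The twist e is the conjugate of [chi_mx] by g, so that tr(g X g^-1 e) = chi X; it is strictly
    upper triangular because g B is upper triangular. *)
Lemma module_neq0 : exists x : baby_verma charKp (borel j.+1 alpha) lam g, x != 0.
Proof.
apply: (@baby_verma_neq0 _ _ _ _ _ _ _ (g *m chi_mx *m invmx g)) => // [|X].
  have -> : g *m chi_mx *m invmx g =
      g *m B *m (Bi *m chi_mx *m B) *m (Bi *m invmx g).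
    rewrite !mulmxA -[g *m B *m Bi]mulmxA flag_mxK // mulmx1.
    by rewrite -[_ *m B *m Bi]mulmxA flag_mxK // mulmx1.
  apply: strict_mul_upper; last exact: gBV_upper.
  exact: upper_mul_strict gB_upper flag_chi_strict.
rewrite chi_mxE !mulmxA mulmxKV // mxtrace_mulC -!mulmxA mxtrace_mulC.
by rewrite [in RHS]mxtrace_mulC -!mulmxA mulVmx // mulmx1.
Qed.

Local Notation V := (baby_verma charKp (borel j.+1 alpha) lam g).

Definition hw : V := lmod_proj _ (free_elt 1 1).

Lemma scale_free_elt (u u' : U) (m : K) : u *: free_elt u' m = free_elt (u * u') m.
Proof.
apply/malgP => k; rewrite [LHS]free_scaleE /free_elt !mcoeffU.
by rewrite mulrnAr.
Qed.

Lemma hw_act u a : weight_action (borel j.+1 alpha) lam g u a -> u *: hw = c a *: hw.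
Proof.
have balanced u' a' : weight_action (borel j.+1 alpha) lam g u' a' ->
    u' *: hw = lmod_proj _ (free_elt 1 a') :> V.
  move=> u'a'; rewrite /hw -linearZ /= scale_free_elt mulr1; apply/lmod_projP.
  apply: Span_gen; rewrite -[u' in free_elt u' 1]mul1r; apply: Tensor_balanced.
  by exists a'; rewrite ?mulr1.
by move=> ua; rewrite (balanced _ _ ua) (balanced _ _ (@Act_scalar _ _ _ charKp _ _ _ a)).
Qed.

Lemma hw_gen (T : V -> Prop) : T hw ->
  (forall x y, T x -> T y -> T (x + y)) -> (forall a x, T x -> T (c a *: x)) ->
  (forall a b x, (a < n)%N -> (b < n)%N -> T x -> T (gl_gen a b *: x)) ->
  forall x, T x.
Proof.
move=> Tv TD TZ TE.
have T0 : T 0 by have := TZ 0 _ Tv; rewrite rmorph0 scale0r.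
have TX X x : T x -> T (Uchi_gen charKp X *: x).
  move=> Tx.
  have -> : Uchi_gen charKp X = \sum_(a < n) \sum_(b < n) c (sl_val X a b) * gl_gen a b.
    have -> : Uchi_gen charKp X = mx_gen (sl_val X) by rewrite /mx_gen traceless_part_sl.
    rewrite {1}[sl_val X]matrix_sum_delta.
    rewrite (big_morph mx_gen mx_genD mx_gen0); apply: eq_bigr => a _.
    rewrite (big_morph mx_gen mx_genD mx_gen0); apply: eq_bigr => b _.
    rewrite mx_genZ; congr (_ * mx_gen _).
    by apply/matrixP => i k; rewrite !mxE -!val_eqE.
  rewrite scaler_suml; elim/big_ind: _ => // a _.
  rewrite scaler_suml; elim/big_ind: _ => // b _.
  by rewrite -scalerA; apply/TZ/TE.
have TU (u : U) x : T x -> T (u *: x).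
  pose P (f : free_alg (sl K n)) : U := quot_proj _ (quot_proj _ f).
  have PD f f' : P (f + f') = P f + P f'.
    exact: etrans (congr1 _ (quot_projD _ f f')) (quot_projD _ _ _).
  have PM f f' : P (f * f') = P f * P f'.
    exact: etrans (congr1 _ (quot_projM _ f f')) (quot_projM _ _ _).
  have -> : u = P (repr (repr u)) by rewrite /P !quot_projK.
  move: (repr (repr u)) => f Tx.
  move: f; apply: free_alg_ind => [|f f' Tf Tf'|a|X f Tf].
  - by rewrite [P 0](_ : _ = 0) ?scale0r //; apply: (addrI (P 0)); rewrite -PD !addr0.
  - by rewrite PD scalerDl; exact: TD.
  - exact: TZ.
  - by rewrite PM -scalerA; exact: TX.
move=> x; rewrite -[x]lmod_projK; move: (repr x) => f; rewrite [f]monalgE.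
pose pr : free_lmod U K -> V := lmod_proj _.
rewrite -[lmod_proj _ _]/(pr _) (big_morph pr (lmod_projD _) (raddf0 _)).
elim/big_ind: _ => // m _.
have -> : pr << f@_m *g m >> = f@_m *: pr (free_elt 1 m).
  by rewrite -[RHS]lmod_projZ scale_free_elt mulr1.
rewrite /pr; apply: TU; have -> : lmod_proj _ (free_elt 1 m) = c m *: hw :> V; last exact: TZ.
rewrite /hw -linearZ /= scale_free_elt; apply/esym/lmod_projP; apply: Span_gen.
rewrite mulr1 -[c m]mul1r; apply: Tensor_balanced.
by exists m; [exact: Act_scalar | rewrite mulr1].
Qed.

Lemma upper_sub_scalar (Y : 'M[K]_n) a :
  upper_triangular Y -> upper_triangular (Y - a%:M).
Proof.
move=> Yup i k ki; rewrite !mxE Yup // sub0r (_ : (i == k) = false) ?mulr0n ?oppr0 //.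
by rewrite -val_eqE /= gtn_eqF.
Qed.

Definition diag_weight (Y : 'M[K]_n) : K := \sum_(q < n) flag_weight K lam q * Y q q.

Lemma weight_eval_conj (Y : 'M[K]_n) : upper_triangular Y ->
  weight_eval lam (g *m B *m (Y - (\tr Y / n%:R)%:M) *m (Bi *m invmx g)) = diag_weight Y.
Proof.
move=> Yup; set Z := Y - _.
have Zup : upper_triangular Z by exact: upper_sub_scalar.
have diagE (q : 'I_n) : (g *m B *m Z *m (Bi *m invmx g)) q q = Y q q - \tr Y / n%:R.
  have gBZ := upper_mul gB_upper Zup.
  rewrite (upper_mul_diag _ gBZ gBV_upper) (upper_mul_diag _ gB_upper Zup).
  rewrite mulrAC -(upper_mul_diag _ gB_upper gBV_upper) mulVB !mxE eqxx mulr1n.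
  by rewrite mul1r mulr1n.
rewrite /weight_eval /diag_weight /flag_weight.
under [RHS]eq_bigr do rewrite mulr_suml.
rewrite exchange_big /=; apply: eq_bigr => i _.
under [RHS]eq_bigr do rewrite -mulrA.
rewrite -mulr_sumr; congr (_ * _); rewrite /fund_weight.
under eq_bigr do rewrite diagE.
under [RHS]eq_bigr do rewrite mulr_suml.
rewrite exchange_big /=; apply: eq_bigr => l _.
under eq_bigr do rewrite mulrBl.
rewrite sumrB -mulr_sumr [_^-1 * _]mulrC; congr (_ - _).
rewrite (bigD1 l) //= eqxx mul1r big1 ?addr0 // => q ql.
by rewrite -val_eqE eq_sym /= in ql; rewrite (negbTE ql) mul0r.
Qed.

Lemma flag_act M : upper_triangular (Bi *m M *m B) ->
  mx_gen M *: hw = c (diag_weight (Bi *m M *m B)) *: hw.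
Proof.
set Y := Bi *m M *m B => Yup.
have BY : B *m Y = M *m B by rewrite /Y !mulmxA flag_mxK // mul1mx.
have trY : \tr Y = \tr M by rewrite mxtrace_mulC mulmxA flag_mxK // mul1mx.
have XE : sl_val (tpart M) *m B = B *m (Y - (\tr Y / n%:R)%:M).
  by rewrite /= mulmxBl mulmxBr BY mul_scalar_mx mul_mx_scalar trY.
have Zup := upper_sub_scalar (\tr Y / n%:R) Yup.
apply: hw_act; rewrite -weight_eval_conj // /mx_gen.
have -> : g *m B *m (Y - (\tr Y / n%:R)%:M) *m (Bi *m invmx g) =
    g *m sl_val (tpart M) *m invmx g.
  rewrite -[g *m B *m _]mulmxA -XE !mulmxA -[_ *m B *m Bi]mulmxA flag_mxK //.
  by rewrite mulmx1.
by apply: Act_gen; apply: upper_borel Zup XE.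
Qed.

Lemma flag_conj_unit a b (q q' : 'I_n) : (a < n)%N -> (b < n)%N ->
  (Bi *m mx_unit a b *m B) q q' =
  flag_inv_coef n j alpha q a * flag_coef n j alpha b q'.
Proof.
move=> an bn; rewrite -mulmxA mxE.
rewrite -[RHS](sum_mx_unit (fun a b => flag_inv_coef n j alpha q a * flag_coef n j alpha b q') an bn).
apply: eq_bigr => i _; rewrite !mxE mulr_sumr; apply: eq_bigr => k _.
by rewrite !mxE mulrCA.
Qed.

Lemma flag_act_strict M : strictly_upper (Bi *m M *m B) -> mx_gen M *: hw = 0.
Proof.
move=> Ys; rewrite flag_act => [|q q' qq]; last by rewrite Ys // ltnW.
by rewrite /diag_weight big1 ?rmorph0 ?scale0r // => q _; rewrite Ys ?mulr0.
Qed.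

Lemma flag_act_diag M m : (m < n)%N ->
  (forall q q' : 'I_n, (Bi *m M *m B) q q' =
     (nat_of_ord q == m)%:R * (nat_of_ord q' == m)%:R) ->
  mx_gen M *: hw = c (flag_weight K lam m) *: hw.
Proof.
move=> mn YE; rewrite flag_act => [|q q' qq]; last first.
  rewrite YE; have [qm|] := eqVneq (nat_of_ord q) m; last by rewrite mul0r.
  by have -> : (nat_of_ord q' == m) = false; [lia | rewrite mulr0].
suff -> : diag_weight (Bi *m M *m B) = flag_weight K lam m by [].
rewrite -[RHS](sum_nat_delta (flag_weight K lam) mn).
apply: eq_bigr => q _; rewrite YE mulrC; congr (_ * _).
by case: eqP; rewrite ?mulr1 ?mul0r.
Qed.

Local Notation fi := (flag_inv_coef n j alpha).
Local Notation fc := (flag_coef n j alpha).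

(** The inverse of [label] on the chain; position j + 1 is taken by v_n. *)
Definition chain_pos (a : nat) : nat := if (a <= j)%N then a else a.+1.

Lemma label_eq a q : (q < n)%N -> (a < s)%N -> (a == label n j q) = (q == chain_pos a).
Proof. by rewrite /label /chain_pos; do !case: ifP; lia. Qed.

Lemma label_special q : (q < n)%N -> (s == label n j q) = (q == j.+1).
Proof. by rewrite /label; do !case: ifP; lia. Qed.

Lemma fi_chain a q : (q < n)%N -> (a < s)%N -> a != j -> fi q a = (q == chain_pos a)%:R.
Proof.
by move=> qn an aj; rewrite /flag_inv_coef label_eq // (negbTE aj) andbF mul0r subr0.
Qed.

Lemma fi_fork q : (q < n)%N -> fi q j = (q == j)%:R - (q == j.+1)%:R * alpha.
Proof.
by move=> qn; rewrite /flag_inv_coef label_eq // /chain_pos leqnn eqxx andbT.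
Qed.

Lemma fi_special q : (q < n)%N -> fi q s = (q == j.+1)%:R.
Proof.
move=> qn; rewrite /flag_inv_coef label_special // (gtn_eqF jn) andbF.
by rewrite mul0r subr0.
Qed.

Lemma fc_chain b q : (q < n)%N -> (b < s)%N -> fc b q = (q == chain_pos b)%:R.
Proof.
move=> qn bn; rewrite /flag_coef label_eq // (ltn_eqF bn) andbF.
by rewrite mul0r addr0.
Qed.

Lemma fc_special q : (q < n)%N -> fc s q = (q == j.+1)%:R + (q == j)%:R * alpha.
Proof. by move=> qn; rewrite /flag_coef label_special // eqxx andbT. Qed.

Lemma fi_support a q : fi q a != 0 -> deg n j (label n j q) = deg n j a.
Proof.
rewrite /flag_inv_coef; have [-> //|_] := eqVneq a (label n j q).
rewrite sub0r oppr_eq0 mulf_eq0 negb_or => /andP[].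
have [/andP[/eqP-> /eqP->] _ _|_] := boolP ((q == j.+1) && (a == j)); last by rewrite eqxx.
by rewrite /deg /label ltnn !eqxx (ltn_eqF jn).
Qed.

Lemma fc_support b q : fc b q != 0 -> deg n j (label n j q) = deg n j b.
Proof.
rewrite /flag_coef; have [-> //|_] := eqVneq b (label n j q).
rewrite add0r mulf_eq0 negb_or => /andP[].
have [/andP[/eqP-> /eqP->] _ _|_] := boolP ((q == j) && (b == s)); last by rewrite eqxx.
by rewrite /deg /label leqnn !eqxx (ltn_eqF jn).
Qed.

Lemma deg_label_mono q q' : (q' <= q)%N -> (q < n)%N ->
  (deg n j (label n j q') <= deg n j (label n j q))%N.
Proof. by rewrite /deg /label; do !case: ifP; lia. Qed.

(** The change of basis mixes only the labels j and n - 1, which have the same degree. A unit of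
    negative degree therefore stays strictly upper triangular in the flag basis. *)
Lemma hw_neg a b : (a < n)%N -> (b < n)%N -> (deg n j a < deg n j b)%N ->
  gl_gen a b *: hw = 0.
Proof.
move=> an bn ab; apply: flag_act_strict => q q' qq; rewrite flag_conj_unit //.
apply/eqP; rewrite mulf_eq0; apply/negPn; rewrite negb_or.
apply/negP => /andP[/fi_support qa /fc_support qb].
by have := deg_label_mono qq (ltn_ord q); rewrite qa qb leqNgt ab.
Qed.

Definition hw_weight (a : nat) : K := flag_weight K lam (chain_pos a).

Lemma hw_diag a : (a < s)%N -> a != j -> gl_gen a a *: hw = c (hw_weight a) *: hw.
Proof.
move=> an aj; apply: flag_act_diag => [|q q'].
  by rewrite /chain_pos; case: ifP; lia.
by rewrite flag_conj_unit ?fi_chain ?fc_chain //; lia.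
Qed.

Lemma flag_conj_linear a M N q q' : (Bi *m (a *: M + N) *m B) q q' =
  a * (Bi *m M *m B) q q' + (Bi *m N *m B) q q'.
Proof. by rewrite mulmxDr mulmxDl -scalemxAr -scalemxAl !mxE. Qed.

Lemma flag_conj_sub M N q q' : (Bi *m (M - N) *m B) q q' =
  (Bi *m M *m B) q q' - (Bi *m N *m B) q q'.
Proof. by rewrite mulmxBr mulmxBl !mxE. Qed.

Let jn1 : (j < n)%N. Proof. by lia. Qed.
Let sn1 : (s < n)%N. Proof. by lia. Qed.

Lemma chain_pos_fork : chain_pos j = j.
Proof. by rewrite /chain_pos leqnn. Qed.

Lemma hw_fork : (gl_gen j j + c alpha * gl_gen s j) *: hw = c (hw_weight j) *: hw.
Proof.
rewrite addrC -mx_gen_linear /hw_weight chain_pos_fork.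
apply: flag_act_diag jn1 _ => q q'.
rewrite flag_conj_linear !flag_conj_unit // fi_fork // fi_special // fc_chain //.
by rewrite chain_pos_fork; ring.
Qed.

Lemma hw_special : (gl_gen s s - c alpha * gl_gen s j) *: hw =
  c (flag_weight K lam j.+1) *: hw.
Proof.
rewrite addrC -mulNr -rmorphN -mx_gen_linear.
apply: flag_act_diag => [|q q']; first by lia.
rewrite flag_conj_linear !flag_conj_unit // fi_special // fc_chain // fc_special //.
by rewrite chain_pos_fork; ring.
Qed.

Lemma hw_fork_special :
  (gl_gen j s + c alpha * (gl_gen s s - gl_gen j j) - c (alpha ^+ 2) * gl_gen s j) *: hw = 0.
Proof.
rewrite -mx_genB [gl_gen j s + _]addrC -mx_gen_linear addrC -mulNr -rmorphN -mx_gen_linear.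
apply: flag_act_strict => q q' qq; rewrite flag_conj_linear flag_conj_linear.
rewrite flag_conj_sub !flag_conj_unit // fi_special // fi_fork //.
rewrite fc_chain // fc_special // chain_pos_fork.
have : (nat_of_ord q == j)%:R * (nat_of_ord q' == j.+1)%:R = 0 :> K.
  rewrite -natrM mulnb; suff -> : (nat_of_ord q == j) && (nat_of_ord q' == j.+1) = false by [].
  by lia.
move=> y0; apply: etrans y0; ring.
Qed.

Definition gaps a b := (\sum_(a <= l < b) gap lam l)%N.

Lemma gaps_cat a b d : (a <= b <= d)%N -> (gaps a b + gaps b d)%N = gaps a d.
Proof. by move=> /andP[ab bd]; rewrite /gaps -big_cat_nat //. Qed.

Lemma gaps_bound a b : (b <= s)%N -> (gaps a b < p)%N.
Proof.
move=> bs; apply: leq_ltn_trans (sum_gap lam_reg); rewrite -/(gaps 0 s).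
have [ab|ba] := leqP a b; last by rewrite /gaps big_geq // ltnW.
rewrite -(@gaps_cat 0 a s) ?(leq_trans ab) // -(@gaps_cat a b s) ?ab //.
by rewrite addnCA leq_addr.
Qed.

Lemma hw_weight_diff q m : (q + m <= s)%N ->
  flag_weight K lam q - flag_weight K lam (q + m) = (gaps q (q + m))%:R - m%:R.
Proof. exact: (flag_weight_diff K lam_reg). Qed.

(** The scalar telescopes to gaps a j + i + 1, which is below gaps a j + gaps j s = gaps a s < p. *)
Lemma raise_ok i a : (i < (gaps j s).-1)%N -> (a <= j)%N ->
  hw_weight a - (hw_weight j - i%:R) + (j.+1 - a)%:R != 0.
Proof.
move=> iR aj; rewrite /hw_weight chain_pos_fork /chain_pos aj.
have := @hw_weight_diff a (j - a); rewrite subnKC // => /(_ (ltnW jn)) E.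
have -> : flag_weight K lam a - (flag_weight K lam j - i%:R) + (j.+1 - a)%:R =
    (gaps a j + i.+1)%:R.
  by rewrite opprB addrCA E subSn // natrD -!natr1; ring.
apply: (natr_pchar_neq0 charKp); rewrite addnS ltn0Sn andTb.
have := gaps_bound a (leqnn s); have := @gaps_cat a j s.
rewrite aj ltnW // => /(_ isT) <-; move: iR.
move: (gaps a j) (gaps j s) => x y; clear; lia.
Qed.

(** The scalar is gaps j (b + 1) + i: positive because each r is, and below p because gaps j (b + 1)
    <= gaps j s. *)
Lemma lower_ok i b : (i < p - gaps j s)%N -> (j < b < s)%N ->
  hw_weight j + i%:R - hw_weight b + (b - j).+1%:R != 0.
Proof.
move=> iR /andP[jb bs]; rewrite /hw_weight chain_pos_fork /chain_pos leqNgt jb /=.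
have jbE : (j + (b - j).+1 = b.+1)%N by lia.
have := @hw_weight_diff j (b - j).+1; rewrite jbE => /(_ bs) E.
have -> : flag_weight K lam j + i%:R - flag_weight K lam b.+1 + (b - j).+1%:R =
    (gaps j b.+1 + i)%:R.
  by rewrite [_ + i%:R - _]addrAC E natrD; ring.
apply: (natr_pchar_neq0 charKp).
have jb' : (j < b.+1)%N by exact: ltnW.
have : (0 < gaps j b.+1)%N by rewrite /gaps big_ltn // addn_gt0 (gap_gt0 lam_reg).
have : (gaps j b.+1 + gaps b.+1 s = gaps j s)%N by rewrite gaps_cat // (ltnW jb') bs.
move: iR; move: (gaps j b.+1) (gaps j s) (gaps b.+1 s) => x y z; clear; lia.
Qed.

Lemma lower_ok_special i : (i < p - gaps j s)%N ->
  hw_weight j + i%:R + 1 - flag_weight K lam j.+1 != 0.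
Proof.
move=> iR; rewrite /hw_weight chain_pos_fork.
have E := flag_weight_step K lam_reg jn.
have -> : flag_weight K lam j + i%:R + 1 - flag_weight K lam j.+1 = (gap lam j + i)%:R.
  by rewrite natrD -[(gap lam j)%:R](subrK 1) -E; ring.
apply: (natr_pchar_neq0 charKp); have := gap_gt0 lam_reg jn.
have : gaps j s = (gap lam j + gaps j.+1 s)%N by rewrite /gaps big_ltn.
move: iR; move: (gaps j s) (gaps j.+1 s) (gap lam j) => x y z; clear; lia.
Qed.

Lemma borel_verma_indecomposable : indecomposable V.
Proof.
have p_gt2 : (2 < p)%N by exact: leq_ltn_trans np.
have R_bound : (0 < gaps j s <= p)%N.
  rewrite (ltnW (gaps_bound j (leqnn s))) andbT.
  by rewrite /gaps big_ltn // addn_gt0 (gap_gt0 lam_reg).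
have cC (a : K) (u : U) : c a * u = u * c a by exact: red_scalarC.
have fixj : hw_weight j ^+ p = hw_weight j by exact: flag_weight_fix.
have ind := cyclic_indecomposable charKp cC n_gt1 p_gt2 lie_gl_gen
  reduced_gl_gen (oner_neq0 _) gl_gen_special jn alpha0 hw_neg hw_diag hw_fork
  hw_special hw_fork_special hw_gen fixj R_bound raise_ok lower_ok lower_ok_special.
apply: ind.
exact: module_neq0.
Qed.

End Assembly.

Theorem proposition8p3 (n p : nat) (K : closedFieldType)
    (charKp : p \in [pchar K]) (lam : weight n) (k : nat) (alpha : K)
    (g : 'M[K]_n) :
  (2 <= n)%N -> prime p -> (n < p)%N ->
  regular p lam ->
  (1 <= k <= n.-1)%N -> alpha != 0 ->
  \det g = 1 -> conj_upper (borel k alpha) g ->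
  indecomposable (baby_verma charKp (borel k alpha) lam g).
Proof.
case: k => // j n_gt1 _ np lam_reg /andP[_ jn] alpha0 det_g.
by apply: borel_verma_indecomposable; rewrite // unitmxE det_g unitr1.
Qed.
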